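(* Let $P\ge 2$, let $j_1<j_2$ be fixed integers (scales), and let $\Xi\subset\mathbb{R}^d$ be a compact parameter set such that each $\Theta\in\Xi$ specifies the law of an $\mathbb{R}^P$-valued operator fractional Brownian motion (OfBm) with wavelet spectrum $E(2^j,\Theta)\in\mathbb{R}^{P\times P}$, $j=j_1,\dots,j_2$. Let the observed process $Y$ be the OfBm with true parameter $\Theta_0\in\Xi$, let $S(2^j)$ be its sample wavelet spectrum from sample size $N$, and let $C_N$ be the objective function $$C_N(\Theta)=\sum_{1\le i_1\le i_2\le P}\ \sum_{j=j_1}^{j_2}\Big(\log_2|S_{i_1,i_2}(2^j)|-\log_2|E_{i_1,i_2}(2^j,\Theta)|\Big)^2,\qquad \Theta\in\Xi .$$ (OfBm, $E$, $S$ are defined in the context.) Assume that $Y$ satisfies (OFBM1)--(OFBM3): - (OFBM1) $Y$ is an $\mathbb{R}^P$-valued OfBm whose Hurst matrix $\underline{\underline{H}}$ (not necessarily diagonalizable) has eigenvalues $h_1,\dots,h_P$ with $0<\Re(h_k)<1$, $k=1,\dots,P$; - (OFBM2) $\mathbb{E}\,Y(t)Y(t)^*$ has full rank for every $t\neq0$; - (OFBM3) $Y$ is time reversible, i.e. $\{Y(-t)\}_{t\in\mathbb{R}}$ and $\{Y(t)\}_{t\in\mathbb{R}}$ have the same finite-dimensional distributions; and that the wavelet $\psi_0\in L^1(\mathbb{R})\cap L^2(\mathbb{R})$ satisfies (W1)--(W3): - (W1) $\int_{\mathbb{R}}t^k\psi_0(t)\,dt=0$ for $k=0,\dots,N_\psi-1$,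 with $N_\psi\ge2$; - (W2) $\mathrm{supp}(\psi_0)$ is a compact interval; - (W3) $\sup_{t\in\mathbb{R}}|\psi_0(t)|(1+|t|)^\alpha<\infty$ for some $\alpha>1$. Suppose in addition that: i) $\Theta_0\in\mathrm{int}\,\Xi$; ii) there is some $j^*\in\{j_1,\dots,j_2\}$ such that for all $\Theta,\Theta'\in\Xi$ with $\Theta\ne\Theta'$ one has $|E_{i_1^*,i_2^*}(2^{j^*},\Theta)|\neq|E_{i_1^*,i_2^*}(2^{j^*},\Theta')|$ for some matrix entry $(i_1^*,i_2^* )$; iii) $E_{i_1,i_2}(2^j,\Theta_0)\neq0$ for all $i_1,i_2=1,\dots,P$ and all $j=j_1,\dots,j_2$; iv) for each $j=j_1,\dots,j_2$, the mapping $\Theta\mapsto E(2^j,\Theta)$ is continuous on $\Xi$ and three times continuously differentiable on $\mathrm{int}\,\Xi$. Let $\{\widehat\Theta^M_N\}_N$ be any sequence of $\Xi$-valued random vectors with $C_N(\widehat\Theta_N^M)=\min_{\Theta\in\Xi}C_N(\Theta)$ almost surely for every $N$. Then $$\widehat\Theta^M_N\to\Theta_0\quad\text{in probability, as } N\to\infty .$$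
   Context: **OfBm.** For a real $P\times P$ matrix $\underline{\underline{H}}$ and $a>0$, $a^{\underline{\underline{H}}}:=\sum_{k\ge0}\log^k(a)\,\underline{\underline{H}}^k/k!$. An $\mathbb{R}^P$-valued operator fractional Brownian motion (OfBm) with Hurst matrix $\underline{\underline{H}}$ is a zero-mean Gaussian process $\{Y(t)\}_{t\in\mathbb{R}}$ with stationary increments that is operator self-similar: for every $a>0$, $\{Y(t)\}_{t\in\mathbb{R}}$ and $\{a^{\underline{\underline{H}}}Y(t/a)\}_{t\in\mathbb{R}}$ have the same finite-dimensional distributions. $^*$ denotes (conjugate) transpose. **Wavelet coefficients.** The functions $\psi_{j,k}(t)=2^{-j/2}\psi_0(2^{-j}t-k)$, $(j,k)\in\mathbb{Z}^2$, form an orthonormal basis of $L^2(\mathbb{R})$. The wavelet coefficients of $Y$ are the vectors $D(j,k)=\int_{\mathbb{R}}2^{-j/2}\psi_0(2^{-j}t-k)\,Y(t)\,dt\in\mathbb{R}^P$. **Wavelet spectrum.** $E(2^j,\Theta)=\mathbb{E}\,D(j,k)D(j,k)^*$ (which does not depend on $k$), where the expectation is taken for the OfBm with parameter $\Theta$; its entries are $E_{i_1,i_2}(2^j,\Theta)$. **Sample wavelet spectrum.** $S(2^j)=\frac1{K_j}\sum_{k=1}^{K_j}D(j,k)D(j,k)^*$ with $K_j=N/2^j$, where $D(j,k)$ are the wavelet coefficients of the observed process $Y$ and $N$ is the sample size ($N$ ranges over positive integers such that all $K_j$, $j=j_1,\dots,j_2$, are integers); its entries are $S_{i_1,i_2}(2^j)$.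 **Convention.** $C_N(\Theta)=+\infty$ if one of the logarithms in its definition is not defined (argument zero). *)

(* Defs.v *)
From HB Require Import structures.
From mathcomp Require Import all_boot all_order all_algebra.
From mathcomp Require Import all_classical all_reals all_analysis.
From mathcomp Require Import complex.

Set Implicit Arguments.
Unset Strict Implicit.
Unset Printing Implicit Defensive.

Import Order.TTheory GRing.Theory Num.Theory.
Import numFieldNormedType.Exports.

Local Open Scope classical_set_scope.
Local Open Scope ring_scope.

Section Processes.
Context {R : realType}.

Definition borel (V : topologicalType) : set (set V) := <<s [set A | open A] >>.

Definition random_vector d (T : measurableType d) (V : topologicalType)
    (f : T -> V) : Prop :=
  forall B, borel B -> measurable (f @^-1` B).

Section OneSpace.
Context {d : measure_display} {T : measurableType d} (Pr : probability T R).
Context {p : nat}.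
Implicit Type Y : T -> R -> 'cV[R]_p.

(* Joint measurability in (w, t): this is what gives the integrals over t
   defining the wavelet coefficients a meaning as random vectors. *)
Definition measurable_process Y : Prop :=
  forall i : 'I_p,
    measurable_fun [set: T * measurableTypeR R] (fun z => Y z.1 z.2 i ord0).

(* [normal_prob m s] is the Gaussian law only for [s != 0], hence the separate
   degenerate case. *)
Definition gaussian_rv (Z : T -> R) : Prop :=
  measurable_fun setT Z /\
  ((exists m, {ae Pr, forall w, Z w = m}) \/
   (exists m s : R, 0 < s /\
      forall A : set R, measurable A ->
        Pr (Z @^-1` A) = normal_prob m s A)).

Definition gaussian_process Y : Prop :=
  forall (n : nat) (t : 'I_n -> R) (u : 'I_n -> 'cV[R]_p),
    gaussian_rv (fun w => \sum_(k < n) \sum_(i < p) u k i ord0 * Y w (t k) i ord0).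

Definition zero_mean Y : Prop :=
  forall (t : R) (i : 'I_p), ('E_Pr[fun w => Y w t i ord0] = 0)%E.

(* The matrix E[Z Z^T]. *)
Definition second_moment (Z : T -> 'cV[R]_p) : 'M[R]_p :=
  \matrix_(i1, i2) fine ('E_Pr[fun w => (Z w *m (Z w)^T) i1 i2])%E.

End OneSpace.

Definition same_fdd d1 (T1 : measurableType d1) (P1 : probability T1 R)
    d2 (T2 : measurableType d2) (P2 : probability T2 R) (p : nat)
    (Y1 : T1 -> R -> 'cV[R]_p) (Y2 : T2 -> R -> 'cV[R]_p) : Prop :=
  forall (n : nat) (t : 'I_n -> R) (A : set 'M[R]_(p, n)), borel A ->
    P1 [set w | A (\matrix_(i, k) Y1 w (t k) i ord0)] =
    P2 [set w | A (\matrix_(i, k) Y2 w (t k) i ord0)].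

Definition mxpowR (p : nat) (a : R) (H : 'M[R]_p) : 'M[R]_p :=
  limn (series (fun k : nat => (ln a ^+ k / k`!%:R) *: H ^+ k)).

Section Ofbm.
Context {d : measure_display} {T : measurableType d} (Pr : probability T R).
Context {p : nat}.
Implicit Type Y : T -> R -> 'cV[R]_p.

Definition stationary_increments Y : Prop :=
  forall h : R, same_fdd Pr Pr (fun w t => Y w (t + h) - Y w h)
                               (fun w t => Y w t - Y w 0).

Definition operator_self_similar (H : 'M[R]_p) Y : Prop :=
  forall a : R, 0 < a ->
    same_fdd Pr Pr Y (fun w t => mxpowR a H *m Y w (t / a)).

Definition ofbm (H : 'M[R]_p) Y : Prop :=
  [/\ gaussian_process Pr Y, zero_mean Pr Y, stationary_increments Y
    & operator_self_similar H Y].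

Definition time_reversible Y : Prop :=
  same_fdd Pr Pr (fun w t => Y w (- t)) Y.

End Ofbm.

(* All complex eigenvalues of the real matrix H have real part in ]0, 1[. *)
Definition hurst_spectrum (p : nat) (H : 'M[R]_p) : Prop :=
  forall h : R[i], eigenvalue (map_mx (real_complex R) H) h ->
    0 < complex.Re h < 1.

End Processes.

Section Wavelets.
Context {R : realType}.
Implicit Type psi : R -> R.
Local Notation mu := (@lebesgue_measure R).

Definition wavelet psi (j k : int) (t : R) : R :=
  2 `^ (- (j%:~R / 2)) * psi (2 ^ (- j) * t - k%:~R).

Definition wavelet_orthonormal_basis psi : Prop :=
  (forall j k j' k' : int,
     \int[mu]_t (wavelet psi j k t * wavelet psi j' k' t) =
     ((j == j') && (k == k'))%:R) /\
  (forall f : R -> R, f \in Lfun mu 2%:E -> forall e : R, 0 < e ->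
     exists (n : nat) (c : 'I_n -> R) (J K : 'I_n -> int),
       (Lnorm mu 2%:E (fun t =>
          (f t - \sum_(m < n) c m * wavelet psi (J m) (K m) t)%:E)
        < e%:E)%E).

Definition vanishing_moments psi (Npsi : nat) : Prop :=
  forall k : nat, (k < Npsi)%N -> \int[mu]_t (t ^+ k * psi t) = 0.

Definition compact_interval_support psi : Prop :=
  exists a b : R, closure [set t | psi t != 0] = `[a, b]%classic.

Definition polynomial_decay psi : Prop :=
  exists2 alpha : R, 1 < alpha &
    has_ubound (range (fun t => `|psi t| * (1 + `|t|) `^ alpha)).

Section Spectra.
Context {d : measure_display} {T : measurableType d} (Pr : probability T R).
Context {p : nat}.
Variables (psi : R -> R) (Y : T -> R -> 'cV[R]_p).


Definition wavelet_coef (j k : int) (w : T) : 'cV[R]_p :=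
  \col_i \int[mu]_t (wavelet psi j k t * Y w t i ord0).

(* The spectrum does not depend on the shift k; k = 0 is used. *)
Definition wavelet_spectrum (j : int) : 'M[R]_p :=
  second_moment Pr (wavelet_coef j 0).

(* K_j = N / 2^j, for those N at which it is an integer. *)
Definition nb_coefs (N : nat) (j : int) : nat := Num.truncn (N%:R / 2 ^ j : R).

Definition sample_spectrum (N : nat) (j : int) (w : T) : 'M[R]_p :=
  (nb_coefs N j)%:R^-1 *:
    \sum_(1 <= k < (nb_coefs N j).+1)
      wavelet_coef j k%:Z w *m (wavelet_coef j k%:Z w)^T.

End Spectra.

Definition admissible_size (j1 j2 : int) : set nat :=
  [set N | (0 < N)%N /\
     forall j : int, j1 <= j <= j2 -> (N%:R / 2 ^ j : R) \is a Num.nat].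

Definition log2 (x : R) : R := ln x / ln 2.

Definition scales (j1 j2 : int) : seq int :=
  [seq j1 + n%:Z | n <- iota 0 `|j2 - j1|.+1].

Definition log_distance (p : nat) (j1 j2 : int) (S E : int -> 'M[R]_p) : \bar R :=
  if `[< forall (j : int) (i1 i2 : 'I_p), j1 <= j <= j2 -> (i1 <= i2)%N ->
           S j i1 i2 != 0 /\ E j i1 i2 != 0 >]
  then (\sum_(i1 < p) \sum_(i2 < p | (i1 <= i2)%N) \sum_(j <- scales j1 j2)
          (log2 `|S j i1 i2| - log2 `|E j i1 i2|) ^+ 2)%:E
  else +oo%E.

End Wavelets.

(* C^n on an open set: all iterated partial derivatives up to order n exist
   and are continuous. *)
Fixpoint Cn_on (R : realType) (d : nat) (W : normedModType R) (n : nat)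
    (U : set 'rV[R]_d) (f : 'rV[R]_d -> W) : Prop :=
  (forall x, U x -> {for x, continuous f}) /\
  match n with
  | 0 => True
  | n'.+1 => forall i : 'I_d,
      (forall x, U x -> derivable f x (delta_mx ord0 i)) /\
      Cn_on n' U (fun x => 'D_(delta_mx ord0 i) f x)
  end.

Definition cvg_in_probability (R : realType) d (T : measurableType d)
    (Pr : probability T R) (V : normedModType R) (F : set_system nat)
    (f : nat -> T -> V) (l : V) : Prop :=
  forall e : R, 0 < e ->
    Pr [set w | e < `|f N w - l|] @[N --> F] --> 0%E.

(* Main.v *)
(** Consistency of the minimizer follows from consistency of the sample spectrum
    by compactness: off a neighbourhood of [th0] the identifiability assumption
    and continuity keep [|E(2^j*, th)|] away from [|E(2^j*, th0)|], so that a
    minimizer of [C_N] lies in that neighbourhood once every entry of [S] is close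
    enough to the corresponding entry of [E(th0)], all of which are nonzero.

    Each entry of [S] is an average of products [D_i(j, k) D_j(j, k)], which
    satisfies the weak law of large numbers once the covariance of two such
    products tends to 0 with the lag.  By Wick's formula that covariance is
    [rho_ii rho_jj + rho_ij rho_ji], where [rho] is the cross-covariance of two
    wavelet coefficients; since [rho_ij rho_ji <= ((rho_ij + rho_ji) / 2)^2], only
    the part of [rho] symmetric in (i, j) matters, and it is a double integral of
    [psi (t) psi (s) G (t - s + x)] with [G] the covariance matrix of the
    increments.  As [psi] has integral 0, it suffices that [G] is asymptotically
    affine on bounded windows.  The square root of a variance of increments is
    subadditive, so by Fekete's lemma [G x / x^2] has a limit [Q]; self-similarity
    gives the Sylvester equation [H Q + Q H^T = 2 Q], so that [Q = 0] because the
    eigenvalues of [H] have real part below 1; and self-similarity once more turns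
    [G x = o(x^2)] into the required expansion of [G (x + y)].  Hence no
    diagonalization of [H] is needed. *)

(* Wavelet coefficients are time integrals, not finite linear combinations of values of Y, so the
   Gaussian hypothesis does not speak of them directly. Instead of showing that Gaussian laws are
   stable under limits, Wick's formula is proved for the values of Y at four times and carried over
   to the coefficients: both of its sides are linear in each variable, so Fubini exchanges the
   variables one at a time. Fubini requires fourth moments bounded on bounded time intervals. No
   continuity of the covariance in time is at hand for this; the bound comes from self-similarity
   away from 0 and from subadditivity near 0. The covariances of the products are bounded from above
   only, which is all that Chebyshev's inequality asks of a variance. Minimality of the estimator
   enters only through the comparison of its objective value with the value at the true
   parameter. *)
Require Import Defs.
From mathcomp Require Import all_boot all_order all_algebra.
From mathcomp Require Import all_classical all_reals all_analysis.
From mathcomp Require Import complex measurable_realfun ring lra.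
Import Order.TTheory GRing.Theory Num.Theory.
Import numFieldNormedType.Exports.
Local Open Scope classical_set_scope.
Local Open Scope ring_scope.

Set Implicit Arguments.
Unset Strict Implicit.
Unset Printing Implicit Defensive.

(** * Affine changes of variables *)

Section AffineChange.
Context {R : realType}.
Notation mu := (@lebesgue_measure R).

Lemma measurable_affine (a b : R) : measurable_fun setT (fun t : R => a * t + b).
Proof. by apply: measurable_funD => //; apply: measurable_funM. Qed.

(** Uniqueness of Lebesgue measure: [a] times the image of [mu] under the affine map gives every
    half-open interval its length. *)
Lemma lebesgue_measure_affine (a b : R) (A : set R) : 0 < a -> measurable A ->
  mu ((fun t => a * t + b) @^-1` A) = (a^-1%:E * mu A)%E.
Proof.
move=> a0 mA.
pose phi := (fun t : measurableTypeR R => a * t + b : measurableTypeR R).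
have mphi : measurable_fun setT phi by exact: measurable_affine.
pose nu : {measure set _ -> \bar R} :=
  mscale (NngNum (ltW a0)) (pushforward mu phi : {measure set _ -> \bar R}).
have -> : mu A = nu mphi A.
  apply: lebesgue_measure_unique => // X [[x y] _ <-] /=.
  rewrite /nu /mscale/= -[pushforward mu phi _]/(mu (phi @^-1` `]x, y]%classic)).
  have -> : phi @^-1` `]x, y] = `](x - b) / a, (y - b) / a]%classic.
    apply/seteqP; split => t /=; rewrite !in_itv/= /phi
      ltr_pdivrMr// ler_pdivlMr// ltrBlDr lerBrDr mulrC//.
  rewrite !lebesgue_measure_itv /= !lte_fin ltr_pM2r ?invr_gt0// ltrD2r.
  case: ifPn => // _; last by rewrite mule0.
  by rewrite -!EFinD -EFinM; congr EFin; field; rewrite gt_eqF.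
by rewrite /nu /mscale/= muleA -EFinM mulVf ?gt_eqF// mul1e.
Qed.

Lemma ge0_integral_affine (a b : R) (f : R -> \bar R) : 0 < a ->
  measurable_fun setT f -> (forall t, 0 <= f t)%E ->
  (\int[mu]_t f (a * t + b)%R = a^-1%:E * \int[mu]_t f t)%E.
Proof.
move=> a0 mf f0.
pose phi := (fun t : measurableTypeR R => a * t + b : measurableTypeR R).
have mphi : measurable_fun setT phi by exact: measurable_affine.
have iV0 : 0 <= a^-1 by rewrite invr_ge0 ltW.
have -> : (a^-1%:E * \int[mu]_t f t = \int[mscale (NngNum iV0) mu]_t f t)%E.
  by rewrite ge0_integral_mscale.
rewrite -[LHS](@ge0_integral_pushforward _ _ _ _ _ phi mphi mu setT f)//.
apply: eq_measure_integral => A mA _; rewrite /pushforward /mscale/=.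
exact: lebesgue_measure_affine.
Qed.

(** Positive and negative parts scale separately. If one of them has infinite integral, [fine]
    returns 0 on both sides, so the formula holds for every measurable [f]. *)
Lemma Rintegral_affine (a b : R) (f : R -> R) : 0 < a ->
  measurable_fun setT f ->
  \int[mu]_t f (a * t + b) = a^-1 * \int[mu]_t f t.
Proof.
move=> a0 mf; rewrite /Rintegral integralE [in RHS]integralE.
have mfE : measurable_fun setT (EFin \o f) by exact/measurable_EFinP.
have -> : (\int[mu]_t (fun t => (f (a * t + b))%:E)^\+ t =
    a^-1%:E * \int[mu]_t (fun t => (f t)%:E)^\+ t)%E.
  rewrite -(ge0_integral_affine b a0)//; last exact: measurable_funepos.
  by apply: eq_integral => t _; rewrite !funeposE.
have -> : (\int[mu]_t (fun t => (f (a * t + b))%:E)^\- t =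
    a^-1%:E * \int[mu]_t (fun t => (f t)%:E)^\- t)%E.
  rewrite -(ge0_integral_affine b a0)//; last exact: measurable_funeneg.
  by apply: eq_integral => t _; rewrite !funenegE.
rewrite -[X in _ = X * _]/(fine a^-1%:E).
set x := integral _ _ _; set y := integral _ _ _.
have : (0 <= x)%E by exact: integral_ge0.
have : (0 <= y)%E by exact: integral_ge0.
have aV0 : 0 < a^-1 by rewrite invr_gt0.
case: x y => [x| |] [y| |] //= _ _.
- by rewrite mulrBr.
- by rewrite gt0_muley ?lte_fin//= mulr0.
- by rewrite gt0_muley ?lte_fin//= mulr0.
- by rewrite gt0_muley ?lte_fin//= mulr0.
Qed.

Lemma Rintegral_shift (c : R) (f : R -> R) : measurable_fun setT f ->
  \int[mu]_t f (t + c) = \int[mu]_t f t.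
Proof.
move=> mf; have := @Rintegral_affine 1 c f ltr01 mf.
rewrite invr1 mul1r => <-; apply: eq_Rintegral => t _; by rewrite mul1r.
Qed.

End AffineChange.

(** * Moments of the normal law *)

Section NormalMoments.
Context {R : realType}.
Notation mu := (@lebesgue_measure R).

(** The Radon-Nikodym derivative of the law agrees almost everywhere with the density, because both
    have the same integrals over measurable sets. *)
Lemma ge0_integral_normal_prob (m s : R) (f : R -> \bar R) :
  measurable_fun setT f -> (forall x, 0 <= f x)%E ->
  (\int[normal_prob m s]_x f x = \int[mu]_x (f x * (normal_pdf m s x)%:E))%E.
Proof.
move=> mf f0.
have dom := normal_prob_dominates m s.
rewrite -(Radon_Nikodym_SigmaFinite.change_of_variables dom)//.
apply: ae_eq_integral => //.
- apply: emeasurable_funM => //; apply: (measurable_int mu).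
  exact: Radon_Nikodym_SigmaFinite.f_integrable.
- apply: emeasurable_funM => //=; apply/measurableT_comp => //=.
  exact: measurable_normal_pdf.
- apply: ae_eqe_mul2l => /=.
  apply: integral_ae_eq => //=.
  + exact: Radon_Nikodym_SigmaFinite.f_integrable.
  + by apply/measurableT_comp => //; exact: measurable_normal_pdf.
  + by move=> E _ mE; rewrite -Radon_Nikodym_SigmaFinite.f_integral.
Qed.

Lemma integrable_normal_prob (m s : R) (f : R -> R) :
  measurable_fun setT f ->
  mu.-integrable setT (fun x => (f x * normal_pdf m s x)%:E) ->
  (normal_prob m s).-integrable setT (EFin \o f).
Proof.
move=> mf /integrableP[_ foo]; apply/integrableP; split.
  exact/measurable_EFinP.
rewrite ge0_integral_normal_prob//; last first.
  by apply: measurableT_comp => //; exact/measurable_EFinP.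
apply: le_lt_trans foo; rewrite le_eqVlt; apply/orP; left; apply/eqP.
apply: eq_integral => x _ /=.
by rewrite normrM [`|normal_pdf _ _ _|]ger0_norm ?normal_pdf_ge0 ?EFinM.
Qed.

Lemma Rintegral_normal_prob (m s : R) (f : R -> R) :
  measurable_fun setT f ->
  \int[normal_prob m s]_x f x = \int[mu]_x (f x * normal_pdf m s x).
Proof.
move=> mf; have mfE : measurable_fun setT (EFin \o f) by exact/measurable_EFinP.
congr fine; rewrite integralE [RHS]integralE.
rewrite !ge0_integral_normal_prob//; last 2 first.
- exact: measurable_funeneg.
- exact: measurable_funepos.
congr (_ - _)%E; apply: eq_integral => x _.
- rewrite !funeposE EFinM -[0%E in RHS](mul0e (normal_pdf m s x)%:E).
  by rewrite -maxe_pMl// lee_fin normal_pdf_ge0.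
- rewrite !funenegE EFinM -[0%E in RHS](mul0e (normal_pdf m s x)%:E).
  by rewrite -mulNe -maxe_pMl// lee_fin normal_pdf_ge0.
Qed.

(** Fundamental theorem of calculus on [[-(n+1), n+1]], then dominated convergence with [|f|] as the
    dominating function. *)
Lemma Rintegral_derive_eq0 (f F : R -> R) :
  continuous f -> mu.-integrable setT (EFin \o f) ->
  (forall x, is_derive x (1 : R) F (f x)) ->
  F x @[x --> +oo] --> 0 -> F x @[x --> -oo] --> 0 ->
  \int[mu]_x f x = 0.
Proof.
move=> cf intf dF Fy FNy.
have mf : measurable_fun setT (EFin \o f) by apply: measurable_int intf.
pose I n := `[- n.+1%:R, n.+1%:R]%classic : set R.
have mI n : measurable (I n) by exact: measurable_itv.
have cvgI : (\int[mu]_x ((EFin \o f) \_ (I n)) x @[n --> \oo] --> \int[mu]_x (f x)%:E)%E.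
  apply: (@dominated_cvg _ _ _ mu _ measurableT _ _ (abse \o (EFin \o f))) => //.
  - by move=> n; apply: (measurable_restrictT (EFin \o f) (mI n)).1 (measurable_funTS mf).
  - move=> x _; apply: (@cvg_near_cst _ _ _ (fun n => ((EFin \o f) \_ (I n)) x)); near=> n.
    rewrite patchE ifT// inE /I/= in_itv/= -ler_norml.
    rewrite (@le_trans _ _ n%:R)//; last by rewrite ler_nat.
    near: n; exact: nbhs_infty_ger.
  - exact: integrable_abse.
  - move=> n x _ /=; rewrite patchE; case: ifPn => //=.
    by rewrite normr0 lee_fin.
have eqI n : (\int[mu]_x ((EFin \o f) \_ (I n)) x = (F n.+1%:R - F (- n.+1%:R))%:E)%E.
  rewrite -integral_mkcond /I (@continuous_FTC2 _ f F)//.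
  - by rewrite gtrN.
  - exact/continuous_subspaceT.
  - have cF x : {for x, continuous F}.
      by apply/differentiable_continuous/derivable1_diffP; have [] := dF x.
    split; [by move=> x _; have [] := dF x|exact/cvg_at_right_filter/cF|exact/cvg_at_left_filter/cF].
  - by move=> x _; rewrite derive1E; apply: derive_val.
have : (\int[mu]_x (f x)%:E = 0)%E.
  rewrite -(cvg_lim _ cvgI)//; apply/cvg_lim => //; under eq_fun do rewrite eqI.
  apply: cvg_EFin; first exact: nearW.
  rewrite -[X in _ --> X]subr0; apply: cvgB.
    by move/cvg_pinftyP : Fy; apply; rewrite (cvg_shiftS (fun n => n%:R : R)); exact: cvgr_idn.
  move/cvg_ninftyP : FNy; apply; apply/cvgNrNy.
  rewrite (cvg_shiftS (fun n => n%:R : R)); exact: cvgr_idn.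
by rewrite /Rintegral => ->.
Unshelve. all: by end_near. Qed.

(** * Central moments of the Gaussian density *)

Section GaussFun.
Variables (m s : R).
Hypothesis s0 : 0 < s.
Let g := normal_pdf m s.

Let gE x : g x = normal_peak s * normal_fun m s x.
Proof. by rewrite /g normal_pdfE ?gt_eqF. Qed.

Lemma is_derive_normal_pdf (x : R) :
  is_derive x (1 : R) g (- ((x - m) / s ^+ 2) * g x).
Proof.
have H : is_derive x (1 : R) (fun y : R => - (y - m) ^+ 2 / (s ^+ 2 *+ 2))
    (- ((x - m) / s ^+ 2)).
  apply: is_derive_eq; rewrite /GRing.scale/= !(mulr0,addr0,add0r).
  by field; rewrite gt_eqF.
have H1 := @is_derive1_comp _ expR (fun y : R => - (y - m) ^+ 2 / (s ^+ 2 *+ 2)) x _ _ (is_derive_expR _) H.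
have H2 : is_derive x (1 : R) (fun y => normal_peak s * normal_fun m s y)
    (normal_peak s * (- ((x - m) / s ^+ 2) * normal_fun m s x)).
  have H1' : is_derive x (1 : R) (normal_fun m s)
    (normal_fun m s x * - ((x - m) / s ^+ 2)) by exact: H1.
  by rewrite (mulrC _ (normal_fun m s x)); exact: (is_deriveZ (normal_peak s) H1').
have -> : g = (fun y => normal_peak s * normal_fun m s y) by exact/funext/gE.
by apply: is_derive_eq; ring.
Qed.

Lemma is_derive_pow_normal_pdf (n : nat) (x : R) :
  is_derive x (1 : R) (fun y => (y - m) ^+ n * g y)
    ((n%:R * (x - m) ^+ n.-1 - (x - m) ^+ n.+1 / s ^+ 2) * g x).
Proof.
have Hg := is_derive_normal_pdf x.
have Hp : is_derive x (1 : R) (fun y => (y - m) ^+ n) (n%:R * (x - m) ^+ n.-1).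
  have H1 : is_derive x (1 : R) (fun y : R => y - m) 1.
    by apply: is_derive_eq; rewrite subr0.
  by have := is_deriveX n H1; rewrite exprfctE /GRing.scale/= mulr1.
apply: (@is_derive_eq _ _ _ _ _ _ _ _ (is_deriveM Hp Hg)).
by rewrite /GRing.scale/= [(x - m) ^+ n.+1]exprS; field; rewrite gt_eqF.
Qed.

Lemma continuous_pow_normal_pdf (n : nat) : continuous (fun y => (y - m) ^+ n * g y).
Proof.
move=> x; apply/differentiable_continuous/derivable1_diffP.
by have [] := is_derive_pow_normal_pdf n x.
Qed.

(** With [u = (x - m)^2 / (4 s^2)] the two exponentials are [e^(-2u)] and [e^(-u)], while
    [(x - m)^4 = 16 s^4 u^2 <= 32 s^4 e^u] because [u^2 / 2 <= e^u]. Domination by the density of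
    twice the variance yields both integrability and decay at infinity. *)
Lemma pow4_normal_pdf_le : exists C, forall x,
  (1 + (x - m) ^+ 4) * g x <= C * normal_pdf m (Num.sqrt 2 * s) x.
Proof.
have s20 : 0 < Num.sqrt 2 * s by rewrite mulr_gt0// sqrtr_gt0.
exists ((1 + 32 * s ^+ 4) * normal_peak s / normal_peak (Num.sqrt 2 * s)) => x.
rewrite gE normal_pdfE ?gt_eqF//.
have pk1 : 0 < normal_peak s by rewrite normal_peak_gt0// gt_eqF.
have : 0 < normal_peak (Num.sqrt 2 * s) by rewrite normal_peak_gt0// gt_eqF.
move: (normal_peak s) (normal_peak _) pk1 => p1 p2 p10 p20.
suff h : (1 + (x - m) ^+ 4) * normal_fun m s x <=
    (1 + 32 * s ^+ 4) * normal_fun m (Num.sqrt 2 * s) x.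
  rewrite [leRHS]mulrA divfK ?gt_eqF// mulrCA -[leRHS]mulrA [leRHS]mulrCA.
  exact: (ler_wpM2l (ltW p10) h).
rewrite /normal_fun exprMn sqr_sqrtr//.
set u := (x - m) ^+ 2 / (s ^+ 2 *+ 4).
have -> : - (x - m) ^+ 2 / (s ^+ 2 *+ 2) = - u + - u.
  by rewrite /u; field; rewrite gt_eqF.
have -> : - (x - m) ^+ 2 / ((2 * s ^+ 2) *+ 2) = - u.
  by rewrite /u; field; rewrite gt_eqF.
rewrite expRD mulrA ler_pM2r ?expR_gt0// expRN ler_pdivrMr ?expR_gt0//.
have u0 : 0 <= u by rewrite divr_ge0 ?sqr_ge0// mulrn_wge0 ?sqr_ge0.
have -> : (x - m) ^+ 4 = 16 * s ^+ 4 * u ^+ 2.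
  by rewrite /u; field; rewrite gt_eqF.
have e1 := expR_ge1Dx u.
have e2 : 1 + u ^+ 2 / 2 <= expR u by exact: (expR_ge1Dxn 1 u0).
have s4 : 0 <= s ^+ 4 by rewrite exprn_ge0// ltW.
have := ler_wpM2l s4 e2; nra.
Qed.

Lemma pow_normal_pdf_le (n : nat) : (n <= 4)%N -> exists C, forall x,
  `|(x - m) ^+ n * g x| <= C * normal_pdf m (Num.sqrt 2 * s) x.
Proof.
move=> n4; have [C HC] := pow4_normal_pdf_le; exists C => x.
rewrite (le_trans _ (HC x))// normrM (ger0_norm (normal_pdf_ge0 _ _ _)).
rewrite ler_wpM2r ?normal_pdf_ge0// normrX.
have -> : (x - m) ^+ 4 = `|x - m| ^+ 4 by rewrite -normrX ger0_norm// exprn_even_ge0.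
set y := `|_|; have y0 : 0 <= y by exact: normr_ge0.
have [y1|y1] := leP y 1.
  by rewrite (@le_trans _ _ 1) ?exprn_ile1// lerDl exprn_ge0.
by rewrite ler_wpDl// ler_weXn2l// ltW.
Qed.

Lemma integrable_pow_normal_pdf (n : nat) : (n <= 4)%N ->
  mu.-integrable setT (fun x => ((x - m) ^+ n * g x)%:E).
Proof.
move=> n4; have [C HC] := pow_normal_pdf_le n4.
have mg : measurable_fun setT (fun x : R => (x - m) ^+ n * g x).
  by apply: continuous_measurable_fun; exact: continuous_pow_normal_pdf.
apply: (@le_integrable _ _ _ mu setT measurableT _
  (fun x => (C * normal_pdf m (Num.sqrt 2 * s) x)%:E)).
- exact/measurable_EFinP.
- by move=> x _; rewrite !abse_EFin lee_fin (le_trans _ (ler_norm _)).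
- under eq_fun do rewrite EFinM.
  by apply: integrableZl => //; exact: integrable_normal_pdf.
Qed.

Lemma cvg_normal_fun_infty (a c : R) : 0 < c ->
  normal_fun a c x @[x --> +oo] --> 0 /\ normal_fun a c x @[x --> -oo] --> 0.
Proof.
move=> c0; have c20 : 0 < c ^+ 2 *+ 2 by rewrite mulrn_wgt0// exprn_gt0.
have E x : normal_fun a c x = expR (- ((x - a) ^+ 2 / (c ^+ 2 *+ 2))).
  by rewrite /normal_fun mulNr.
have K (A x : R) : 1 <= `|x - a| -> A * (c ^+ 2 *+ 2) <= `|x - a| ->
    A <= (x - a) ^+ 2 / (c ^+ 2 *+ 2).
  move=> h1 h2; rewrite ler_pdivlMr// (le_trans h2)//.
  rewrite -[(x - a) ^+ 2]real_normK ?num_real//; nra.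
split; under eq_fun do rewrite E.
  apply: (@cvg_comp _ _ _ (fun x => (x - a) ^+ 2 / (c ^+ 2 *+ 2)) (fun x => expR (- x)) _ _ _ _ (@cvgr_expR R)).
  apply/cvgryPge => A; near=> x; apply: K; rewrite (le_trans _ (ler_norm _))//.
    by rewrite lerBrDr; near: x; apply: nbhs_pinfty_ge; rewrite num_real.
  by rewrite lerBrDr; near: x; apply: nbhs_pinfty_ge; rewrite num_real.
apply: (@cvg_comp _ _ _ (fun x => (x - a) ^+ 2 / (c ^+ 2 *+ 2)) (fun x => expR (- x)) _ _ _ _ (@cvgr_expR R)).
apply/cvgryPge => A; near=> x; apply: K; rewrite distrC (le_trans _ (ler_norm _))//.
  by rewrite lerBrDr -lerBrDl; near: x; apply: nbhs_ninfty_le; rewrite num_real.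
by rewrite lerBrDr -lerBrDl; near: x; apply: nbhs_ninfty_le; rewrite num_real.
Unshelve. all: by end_near. Qed.

(** Integrating the derivative of [(x - m)^n g] over the line gives [n M_(n-1) = M_(n+1) / s^2] for
    the central moments [M_n]; the cases n = 0, 1, 3 determine M_1, M_2 and M_4. For n = 0 the
    truncated predecessor is harmless, its coefficient being 0. *)
Lemma normal_pdf_moments :
  [/\ \int[mu]_x ((x - m) * g x) = 0,
      \int[mu]_x ((x - m) ^+ 2 * g x) = s ^+ 2 &
      \int[mu]_x ((x - m) ^+ 4 * g x) = 3 * s ^+ 4].
Proof.
have lim0 n : (n <= 4)%N -> (x - m) ^+ n * g x @[x --> +oo] --> 0 /\
    (x - m) ^+ n * g x @[x --> -oo] --> 0.
  move=> n4.
  have s20 : 0 < Num.sqrt 2 * s by rewrite mulr_gt0// sqrtr_gt0.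
  have [C HC] := pow_normal_pdf_le n4.
  have [cy cNy] := cvg_normal_fun_infty m s20.
  pose C' := C * normal_peak (Num.sqrt 2 * s).
  have HC' x : - (C' * normal_fun m (Num.sqrt 2 * s) x) <= (x - m) ^+ n * g x
      <= C' * normal_fun m (Num.sqrt 2 * s) x.
    by rewrite -ler_norml (le_trans (HC x))// normal_pdfE ?gt_eqF// mulrA.
  have sq (F : set_system R) : Filter F ->
      normal_fun m (Num.sqrt 2 * s) x @[x --> F] --> 0 ->
      (x - m) ^+ n * g x @[x --> F] --> 0.
    move=> FF cF.
    apply: (@squeeze_cvgr _ _ _ _ (fun x => - (C' * normal_fun m (Num.sqrt 2 * s) x))
      (fun x => C' * normal_fun m (Num.sqrt 2 * s) x)).
    - exact: nearW.
    - rewrite -oppr0 -(mulr0 C'); apply: cvgN; apply: cvgM => //; exact: cvg_cst.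
    - rewrite -(mulr0 C'); apply: cvgM => //; exact: cvg_cst.
  by split; apply: sq.
have I n : (n < 4)%N -> mu.-integrable setT (fun x =>
    (n%:R * ((x - m) ^+ n.-1 * g x))%:E).
  move=> n4; under eq_fun do rewrite EFinM.
  apply: integrableZl => //; apply: integrable_pow_normal_pdf.
  by rewrite (leq_trans (leq_pred _)) 1?ltnW.
have I' n : (n < 4)%N -> mu.-integrable setT (fun x =>
    ((s ^+ 2)^-1 * ((x - m) ^+ n.+1 * g x))%:E).
  move=> n4; under eq_fun do rewrite EFinM.
  by apply: integrableZl => //; apply: integrable_pow_normal_pdf.
have rec n : (n < 4)%N ->
    n%:R * \int[mu]_x ((x - m) ^+ n.-1 * g x) =
    (s ^+ 2)^-1 * \int[mu]_x ((x - m) ^+ n.+1 * g x).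
  move=> n4; rewrite -!RintegralZl//; last 2 first.
  - exact: integrable_pow_normal_pdf.
  - by apply: integrable_pow_normal_pdf; rewrite (leq_trans (leq_pred _)) 1?ltnW.
  apply/eqP; rewrite -subr_eq0; apply/eqP.
  rewrite -RintegralB//; [|exact: I|exact: I'].
  have E x : n%:R * ((x - m) ^+ n.-1 * g x) - (s ^+ 2)^-1 * ((x - m) ^+ n.+1 * g x)
     = (n%:R * (x - m) ^+ n.-1 - (x - m) ^+ n.+1 / s ^+ 2) * g x.
    by ring.
  apply: (@Rintegral_derive_eq0 _ (fun x => (x - m) ^+ n * g x)).
  - move=> x; apply: cvgB; apply: cvgMr; exact: continuous_pow_normal_pdf.
  - by have := integrableB measurableT (I n n4) (I' n n4); apply: eq_integrable.
  - by move=> x; rewrite E; exact: is_derive_pow_normal_pdf.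
  - by have [] := lim0 n (ltnW n4).
  - by have [] := lim0 n (ltnW n4).
have s2 : s ^+ 2 != 0 by rewrite gt_eqF// exprn_gt0.
have I0 : \int[mu]_x ((x - m) ^+ 0 * g x) = 1.
  by under eq_Rintegral do rewrite expr0 mul1r; rewrite /Rintegral integral_normal_pdf.
have I1 : \int[mu]_x ((x - m) ^+ 1 * g x) = 0.
  by have /esym/eqP := rec 0%N isT; rewrite mul0r mulf_eq0 invr_eq0 (negbTE s2) => /eqP.
have I2 : \int[mu]_x ((x - m) ^+ 2 * g x) = s ^+ 2.
  have := rec 1%N isT; rewrite /= I0 mul1r => /(congr1 ( *%R (s ^+ 2))).
  by rewrite mulr1 mulVKf.
split => //.
have := rec 3%N isT; rewrite /= I2 => /(congr1 ( *%R (s ^+ 2))).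
by rewrite mulVKf// => <-; ring.
Qed.

End GaussFun.
End NormalMoments.

(** * Fourth moments and Wick's formula *)

Section FourthMoments.
Context d (T : measurableType d) (R : realType) (P : probability T R).
Implicit Types X Y Z : T -> R.

(** The weak law is applied to products of two coefficients, whose squares must be integrable; hence
    fourth moments. *)
Definition L4 X :=
  measurable_fun setT X /\ P.-integrable setT (fun w => (X w ^+ 4)%:E).

Lemma normr_prod4_le (x1 x2 x3 x4 : R) :
  `|x1 * x2 * x3 * x4| <= x1 ^+ 4 + x2 ^+ 4 + x3 ^+ 4 + x4 ^+ 4.
Proof.
have e4 (x : R) : x ^+ 4 = (x ^+ 2) ^+ 2 by rewrite -exprM.
have E (x y : R) : `|x * y| <= (x ^+ 2 + y ^+ 2) / 2.
  have := sqr_ge0 (x + y); have := sqr_ge0 (x - y).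
  by rewrite ler_norml => h1 h2; apply/andP; split; nra.
rewrite -mulrA (le_trans (E _ _))// !exprMn !e4.
have E1 := E (x1 ^+ 2) (x2 ^+ 2); have E2 := E (x3 ^+ 2) (x4 ^+ 2).
have := ler_norm (x1 ^+ 2 * x2 ^+ 2); have := ler_norm (x3 ^+ 2 * x4 ^+ 2).
have := sqr_ge0 (x1 ^+ 2); have := sqr_ge0 (x2 ^+ 2).
have := sqr_ge0 (x3 ^+ 2); have := sqr_ge0 (x4 ^+ 2).
lra.
Qed.

Lemma L4_prod4 X1 X2 X3 X4 : L4 X1 -> L4 X2 -> L4 X3 -> L4 X4 ->
  P.-integrable setT (fun w => (X1 w * X2 w * X3 w * X4 w)%:E).
Proof.
move=> [m1 i1] [m2 i2] [m3 i3] [m4 i4].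
apply: (@le_integrable _ _ _ P setT measurableT _ (fun w =>
  (X1 w ^+ 4)%:E + (X2 w ^+ 4)%:E + (X3 w ^+ 4)%:E + (X4 w ^+ 4)%:E))%E.
- by apply/measurable_EFinP; do ?apply: measurable_funM.
- move=> w _; rewrite -!EFinD !abse_EFin lee_fin.
  by rewrite (le_trans (normr_prod4_le _ _ _ _))// ler_norm.
- by do 3 (apply: integrableD => //).
Qed.

Lemma L4_cst c : L4 (cst c).
Proof.
split => //; have := @finite_measure_integrable_cst _ _ _ P _ (c ^+ 4) measurableT.
by apply: eq_integrable.
Qed.

Lemma L4_prod2 X1 X2 : L4 X1 -> L4 X2 ->
  P.-integrable setT (fun w => (X1 w * X2 w)%:E).
Proof.
move=> h1 h2; have := L4_prod4 h1 h2 (L4_cst 1) (L4_cst 1).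
by apply: eq_integrable => // w _; rewrite !mulr1.
Qed.

Lemma L4_integrable X : L4 X -> P.-integrable setT (EFin \o X).
Proof.
move=> h1; have := L4_prod2 h1 (L4_cst 1).
by apply: eq_integrable => // w _; rewrite !mulr1.
Qed.

Lemma L4D X1 X2 : L4 X1 -> L4 X2 -> L4 (fun w => X1 w + X2 w).
Proof.
move=> [m1 i1] [m2 i2]; split; first exact: measurable_funD.
apply: (@le_integrable _ _ _ P setT measurableT _ (fun w =>
  8%:E * ((X1 w ^+ 4)%:E + (X2 w ^+ 4)%:E)))%E.
- by apply/measurable_EFinP; apply: measurable_funX; exact: measurable_funD.
- move=> w _; rewrite -!EFinD -EFinM !abse_EFin lee_fin.
  have e4 (x : R) : x ^+ 4 = (x ^+ 2) ^+ 2 by rewrite -exprM.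
  have E (x y : R) : (x + y) ^+ 2 <= 2 * (x ^+ 2 + y ^+ 2).
    have := sqr_ge0 (x - y); nra.
  rewrite (le_trans _ (ler_norm _))// ger0_norm; last by rewrite exprn_even_ge0.
  rewrite !e4; have E1 := E (X1 w) (X2 w); have E2 := E (X1 w ^+ 2) (X2 w ^+ 2).
  have : ((X1 w + X2 w) ^+ 2) ^+ 2 <= (2 * (X1 w ^+ 2 + X2 w ^+ 2)) ^+ 2.
    by rewrite lerXn2r// nnegrE ?sqr_ge0// mulr_ge0// addr_ge0 ?sqr_ge0.
  rewrite exprMn; nra.
- by apply: integrableZl => //; exact: integrableD.
Qed.

Lemma L4Z (c : R) X : L4 X -> L4 (fun w => c * X w).
Proof.
move=> [m1 i1]; split; first exact: measurable_funM.
under eq_fun do rewrite exprMn EFinM.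
exact: integrableZl.
Qed.

Lemma ae_eq_Rintegral X Y : measurable_fun setT X -> measurable_fun setT Y ->
  {ae P, forall w, X w = Y w} -> \int[P]_w X w = \int[P]_w Y w.
Proof.
move=> mX mY XY; congr fine; apply: ae_eq_integral => //.
- exact/measurable_EFinP.
- exact/measurable_EFinP.
- by apply: filterS XY => w /= -> _.
Qed.

Lemma Rintegral_probability_cst (c : R) : \int[P]_w c = c.
Proof. by rewrite /Rintegral integral_cst//= probability_setT mule1. Qed.

Section Law.
Variables (Z : T -> R) (m s : R).
Hypothesis mZ : measurable_fun setT Z.
Hypothesis Zlaw : forall A : set R, measurable A -> P (Z @^-1` A) = normal_prob m s A.

Lemma integrable_normal_law (f : R -> R) : measurable_fun setT f ->
  lebesgue_measure.-integrable setT (fun x => (f x * normal_pdf m s x)%:E) ->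
  P.-integrable setT (EFin \o (f \o Z)).
Proof.
move=> mf intf; have /integrableP[_ foo] := integrable_normal_prob mf intf.
apply/integrableP; split; first by apply/measurable_EFinP/measurableT_comp.
apply: le_lt_trans foo.
rewrite -[leLHS](@ge0_integral_pushforward _ _ T (measurableTypeR R) _ Z mZ P setT (abse \o (EFin \o f)))//.
- rewrite le_eqVlt; apply/orP; left; apply/eqP.
  apply: eq_measure_integral => A mA _.
  exact: Zlaw.
- by apply: measurableT_comp => //; exact/measurable_EFinP.
- by move=> y _; exact: abse_ge0.
Qed.

Lemma Rintegral_normal_law (f : R -> R) : measurable_fun setT f ->
  lebesgue_measure.-integrable setT (fun x => (f x * normal_pdf m s x)%:E) ->
  \int[P]_w f (Z w) = \int[lebesgue_measure]_x (f x * normal_pdf m s x).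
Proof.
move=> mf intf; rewrite -Rintegral_normal_prob//; congr fine.
rewrite -[LHS](@integral_pushforward _ _ T (measurableTypeR R) _ Z mZ P setT (EFin \o f))//.
- apply: eq_measure_integral => A mA _.
  exact: Zlaw.
- exact/measurable_EFinP.
- exact: integrable_normal_law.
Qed.

End Law.

Lemma gaussian_rv_L4 Z : gaussian_rv P Z -> L4 Z.
Proof.
move=> [mZ [[m Zm]|[m [s [s0 Zlaw]]]]]; split => //.
  apply/integrableP; split; first exact/measurable_EFinP/measurable_funX.
  have -> : (\int[P]_w `|(Z w ^+ 4)%:E| = \int[P]_w (cst `|m ^+ 4|%:E) w)%E.
    apply: ae_eq_integral => //; last by apply: filterS Zm => w /= -> _.
    by apply: measurableT_comp => //; exact/measurable_EFinP/measurable_funX.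
  by rewrite integral_cst//= probability_setT mule1 ltry.
have L : L4 (fun w => Z w - m).
  split; first exact: measurable_funB.
  apply: (integrable_normal_law (m := m) (s := s) mZ Zlaw (f := fun x => (x - m) ^+ 4)).
    by apply: measurable_funX; exact: measurable_funB.
  exact: integrable_pow_normal_pdf.
have := (L4D L (L4_cst m)).2.
by apply: eq_integrable => // w _; rewrite subrK.
Qed.

Lemma gaussian_rv_moment4 Z : gaussian_rv P Z -> \int[P]_w Z w = 0 ->
  \int[P]_w (Z w ^+ 4) = 3 * (\int[P]_w (Z w ^+ 2)) ^+ 2.
Proof.
move=> gZ; have LZ := gaussian_rv_L4 gZ.
case: gZ => mZ [[m Zm]|[m [s [s0 Zlaw]]]] EZ.
  have m0 : m = 0.
    by rewrite -EZ (ae_eq_Rintegral mZ _ Zm)// Rintegral_probability_cst.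
  have E n : \int[P]_w (Z w ^+ n.+1) = 0.
    rewrite (@ae_eq_Rintegral _ (cst 0))//.
    - by rewrite Rintegral_probability_cst.
    - exact: measurable_funX.
    - by apply: filterS Zm => w -> ; rewrite m0 expr0n.
  by rewrite !E expr0n mulr0.
have [M1 M2 M4] := normal_pdf_moments m s0.
have mp n : measurable_fun setT (fun x : R => (x - m) ^+ n).
  by apply: measurable_funX; exact: measurable_funB.
have L n : (n <= 4)%N -> \int[P]_w ((Z w - m) ^+ n) =
    \int[lebesgue_measure]_x ((x - m) ^+ n * normal_pdf m s x).
  move=> n4; apply: (Rintegral_normal_law mZ Zlaw (mp n)).
  exact: integrable_pow_normal_pdf.
have iZ := L4_integrable LZ.
have m0 : m = 0.
  have := L 1%N isT; rewrite [RHS]M1 RintegralB//; last exact: finite_measure_integrable_cst.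
  by rewrite EZ Rintegral_probability_cst sub0r => /eqP; rewrite oppr_eq0 => /eqP.
have := L 2%N isT; have := L 4%N isT; rewrite M2 M4 m0.
under eq_Rintegral do rewrite subr0.
under [\int[P]_w (_ ^+ 2)]eq_Rintegral do rewrite subr0.
by move=> -> ->; rewrite -exprM.
Qed.

(** The formula of Wick and Isserlis for centred jointly Gaussian variables, taken as a predicate on
    arbitrary variables so that it can be transported from values of a process to its time
    integrals. *)
Definition wick X1 X2 X3 X4 :=
  \int[P]_w (X1 w * X2 w * X3 w * X4 w) =
  \int[P]_w (X1 w * X2 w) * \int[P]_w (X3 w * X4 w) +
  \int[P]_w (X1 w * X3 w) * \int[P]_w (X2 w * X4 w) +
  \int[P]_w (X1 w * X4 w) * \int[P]_w (X2 w * X3 w).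

Lemma Rintegral_mulC X1 X2 : \int[P]_w (X1 w * X2 w) = \int[P]_w (X2 w * X1 w).
Proof. by apply: eq_Rintegral => w _; rewrite mulrC. Qed.

Lemma Rintegral_mulDl X1 X2 X3 : L4 X1 -> L4 X2 -> L4 X3 ->
  \int[P]_w ((X1 w + X2 w) * X3 w) =
  \int[P]_w (X1 w * X3 w) + \int[P]_w (X2 w * X3 w).
Proof.
move=> h1 h2 h3; rewrite -RintegralD//; [|exact: L4_prod2..].
by apply: eq_Rintegral => w _; rewrite mulrDl.
Qed.

Lemma Rintegral_mulZl (c : R) X1 X2 : L4 X1 -> L4 X2 ->
  \int[P]_w ((c * X1 w) * X2 w) = c * \int[P]_w (X1 w * X2 w).
Proof.
move=> h1 h2; rewrite -RintegralZl//; last exact: L4_prod2.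
by apply: eq_Rintegral => w _; rewrite mulrA.
Qed.

Lemma wick_polarization X1 X2 X3 X4 : L4 X1 -> L4 X2 -> L4 X3 -> L4 X4 ->
  (forall e2 e3 e4 : R, let Z w := X1 w + e2 * X2 w + e3 * X3 w + e4 * X4 w in
     \int[P]_w (Z w ^+ 4) = 3 * (\int[P]_w (Z w ^+ 2)) ^+ 2) ->
  wick X1 X2 X3 X4.
Proof.
move=> h1 h2 h3 h4 HZ.
pose Z e2 e3 e4 w := X1 w + e2 * X2 w + e3 * X3 w + e4 * X4 w.
have LZ e2 e3 e4 : L4 (Z e2 e3 e4).
  by apply: L4D (L4Z _ h4); apply: L4D (L4Z _ h3); apply: L4D (L4Z _ h2).
have L2 : L4 (fun w => X1 w + 0 * X2 w) by apply: L4D (L4Z _ h2).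
have E2 e2 e3 e4 : \int[P]_w (Z e2 e3 e4 w ^+ 2) =
  \int[P]_w (X1 w * X1 w) + e2 ^+ 2 * \int[P]_w (X2 w * X2 w) +
  e3 ^+ 2 * \int[P]_w (X3 w * X3 w) + e4 ^+ 2 * \int[P]_w (X4 w * X4 w) +
  2 * (e2 * \int[P]_w (X1 w * X2 w) + e3 * \int[P]_w (X1 w * X3 w) +
       e4 * \int[P]_w (X1 w * X4 w) + e2 * e3 * \int[P]_w (X2 w * X3 w) +
       e2 * e4 * \int[P]_w (X2 w * X4 w) + e3 * e4 * \int[P]_w (X3 w * X4 w)).
  have lin W : L4 W -> \int[P]_w (Z e2 e3 e4 w * W w) =
      \int[P]_w (X1 w * W w) + e2 * \int[P]_w (X2 w * W w) +
      e3 * \int[P]_w (X3 w * W w) + e4 * \int[P]_w (X4 w * W w).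
    move=> hW; have k2 := L4D h1 (L4Z e2 h2); have k3 := L4D k2 (L4Z e3 h3).
    rewrite (Rintegral_mulDl k3 (L4Z e4 h4) hW).
    rewrite (Rintegral_mulDl k2 (L4Z e3 h3) hW).
    by rewrite (Rintegral_mulDl h1 (L4Z e2 h2) hW) !Rintegral_mulZl.
  under eq_Rintegral do rewrite expr2.
  rewrite lin// !(Rintegral_mulC _ (Z e2 e3 e4)) !lin//.
  rewrite (Rintegral_mulC X2 X1) (Rintegral_mulC X3 X1) (Rintegral_mulC X4 X1).
  rewrite (Rintegral_mulC X3 X2) (Rintegral_mulC X4 X2) (Rintegral_mulC X4 X3).
  ring.
(* 192 = 4! * 8 is the polarization constant of quartic forms in four variables. *)
pose D3 e2 e3 w := Z e2 e3 1 w ^+ 4 - Z e2 e3 (-1) w ^+ 4.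
pose D2 e2 w := D3 e2 1 w - D3 e2 (-1) w.
have i3 e2 e3 : P.-integrable setT (EFin \o D3 e2 e3).
  have := integrableB measurableT (LZ e2 e3 1).2 (LZ e2 e3 (-1)).2.
  exact: eq_integrable.
have i2 e2 : P.-integrable setT (EFin \o D2 e2).
  have := integrableB measurableT (i3 e2 1) (i3 e2 (-1)).
  exact: eq_integrable.
have h0 : \int[P]_w (192 * (X1 w * X2 w * X3 w * X4 w)) = \int[P]_w (D2 1 w - D2 (-1) w).
  by apply: eq_Rintegral => w _; rewrite /D2 /D3 /Z; ring.
rewrite RintegralZl// in h0; last exact: L4_prod4.
rewrite RintegralB// in h0.
have e2E e2 : \int[P]_w D2 e2 w = \int[P]_w D3 e2 1 w - \int[P]_w D3 e2 (-1) w.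
  by rewrite RintegralB//.
have e3E e2 e3 : \int[P]_w D3 e2 e3 w =
    3 * (\int[P]_w (Z e2 e3 1 w ^+ 2)) ^+ 2 - 3 * (\int[P]_w (Z e2 e3 (-1) w ^+ 2)) ^+ 2.
  by rewrite RintegralB//; [rewrite -!HZ|exact: (LZ _ _ _).2..].
rewrite !e2E !e3E !E2 in h0.
have n0 : (192 : R) != 0 by rewrite pnatr_eq0.
apply: (mulfI n0); rewrite h0 /wick; ring.
Qed.

(** Time integrals are treated in the last argument only; a cyclic shift brings each argument there
    in turn. *)
Lemma wick_rot X1 X2 X3 X4 : wick X1 X2 X3 X4 -> wick X4 X1 X2 X3.
Proof.
rewrite /wick (Rintegral_mulC X4 X1) (Rintegral_mulC X4 X2) (Rintegral_mulC X4 X3) => h.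
rewrite (_ : \int[P]_w _ = \int[P]_w (X1 w * X2 w * X3 w * X4 w)).
  by rewrite h; ring.
by apply: eq_Rintegral => w _; ring.
Qed.

End FourthMoments.

(** * Integrals of a process over time *)

Section TimeIntegrals.
Context d (T : measurableType d) (R : realType) (P : probability T R).
Notation mu := (@lebesgue_measure R).
Variable (f : R -> R).
Hypotheses (mf : measurable_fun setT f) (intf : mu.-integrable setT (EFin \o f)).

Definition joint_measurable (h : T -> R -> R) :=
  measurable_fun [set: T * measurableTypeR R] (fun z => h z.1 z.2).

Definition time_integral (h : T -> R -> R) (w : T) : R :=
  \int[mu]_t (f t * h w t).

Lemma joint_measurableM h1 h2 : joint_measurable h1 -> joint_measurable h2 ->
  joint_measurable (fun w t => h1 w t * h2 w t).
Proof. exact: measurable_funM. Qed.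

Lemma joint_measurable_fst (X : T -> R) : measurable_fun setT X ->
  joint_measurable (fun w _ => X w).
Proof. by move=> mX; apply: (measurableT_comp mX measurable_fst). Qed.

Lemma joint_measurable_snd : joint_measurable (fun _ t => f t).
Proof.
exact: (measurableT_comp (mf : measurable_fun [set: measurableTypeR R] f)
  (@measurable_snd _ _ T (measurableTypeR R))).
Qed.

Lemma joint_measurable_slice h t : joint_measurable h ->
  measurable_fun setT (fun w => h w t).
Proof.
move=> mh.
exact: (measurableT_comp mh (pair2_measurable (t : measurableTypeR R))).
Qed.

Lemma measurable_time_integral h : joint_measurable h ->
  measurable_fun setT (time_integral h).
Proof.
move=> mh; have mfh := joint_measurableM joint_measurable_snd mh.
have mE : measurable_fun [set: T * measurableTypeR R] (fun z => (f z.2 * h z.1 z.2)%:E).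
  exact/measurable_EFinP.
apply: (@measurableT_comp _ _ _ _ _ _ fine) => //.
under [X in measurable_fun _ X]eq_fun do rewrite integralE.
apply: emeasurable_funB.
- have := @measurable_fun_fubini_tonelli_F _ _ T (measurableTypeR R) R mu _
    (measurable_funepos mE) (fun z => funepos_ge0 _ z).
  by apply: eq_measurable_fun => w _; apply: eq_integral => t _; rewrite !funeposE.
- have := @measurable_fun_fubini_tonelli_F _ _ T (measurableTypeR R) R mu _
    (measurable_funeneg mE) (fun z => funeneg_ge0 _ z).
  by apply: eq_measurable_fun => w _; apply: eq_integral => t _; rewrite !funenegE.
Qed.

Section Fubini.
Variables (h : T -> R -> R) (M : R).
Hypothesis mh : joint_measurable h.
Hypothesis hM : forall t, f t != 0 -> (\int[P]_w `|(h w t)%:E| <= M%:E)%E.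

Let F (z : T * measurableTypeR R) := (f z.2 * h z.1 z.2)%:E.

Let mF : measurable_fun setT F.
Proof.
by apply/measurable_EFinP; exact: (joint_measurableM joint_measurable_snd mh).
Qed.

(** Tonelli: integrating over the probability space first leaves at most [M |f t|]. The moment bound
    is asked only where [f] does not vanish, since the moments of the process are bounded only
    locally in time. *)
Lemma integrable_time_product : (P \x mu)%E.-integrable setT F.
Proof.
apply/(integrable21ltyP _ _ mF).
have /integrableP[mfE foo] := integrableZl measurableT M (integrable_norm intf).
apply: le_lt_trans foo; apply: ge0_le_integral => //.
- by move=> t _; exact: integral_ge0.
- apply: (@measurable_fun_fubini_tonelli_G _ _ _ _ _ P (abse \o F)) => //.
    exact: measurableT_comp.
  by move=> z; exact: abse_ge0.
- exact: measurableT_comp.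
move=> t _ /=.
under eq_integral do rewrite normrM EFinM.
rewrite ge0_integralZl//; last first.
  apply/measurable_EFinP/measurableT_comp => //.
  exact: joint_measurable_slice.
have [->|ft0] := eqVneq (f t) 0; first by rewrite normr0 mul0e lee_fin.
have M0 : 0 <= M by rewrite -lee_fin (le_trans _ (hM ft0))// integral_ge0.
rewrite normrM normr_id (ger0_norm M0) mulrC EFinM.
by rewrite lee_wpmul2l// hM.
Qed.

Lemma ae_integrable_time :
  {ae P, forall w, mu.-integrable setT (fun t => (f t * h w t)%:E)}.
Proof. exact: (ae_integrable1 integrable_time_product). Qed.

Lemma ae_time_integralE :
  {ae P, forall w, (time_integral h w)%:E = (\int[mu]_t (f t * h w t)%:E)%E}.
Proof.
apply: filterS ae_integrable_time => w iw.
by rewrite fineK// integrable_fin_num.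
Qed.

Lemma integrable_time_integral : P.-integrable setT (EFin \o time_integral h).
Proof.
have /integrableP[mI foo] := integrable_fubini_F integrable_time_product.
apply/integrableP; split; first exact/measurable_EFinP/measurable_time_integral.
apply: le_lt_trans foo; rewrite le_eqVlt; apply/orP; left; apply/eqP.
apply: ae_eq_integral => //.
- by apply: measurableT_comp => //; exact/measurable_EFinP/measurable_time_integral.
- exact: measurableT_comp.
- by apply: filterS ae_time_integralE => w wE _; congr abse; exact: wE.
Qed.

Lemma Rintegral_time_integral :
  \int[P]_w time_integral h w = \int[mu]_t (f t * \int[P]_w h w t).
Proof.
have ih t : f t != 0 -> P.-integrable setT (fun w => (h w t)%:E).
  move=> ft0; apply/integrableP; split.
    exact/measurable_EFinP/joint_measurable_slice.
  by rewrite (le_lt_trans (hM ft0))// ltry.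
congr fine; transitivity (\int[P]_w \int[mu]_t F (w, t))%E.
  apply: ae_eq_integral => //.
  - exact/measurable_EFinP/measurable_time_integral.
  - exact: measurable_int (integrable_fubini_F integrable_time_product).
  - by apply: filterS ae_time_integralE => w /= -> _.
rewrite (integral12_prod_meas1 integrable_time_product).
rewrite -(integral21_prod_meas1 integrable_time_product).
apply: eq_integral => t _; rewrite /fubini_G /F/=.
have [->|ft0] := eqVneq (f t) 0.
  by rewrite mul0r; under eq_integral do rewrite mul0r; rewrite integral0.
under eq_integral do rewrite EFinM.
rewrite integralZl//; last exact: ih.
by rewrite EFinM fineK// integrable_fin_num//; exact: ih.
Qed.

Lemma integrable_expectation_time :
  mu.-integrable setT (fun t => (f t * \int[P]_w h w t)%:E).
Proof.
have ih t : f t != 0 -> P.-integrable setT (fun w => (h w t)%:E).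
  move=> ft0; apply/integrableP; split.
    exact/measurable_EFinP/joint_measurable_slice.
  by rewrite (le_lt_trans (hM ft0))// ltry.
apply: (@le_integrable _ _ _ mu setT measurableT _
  (fun t => M%:E * (EFin \o (Num.norm \o f)) t)%E); last first.
- exact/integrableZl/integrable_norm.
- move=> t _; rewrite -EFinM !abse_EFin !lee_fin.
  have [->|ft0] := eqVneq (f t) 0; first by rewrite mul0r normr0 normr_ge0.
  rewrite !normrM normr_id mulrC ler_wpM2r// (le_trans _ (ler_norm _))//.
  rewrite -lee_fin EFin_normr_Rintegral//; last exact: ih.
  rewrite (le_trans _ (hM ft0))// le_abse_integral//.
  exact: measurable_int (ih _ ft0).
have := measurable_fubini_G integrable_time_product.
apply: eq_measurable_fun => t _; rewrite /fubini_G /F/=.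
have [->|ft0] := eqVneq (f t) 0.
  by rewrite mul0r; under eq_integral do rewrite mul0r; rewrite integral0.
under eq_integral do rewrite EFinM.
rewrite integralZl//; last exact: ih.
by rewrite EFinM fineK// integrable_fin_num//; exact: ih.
Qed.

End Fubini.

End TimeIntegrals.

(** * Fourth moments and Wick's formula for time integrals *)

Section FourthMomentTimeIntegral.
Context d (T : measurableType d) (R : realType) (P : probability T R).
Notation mu := (@lebesgue_measure R).
Variable (f : R -> R).
Hypotheses (mf : measurable_fun setT f) (intf : mu.-integrable setT (EFin \o f)).

Variables (h : T -> R -> R) (M : R).
Hypothesis mh : joint_measurable h.
Hypothesis hL : forall t, f t != 0 -> L4 P (fun w => h w t).
Hypothesis hM : forall t, f t != 0 -> \int[P]_w (h w t ^+ 4) <= M.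

Lemma L4_prod3_time X1 X2 X3 : L4 P X1 -> L4 P X2 -> L4 P X3 ->
  forall t, f t != 0 -> (\int[P]_w `|(X1 w * X2 w * X3 w * h w t)%:E| <=
    (\int[P]_w (X1 w ^+ 4) + \int[P]_w (X2 w ^+ 4) + \int[P]_w (X3 w ^+ 4) + M)%:E)%E.
Proof.
move=> h1 h2 h3 t ft0.
have i4 := L4_prod4 h1 h2 h3 (hL ft0).
have i := integrable_norm i4.
rewrite -[leLHS]fineK; last exact: integrable_fin_num i.
rewrite lee_fin (@le_trans _ _ (\int[P]_w (X1 w ^+ 4 + X2 w ^+ 4 + X3 w ^+ 4 + h w t ^+ 4)))//.
  apply: le_Rintegral => // [|w _]; last exact: normr_prod4_le.
  exact: (integrableD measurableT (integrableD measurableT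
    (integrableD measurableT h1.2 h2.2) h3.2) (hL ft0).2).
rewrite RintegralD ?RintegralD ?lerD2l ?hM//.
- exact: h1.2.
- exact: h2.2.
- exact: (integrableD measurableT h1.2 h2.2).
- exact: h3.2.
- exact: (integrableD measurableT (integrableD measurableT h1.2 h2.2) h3.2).
- exact: (hL ft0).2.
Qed.

Lemma ae_integrable_time_integrand :
  {ae P, forall w, mu.-integrable setT (fun t => (f t * h w t)%:E)}.
Proof.
have c1 := L4_cst P 1.
apply: (ae_integrable_time mf intf mh) => t ft0.
have := L4_prod3_time c1 c1 c1 ft0.
by under eq_integral do rewrite !mul1r; exact.
Qed.

Lemma Rintegral_mul_time_integral X1 X2 X3 : L4 P X1 -> L4 P X2 -> L4 P X3 ->
  \int[P]_w (X1 w * X2 w * X3 w * time_integral f h w) =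
  \int[mu]_t (f t * \int[P]_w (X1 w * X2 w * X3 w * h w t)).
Proof.
move=> h1 h2 h3.
have m3 : measurable_fun setT (fun w => X1 w * X2 w * X3 w).
  by do 2 (apply: measurable_funM; [|by case: h1 h2 h3 => ? _ [? _] [? _]]);
    case: h1.
have mh3 := joint_measurableM (joint_measurable_fst m3) mh.
rewrite -(Rintegral_time_integral mf intf mh3 (L4_prod3_time h1 h2 h3)).
apply: ae_eq_Rintegral.
- by apply: measurable_funM => //; exact: (measurable_time_integral mf).
- exact: (measurable_time_integral mf).
apply: filterS ae_integrable_time_integrand => w iw.
rewrite /time_integral -RintegralZl//.
by apply: eq_Rintegral => t _; rewrite mulrCA.
Qed.

Lemma integrable_mul_time X1 X2 X3 : L4 P X1 -> L4 P X2 -> L4 P X3 ->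
  mu.-integrable setT (fun t => (f t * \int[P]_w (X1 w * X2 w * X3 w * h w t))%:E).
Proof.
move=> h1 h2 h3.
have m3 : measurable_fun setT (fun w => X1 w * X2 w * X3 w).
  by do 2 (apply: measurable_funM; [|by case: h1 h2 h3 => ? _ [? _] [? _]]);
    case: h1.
have mh3 := joint_measurableM (joint_measurable_fst m3) mh.
exact: (integrable_expectation_time mf intf mh3 (L4_prod3_time h1 h2 h3)).
Qed.

(** Pathwise, the fourth power of the integral is at most [(A + 1)^3] times the integral of
    [|f| h^4], where [A] is the integral of [|f|]; the latter variable is integrable by Fubini
    applied to [|f|] and [h^4]. *)
Lemma L4_time_integral : L4 P (time_integral f h).
Proof.
have mI := measurable_time_integral mf mh.
have mnf : measurable_fun setT (fun t => `|f t|) by exact: measurableT_comp.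
have inf : mu.-integrable setT (EFin \o (fun t => `|f t|)) by exact: integrable_norm intf.
have mh4 : joint_measurable (fun w t => h w t ^+ 4) by exact: measurable_funX.
have hM4 t : `|f t| != 0 -> (\int[P]_w `|(h w t ^+ 4)%:E| <= M%:E)%E.
  rewrite normr_eq0 => ft0; under eq_integral do
    rewrite abse_EFin ger0_norm ?exprn_even_ge0//.
  rewrite -[leLHS]fineK; last exact: integrable_fin_num (hL ft0).2.
  by rewrite lee_fin hM.
split => //; apply/integrableP; split; first exact/measurable_EFinP/measurable_funX.
pose A := \int[mu]_t `|f t|.
have A0 : 0 <= A by apply: Rintegral_ge0.
have intU := integrable_time_integral mnf inf mh4 hM4.
have mU := measurable_time_integral mnf mh4.
set U := time_integral _ _ in intU mU.
have U0 w : 0 <= U w by apply: Rintegral_ge0 => t _; rewrite mulr_ge0// exprn_even_ge0.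
have /integrableP[_] := integrableZl measurableT ((A + 1) ^+ 3) intU.
apply: le_lt_trans; apply: ae_ge0_le_integral => //.
- by apply/measurableT_comp => //; exact/measurable_EFinP/measurable_funX.
- by apply/measurableT_comp => //; apply: emeasurable_funM => //; exact/measurable_EFinP.
have := ae_integrable_time mnf inf mh4 hM4.
apply: filterS2 ae_integrable_time_integrand => w iw iw4 _.
rewrite -EFinM !abse_EFin lee_fin (le_trans _ (ler_norm _))// ger0_norm ?exprn_even_ge0//.
pose B := \int[mu]_t `|f t * h w t|.
have B0 : 0 <= B by apply: Rintegral_ge0.
have IB : `|time_integral f h w| <= B by exact: le_normr_Rintegral.
have -> : time_integral f h w ^+ 4 = `|time_integral f h w| ^+ 4.
  by rewrite -normrX ger0_norm// exprn_even_ge0.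
apply: (@le_trans _ _ (B ^+ 4)); first by rewrite lerXn2r// nnegrE.
(* The mean of [|h|] would be [B / A]; [A + 1] keeps the tangent point meaningful when [f] vanishes
   almost everywhere. Then [4 c^3 B - 3 c^4 A = c^4 (A + 4)], which is still at least
   [c^4 (A + 1)]. *)
pose c := B / (A + 1).
have c0 : 0 <= c by rewrite divr_ge0// addr_ge0.
(* Jensen for y |-> y ^ 4 and the finite measure |f| dt, through the tangent at c. *)
have tangent t : 4 * c ^+ 3 * `|f t * h w t| - 3 * c ^+ 4 * `|f t| <= `|f t| * h w t ^+ 4.
  rewrite normrM mulrCA [_ * `|f t|]mulrC -mulrBr ler_wpM2l//.
  have -> : h w t ^+ 4 = `|h w t| ^+ 4 by rewrite -normrX ger0_norm// exprn_even_ge0.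
  set y := `|h w t|; have y0 : 0 <= y by exact: normr_ge0.
  rewrite -subr_ge0.
  have -> : y ^+ 4 - (4 * c ^+ 3 * y - 3 * c ^+ 4) =
    (y - c) ^+ 2 * (y ^+ 2 + 2 * c * y + 3 * c ^+ 2) by ring.
  rewrite mulr_ge0 ?sqr_ge0//.
  have := mulr_ge0 c0 y0; have := sqr_ge0 y; have := sqr_ge0 c; lra.
have i1 := integrableZl measurableT (4 * c ^+ 3) (integrable_norm iw).
have i2 := integrableZl measurableT (3 * c ^+ 4) inf.
have key : 4 * c ^+ 3 * B - 3 * c ^+ 4 * A <= U w.
  rewrite /B /A -!RintegralZl//; last exact: (integrable_norm iw).
  rewrite -RintegralB//; apply: le_Rintegral => //.
  exact: (integrableB measurableT i1 i2).
have A1 : 0 < A + 1 by rewrite ltr_wpDl.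
have Bc : B = c * (A + 1) by rewrite /c divfK// gt_eqF.
have c4 : 0 <= c ^+ 4 by rewrite exprn_ge0.
have : c ^+ 4 * (A + 1) <= U w.
  by apply: le_trans key; rewrite Bc; nra.
move=> hU; rewrite Bc.
have -> : (c * (A + 1)) ^+ 4 = (A + 1) ^+ 3 * (c ^+ 4 * (A + 1)) by ring.
by rewrite ler_wpM2l// exprn_ge0// ltW.
Qed.

(** Both sides of Wick's formula are linear in the last variable, hence commute with the integral
    against [f]. *)
Lemma wick_time_integral X1 X2 X3 : L4 P X1 -> L4 P X2 -> L4 P X3 ->
  (forall t, f t != 0 -> wick P X1 X2 X3 (fun w => h w t)) ->
  wick P X1 X2 X3 (time_integral f h).
Proof.
move=> h1 h2 h3 W.
have c1 := L4_cst P 1.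
have red X : L4 P X -> \int[P]_w (X w * time_integral f h w) =
    \int[mu]_t (f t * \int[P]_w (X w * h w t)).
  move=> hX; have := Rintegral_mul_time_integral c1 c1 hX.
  under eq_Rintegral do rewrite !mul1r.
  by move=> ->; apply: eq_Rintegral => t _; under eq_Rintegral do rewrite !mul1r.
have ired X : L4 P X ->
    mu.-integrable setT (fun t => (f t * \int[P]_w (X w * h w t))%:E).
  move=> hX; have := integrable_mul_time c1 c1 hX.
  by apply: eq_integrable => // t _; under eq_Rintegral do rewrite !mul1r.
rewrite /wick Rintegral_mul_time_integral// !red//.
have iZ (c : R) X : L4 P X ->
    mu.-integrable setT (fun t => (c * (f t * \int[P]_w (X w * h w t)))%:E).
  move=> hX; have := integrableZl measurableT c (ired _ hX).
  exact: eq_integrable.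
rewrite [X in _ = _ + X]mulrC -!RintegralZl//; [|exact: ired..].
rewrite -RintegralD//; [|exact: iZ..].
rewrite -RintegralD//; last 2 first.
- have := integrableD measurableT (iZ (\int[P]_w (X1 w * X2 w)) _ h3)
    (iZ (\int[P]_w (X1 w * X3 w)) _ h2).
  exact: eq_integrable.
- exact: iZ.
apply: eq_Rintegral => t _.
have [->|ft0] := eqVneq (f t) 0; first by rewrite !(mul0r,mulr0) !addr0.
by rewrite (W t ft0); ring.
Qed.

End FourthMomentTimeIntegral.

(** * Matrix powers *)

Section MatrixExponential.
Context {R : realType} {p : nat}.
Variable H : 'M[R]_p.

Let B : R := 1 + \sum_(i < p) \sum_(j < p) `|H i j|.

Let B_ge0 : 0 <= B.
Proof. by rewrite addr_ge0// sumr_ge0// => i _; rewrite sumr_ge0. Qed.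

(** Row sums are estimated instead of single entries, because their bound is stable under
    multiplication by [H]; every row sum of [H] is at most [B]. *)
Lemma normr_expmx_le (k : nat) (i j : 'I_p) : `|(H ^+ k) i j| <= B ^+ k.
Proof.
suff : \sum_(j < p) `|(H ^+ k) i j| <= B ^+ k.
  by apply: le_trans; rewrite (bigD1 j)//= lerDl sumr_ge0.
elim: k i {j} => [|k IH] i.
  rewrite !expr0 (bigD1 i)//= big1 ?addr0.
    by rewrite [1]/(1%:M) mxE eqxx normr1.
  by move=> l /negbTE li; rewrite [1]/(1%:M) mxE eq_sym li normr0.
rewrite !exprS.
have -> : \sum_(j < p) `|(H * H ^+ k) i j| = \sum_(j < p) `|\sum_l H i l * (H ^+ k) l j|.
  by apply: eq_bigr => j _; rewrite mxE.
apply: (@le_trans _ _ (\sum_(j < p) \sum_l `|H i l| * `|(H ^+ k) l j|)).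
  apply: ler_sum => j _; rewrite (le_trans (ler_norm_sum _ _ _))//.
  by apply: ler_sum => l _; rewrite normrM.
rewrite exchange_big /=.
apply: (@le_trans _ _ (\sum_l `|H i l| * B ^+ k)).
  by apply: ler_sum => l _; rewrite -mulr_sumr ler_wpM2l.
rewrite -mulr_suml ler_wpM2r ?exprn_ge0// ler_wpDl//.
rewrite (bigD1 i (F := fun i => \sum_j `|H i j|))//= lerDl sumr_ge0// => l _.
by rewrite sumr_ge0.
Qed.

Definition expmx_coeff (s : R) (i j : 'I_p) (k : nat) : R := s ^+ k / k`!%:R * (H ^+ k) i j.

Lemma cvg_mx_entries (u : nat -> 'M[R]_p) (l : 'M[R]_p) :
  (forall i j, u n i j @[n --> \oo] --> l i j) -> u @ \oo --> l.
Proof.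
move=> ul A [Q nQ sQA]; rewrite /nbhs/=.
have F : \forall n \near \oo, forall i j, Q i j (u n i j).
  by apply: filter_forall => i; apply: filter_forall => j; exact: ul.
by apply: filterS F => n Qn; apply: sQA.
Qed.

Let coeff_le s i j k : `|expmx_coeff s i j k| <= exp_coeff (`|s| * B) k.
Proof.
rewrite /expmx_coeff /exp_coeff/= !normrM normrX normfV normr_nat exprMn.
rewrite mulrAC ler_wpM2r ?invr_ge0//.
by rewrite ler_wpM2l ?exprn_ge0// normr_expmx_le.
Qed.

Lemma is_cvg_expmx_coeff s i j : cvgn (series (expmx_coeff s i j)).
Proof.
apply: normed_cvg; apply: (@series_le_cvg _ _ (exp_coeff (`|s| * B))) => //.
- by move=> k; exact: normr_ge0.
- by move=> k; rewrite exp_coeff_ge0// mulr_ge0.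
- by move=> k; exact: coeff_le.
- exact: is_cvg_series_exp_coeff.
Qed.

Lemma mxpowRE (a : R) i j : mxpowR a H i j = limn (series (expmx_coeff (ln a) i j)).
Proof.
rewrite /mxpowR; set u := series _.
have -> : limn u = \matrix_(i, j) limn (series (expmx_coeff (ln a) i j)).
  apply/cvg_lim => //; apply: cvg_mx_entries => k l; rewrite mxE.
  rewrite (_ : (fun n => u n k l) = series (expmx_coeff (ln a) k l)).
    exact: is_cvg_expmx_coeff.
  by apply/funext => n; rewrite /u /series /= summxE; apply: eq_bigr => m _; rewrite mxE.
by rewrite mxE.
Qed.

Let partial_le (x : R) n : 0 <= x -> \sum_(0 <= k < n) exp_coeff x k <= expR x.
Proof.
move=> x0; apply: nondecreasing_cvgn_le; last exact: is_cvg_series_exp_coeff.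
by apply/nondecreasing_seqP => k; rewrite /series/= big_nat_recr//= lerDl exp_coeff_ge0.
Qed.

Lemma mxpowR_bounded (a S : R) i j : `|ln a| <= S -> `|mxpowR a H i j| <= expR (S * B).
Proof.
move=> aS; rewrite mxpowRE.
have cv := @is_cvg_expmx_coeff (ln a) i j.
have S0 : 0 <= S by exact: le_trans aS.
have K n : `|series (expmx_coeff (ln a) i j) n| <= expR (S * B).
  rewrite (le_trans (ler_norm_sum _ _ _))//.
  apply: (@le_trans _ _ (\sum_(0 <= k < n) exp_coeff (`|ln a| * B) k)).
    by apply: ler_sum => k _; exact: coeff_le.
  by rewrite (le_trans (partial_le _ _))// ?mulr_ge0// ler_expR ler_wpM2r.
rewrite ler_norml; apply/andP; split.
- by apply: limr_ge => //; apply: nearW => n; have := K n; rewrite ler_norml => /andP[].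
- by apply: limr_le => //; apply: nearW => n; have := K n; rewrite ler_norml => /andP[].
Qed.

(** The first two terms are split off; as [|s| <= 1] and [(k + 2)! >= k!], the term of rank [k + 2]
    is at most [s^2 B^2] times the k-th term of [expR B]. This and the boundedness above are the
    only facts on [a^H] that are used later; the group law in [a] never intervenes. *)
Lemma mxpowR_expansion (a : R) i j : `|ln a| <= 1 ->
  `|mxpowR a H i j - (1%:M i j + ln a * H i j)| <= ln a ^+ 2 * (B ^+ 2 * expR B).
Proof.
move=> a1; rewrite mxpowRE; set s := ln a in a1 *.
have cv := @is_cvg_expmx_coeff s i j.
have K n : `|series (expmx_coeff s i j) n.+2 - (1%:M i j + s * H i j)| <=
    s ^+ 2 * (B ^+ 2 * expR B).
  rewrite /series/= big_nat_recl// big_nat_recl//= /expmx_coeff !expr0 !expr1.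
  rewrite !fact0 !factS fact0 !muln1 !divr1 mul1r.
  have E0 (x y z : R) : x + (y + z) - (x + y) = z by ring.
  rewrite -[1%:M]/(1 : 'M[R]_p) E0.
  rewrite (le_trans (ler_norm_sum _ _ _))//.
  apply: (@le_trans _ _ (\sum_(0 <= k < n) s ^+ 2 * B ^+ 2 * exp_coeff B k)).
    apply: ler_sum => k _.
    have := coeff_le s i j k.+2; rewrite /expmx_coeff => /le_trans; apply.
    rewrite /exp_coeff/= exprMn -[s ^+ 2]real_normK ?num_real//.
    have -> : `|s| ^+ k.+2 * B ^+ k.+2 / (k.+2)`!%:R =
      `|s| ^+ 2 * B ^+ 2 * ((`|s| ^+ k * B ^+ k) / (k.+2)`!%:R) by rewrite !exprS; ring.
    rewrite ler_wpM2l ?mulr_ge0 ?exprn_ge0// ler_pM ?mulr_ge0 ?exprn_ge0 ?invr_ge0//.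
      by rewrite ler_piMl ?exprn_ge0// exprn_ile1.
    by rewrite lef_pV2 ?posrE ?ltr0n ?fact_gt0// ler_nat !factS mulnA leq_pmull.
  rewrite -mulr_sumr -mulrA ler_wpM2l ?sqr_ge0// ler_wpM2l ?sqr_ge0//.
  exact: partial_le.
have lim2 : (fun n => series (expmx_coeff s i j) n.+2) @ \oo --> limn (series (expmx_coeff s i j)).
  by rewrite (cvg_shiftS (fun n => series (expmx_coeff s i j) n.+1)) cvg_shiftS.
have cv2 : cvgn (fun n => series (expmx_coeff s i j) n.+2) by apply/cvg_ex; eexists; exact: lim2.
rewrite -(cvg_lim _ lim2)//.
rewrite ler_distl; apply/andP; split.
- apply: limr_ge => //; apply: nearW => n; have := K n.
  by rewrite ler_distl => /andP[].
- apply: limr_le => //; apply: nearW => n; have := K n.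
  by rewrite ler_distl => /andP[].
Qed.

End MatrixExponential.

(** * A Sylvester equation with only the zero solution *)

Section Sylvester.
Context {R : realType}.

(* Q intertwines H with c - H^T, and the spectra of these two matrices are
   disjoint: the characteristic polynomial of H vanishes at H and is invertible
   at c - H^T. *)
Lemma sylvester_eq0 (p : nat) (H Q : 'M[R]_p) (c : R) :
  (forall h : R[i], eigenvalue (map_mx (real_complex R) H) h ->
     complex.Re h < c / 2) ->
  H *m Q + Q *m H^T = c *: Q -> Q = 0.
Proof.
case: p H Q => [|n] H Q spec HQ; first by rewrite [Q]flatmx0.
pose C := R[i].
pose A : 'M[C]_n.+1 := map_mx (real_complex R) H.
pose Qc : 'M[C]_n.+1 := map_mx (real_complex R) Q.
pose cc : C := (c%:C)%C.
pose N : 'M[C]_n.+1 := cc%:M - A^T.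
have AQ : A *m Qc = Qc *m N.
  have := congr1 (map_mx (real_complex R)) HQ.
  rewrite map_mxD !map_mxM -map_trmx map_mxZ -/A -/Qc => E.
  rewrite mulmxBr mul_mx_scalar; apply/eqP; rewrite eq_sym subr_eq; apply/eqP.
  by rewrite E.
have [rs rsE] := closed_field_poly_normal (char_poly A).
rewrite (monicP (char_poly_monic A)) scale1r in rsE.
have root_unit r : r \in rs -> N - r%:M \in unitmx.
  move=> rrs.
  have er : eigenvalue A r by rewrite eigenvalue_root_char rsE root_prod_XsubC.
  (* The real parts of [r] and [c - r] add up to [c], so they cannot both lie below [c / 2]. *)
  have ner : ~~ eigenvalue A (cc - r).
    apply/negP => /spec; have := spec _ er.
    case: (r) => r1 r2 /=; lra.
  have : A - (cc - r)%:M \in unitmx.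
    rewrite -row_free_unit -kermx_eq0; move: ner.
    by rewrite /eigenvalue negbK /eigenspace.
  rewrite -unitmx_tr; rewrite (_ : N - r%:M = - (A - (cc - r)%:M)^T).
    set M := (A - _)^T => uM; have : - M *m - invmx M = 1%:M.
      by rewrite mulNmx mulmxN opprK mulmxV.
    by move/mulmx1_unit => [].
  rewrite raddfB/= tr_scalar_mx /N opprB raddfB/= addrAC; congr (_ - _).
have comm (s : seq C) : \prod_(r <- s) (A - r%:M) *m Qc = Qc *m \prod_(r <- s) (N - r%:M).
  elim: s => [|r s IH]; first by rewrite !big_nil mul1mx mulmx1.
  rewrite !big_cons -!mulmxE -mulmxA IH !mulmxA; congr (_ *m _).
  by rewrite mulmxBl AQ (mulmxBr Qc N) mul_scalar_mx mul_mx_scalar.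
have CH : \prod_(r <- rs) (A - r%:M) = 0.
  have := Cayley_Hamilton A; rewrite rsE rmorph_prod => <-.
  by apply: eq_bigr => r _; rewrite rmorphB/= horner_mx_X horner_mx_C.
have Nunit (s : seq C) : {subset s <= rs} -> \prod_(r <- s) (N - r%:M) \in unitmx.
  elim: s => [|r s IH] sub; first by rewrite big_nil unitmx1.
  rewrite big_cons -mulmxE unitmx_mul root_unit ?sub ?mem_head//= IH// => x xs.
  by rewrite sub// in_cons xs orbT.
have Qc0 : Qc = 0.
  have := comm rs; rewrite CH mul0mx => /(congr1 (fun M => M *m invmx (\prod_(r <- rs) (N - r%:M)))).
  by rewrite mul0mx mulmxK ?Nunit// => <-.
apply/matrixP => i j; have := congr1 (fun M : 'M[C]_n.+1 => complex.Re (M i j)) Qc0.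
by rewrite !mxE.
Qed.

End Sylvester.

(** * Self-similar covariance functions *)

Section Fekete.
Context {R : realType}.

Lemma subadditive_mulrn (f : R -> R) (t r : R) (n : nat) :
  (forall x y, f (x + y) <= f x + f y) -> f (n%:R * t + r) <= n%:R * f t + f r.
Proof.
move=> fD; elim: n => [|n IH]; first by rewrite !mul0r !add0r.
rewrite -natr1 !mulrDl !mul1r addrAC addrC (le_trans (fD _ _))//.
by rewrite (addrC _ (f t)) -addrA lerD2l.
Qed.

(** Fekete's lemma on the real line; the limit is the infimum of [f t / t] over [t > 0]. For [t]
    nearly optimal and [x = n t + r] with [0 <= r <= t], [f x <= n f t + f r], and local boundedness
    makes [f r] negligible against [x]. *)
Lemma subadditive_cvg (f : R -> R) :
  (forall x, 0 <= f x) -> (forall x y, f (x + y) <= f x + f y) ->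
  (forall L, exists M, forall x, 0 <= x <= L -> f x <= M) ->
  exists l : R, f x / x @[x --> +oo] --> l.
Proof.
move=> f0 fD fM; pose A := [set f t / t | t in [set t | 0 < t]].
have A0 : A !=set0 by exists (f 1 / 1); exists 1 => //=.
have lA : lbound A 0 by move=> _ [t /= t0 <-]; rewrite divr_ge0// ltW.
have infA : has_inf A by split => //; exists 0.
exists (inf A); apply/cvgrPdist_le => e e0.
have e20 : 0 < e / 2 by rewrite divr_gt0.
have [_ [t /= t0 <-] ht] := inf_adherent e20 infA.
have [M HM] := fM t.
near=> x.
have x0 : 0 < x by near: x; apply: nbhs_pinfty_gt; rewrite num_real.
have Mx : M / (e / 2) <= x by near: x; apply: nbhs_pinfty_ge; rewrite num_real.
have lx : inf A <= f x / x by apply: ge_inf; [exact: infA.2|exists x].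
rewrite distrC ger0_norm ?subr_ge0// lerBlDl.
pose n := Num.truncn (x / t); pose r := x - n%:R * t.
have /andP[nx xn] : n%:R <= x / t < n.+1%:R by apply: truncn_itv; rewrite divr_ge0// ltW.
rewrite ler_pdivlMr// in nx; rewrite ltr_pdivrMr// in xn.
have r0 : 0 <= r <= t.
  by rewrite subr_ge0 nx/= lerBlDl (le_trans (ltW xn))// -natr1 mulrDl mul1r.
have := subadditive_mulrn t r n fD; rewrite {1}/r addrC subrK => fx.
have fr := HM _ r0.
have q0 : 0 <= f t / t by rewrite divr_ge0// ltW.
rewrite ler_pdivrMr//.
have h1 : n%:R * f t <= x * (f t / t).
  have -> : n%:R * f t = n%:R * t * (f t / t) by field; rewrite gt_eqF.
  by rewrite ler_wpM2r.
have h2 : M <= x * (e / 2) by rewrite -ler_pdivrMr.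
have h3 : x * (f t / t) <= x * (inf A + e / 2) by rewrite ler_wpM2l// ltW.
lra.
Unshelve. all: by end_near. Qed.

End Fekete.

(** * Entrywise bounds and conjugation by a^H *)

Section EntryBounds.
Context {R : realType} {p : nat}.
Implicit Types M N W : 'M[R]_p.

Definition entries_le M (m : R) := forall i j, `|M i j| <= m.

Lemma entries_le_mul M N m n : 0 <= m -> entries_le M m -> entries_le N n ->
  entries_le (M *m N) (p%:R * m * n).
Proof.
move=> m0 hM hN i j; rewrite mxE (le_trans (ler_norm_sum _ _ _))//.
apply: (@le_trans _ _ (\sum_(k < p) m * n)).
  by apply: ler_sum => k _; rewrite normrM ler_pM.
by rewrite sumr_const card_ord -mulrA mulr_natl.
Qed.

Lemma entries_leD M N m n : entries_le M m -> entries_le N n ->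
  entries_le (M + N) (m + n).
Proof.
by move=> hM hN i j; rewrite mxE (le_trans (ler_normD _ _))// lerD.
Qed.

Lemma entries_leZ c M m : entries_le M m -> entries_le (c *: M) (`|c| * m).
Proof. by move=> hM i j; rewrite mxE normrM ler_wpM2l. Qed.

Lemma entries_le_tr M m : entries_le M m -> entries_le M^T m.
Proof. by move=> hM i j; rewrite mxE. Qed.

Lemma entries_leW M m n : m <= n -> entries_le M m -> entries_le M n.
Proof. by move=> mn hM i j; exact: le_trans (hM i j) mn. Qed.

Lemma entries_le_ex M : exists2 m, 0 <= m & entries_le M m.
Proof.
exists (\sum_i \sum_j `|M i j|).
  by rewrite sumr_ge0// => i _; rewrite sumr_ge0.
move=> i j; rewrite (bigD1 i)//= (bigD1 j)//= -addrA lerDl addr_ge0//.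
  by rewrite sumr_ge0.
by rewrite sumr_ge0// => k _; rewrite sumr_ge0.
Qed.

(** The Sylvester operator is the derivative at [a = 1] of conjugation by [a^H]. [K] depends on [H]
    alone and the remainder is linear in the size of [W]: the expansion is used for a fixed limit
    matrix and also for [G x], which may grow with [x]. *)
Lemma conj_mxpowR_expansion (H : 'M[R]_p) : exists2 K, 0 <= K &
  forall (a m : R) W, `|ln a| <= 1 -> 0 <= m -> entries_le W m ->
  let A := mxpowR a H in
  entries_le (A *m W *m A^T - W - ln a *: (H *m W + W *m H^T)) (ln a ^+ 2 * K * m).
Proof.
have [h h0 hH] := entries_le_ex H.
pose B : R := 1 + \sum_(i < p) \sum_(j < p) `|H i j|.
pose C := B ^+ 2 * expR B.
have C0 : 0 <= C by rewrite mulr_ge0 ?sqr_ge0// expR_ge0.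
pose P : R := p%:R; have P0 : 0 <= P by [].
have K0 : 0 <= P ^+ 2 * (h ^+ 2 + C * expR B + (1 + h) * C).
  have eB := expR_ge0 B; rewrite mulr_ge0 ?sqr_ge0//.
  by rewrite !addr_ge0 ?sqr_ge0// mulr_ge0// addr_ge0.
exists (P ^+ 2 * (h ^+ 2 + C * expR B + (1 + h) * C)) => // a m W.
set s := ln a => s1 m0 hW A.
pose E := A - (1%:M + s *: H).
have hE : entries_le E (s ^+ 2 * C).
  by move=> i j; have := mxpowR_expansion H i j s1; rewrite /E !mxE.
have hA : entries_le A (expR B).
  by move=> i j; have := mxpowR_bounded H i j s1; rewrite mul1r.
have hB : entries_le (1%:M + s *: H) (1 + h).
  apply: entries_leD; first by move=> i j; rewrite mxE; case: eqP; rewrite ?normr1 ?normr0.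
  apply: entries_leW (entries_leZ s hH); by rewrite ler_piMl.
(* Substituting [A = 1 + s H + E] leaves the quadratic term and two terms containing [E], each of
   order [s^2]. *)
have -> : A *m W *m A^T - W - s *: (H *m W + W *m H^T) =
   s ^+ 2 *: (H *m W *m H^T) + E *m W *m A^T + (1%:M + s *: H) *m W *m E^T.
  pose X := s *: H.
  have -> : s *: (H *m W + W *m H^T) = X *m W + W *m X^T.
    by rewrite /X linearZ/= -scalemxAl -scalemxAr scalerDr.
  have -> : s ^+ 2 *: (H *m W *m H^T) = X *m W *m X^T.
    by rewrite /X linearZ/= -!scalemxAl -scalemxAr scalerA -expr2.
  have AE : A = (1%:M + X) + E by rewrite /E addrC subrK.
  have ATE : A^T = (1%:M + X^T) + E^T by rewrite AE !raddfD/= trmx1.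
  rewrite -/X ATE AE !mulmxDl !mulmxDr !mul1mx !mulmx1.
  have AC (w xw ew wx xwx ewx we xwe ewe : 'M[R]_p) :
    w + wx + we + (xw + xwx + xwe) + (ew + ewx + ewe) - w - (xw + wx) =
    xwx + (ew + ewx + ewe) + (we + xwe).
    by apply/matrixP => i j; rewrite !mxE; ring.
  exact: AC.
have s20 : 0 <= s ^+ 2 by rewrite sqr_ge0.
have -> : s ^+ 2 * (P ^+ 2 * (h ^+ 2 + C * expR B + (1 + h) * C)) * m =
  `|s ^+ 2| * (P * (P * h * m) * h) + P * (P * (s ^+ 2 * C) * m) * expR B
   + P * (P * (1 + h) * m) * (s ^+ 2 * C).
  by rewrite ger0_norm//; ring.
have sC0 : 0 <= s ^+ 2 * C by rewrite mulr_ge0.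
have h10 : 0 <= 1 + h by rewrite addr_ge0.
apply: entries_leD; [apply: entries_leD|].
- apply: entries_leZ; apply: entries_le_mul (entries_le_tr hH).
    by rewrite mulr_ge0// mulr_ge0.
  exact: entries_le_mul.
- apply: entries_le_mul (entries_le_tr hA); first by rewrite mulr_ge0// mulr_ge0.
  exact: entries_le_mul.
- apply: entries_le_mul (entries_le_tr hE); first by rewrite mulr_ge0// mulr_ge0.
  exact: entries_le_mul.
Qed.

End EntryBounds.

(** * Growth of a self-similar matrix covariance *)

Section SelfSimilarCovariance.
Context {R : realType} {p : nat}.
Variables (H : 'M[R]_p) (G : R -> 'M[R]_p).
Hypothesis H_spec : hurst_spectrum H.
Hypothesis G_ss : forall a x, 0 < a -> G (a * x) = mxpowR a H *m G x *m (mxpowR a H)^T.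
Hypothesis G_even : forall x, G (- x) = G x.
(* [G x i i + G x j j + 2 * G x i j] is the variance of the increment of
   Y_i + Y_j over a lag x, hence nonnegative with subadditive square root. *)
Hypothesis G_ge0 : forall i j x, 0 <= G x i i + G x j j + 2 * G x i j.
Hypothesis G_subadd : forall i j x y,
  Num.sqrt (G (x + y) i i + G (x + y) j j + 2 * G (x + y) i j) <=
  Num.sqrt (G x i i + G x j j + 2 * G x i j) +
  Num.sqrt (G y i i + G y j j + 2 * G y i j).

Let f i j x := Num.sqrt (G x i i + G x j j + 2 * G x i j).

(** [f i i x ^+ 2] equals [4 * G x i i], whence the quarters. *)
Let G_polar i j x : G x i j = (f i j x ^+ 2 - f i i x ^+ 2 / 4 - f j j x ^+ 2 / 4) / 2.
Proof. by rewrite /f !sqr_sqrtr//; field. Qed.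

Let f_ge0 i j x : 0 <= f i j x. Proof. exact: sqrtr_ge0. Qed.

Lemma selfsimilar_entries_bounded1 L : exists M, forall x, 1 <= x <= L -> entries_le (G x) M.
Proof.
have [g g0 hg] := entries_le_ex (G 1).
pose B : R := expR (ln L * (1 + \sum_(i < p) \sum_(j < p) `|H i j|)).
exists (p%:R * (p%:R * B * g) * B) => x /andP[x1 xL].
have x0 : 0 < x by rewrite (lt_le_trans _ x1).
have B0 : 0 <= B by exact: expR_ge0.
have hA : entries_le (mxpowR x H) B.
  move=> i j; apply: mxpowR_bounded.
  by rewrite ger0_norm ?ln_ge0// ler_ln// posrE// (lt_le_trans x0).
rewrite -[x]mulr1 G_ss//; apply: entries_le_mul (entries_le_tr hA).
  by rewrite mulr_ge0// mulr_ge0.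
exact: entries_le_mul.
Qed.

(** Self-similarity from [G 1] gives no bound near 0, since the estimate of [a^H] blows up with
    [|ln a|]. Writing [x = (x + 1) + (-1)] moves the interval to [[1, L + 1]], at the cost of one
    extra term [f i j 1]. *)
Let f_bounded i j L : exists M, forall x, 0 <= x <= L -> f i j x <= M.
Proof.
have [M hM] := selfsimilar_entries_bounded1 (L + 1).
exists (Num.sqrt (M + M + 2 * M) + f i j 1) => x /andP[x0 xL].
have E : x = (x + 1) + (- 1) by rewrite addrK.
rewrite {1}E (le_trans (G_subadd _ _ _ _))// G_even lerD2r.
have hx := hM (x + 1); rewrite lerD2r xL lerDr x0 in hx.
have {}hx := hx isT.
have h1 := le_trans (ler_norm _) (hx i i).
have h2 := le_trans (ler_norm _) (hx j j).
have h3 := le_trans (ler_norm _) (hx i j).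
rewrite ler_wsqrtr//; lra.
Qed.

Lemma selfsimilar_entries_bounded L : exists M, forall x, `|x| <= L -> entries_le (G x) M.
Proof.
have bij (i j : 'I_p) : exists M, forall x, `|x| <= L -> `|G x i j| <= M.
  have [M1 h1] := f_bounded i j L; have [M2 h2] := f_bounded i i L.
  have [M3 h3] := f_bounded j j L.
  exists (M1 ^+ 2 + M2 ^+ 2 + M3 ^+ 2) => x xL.
  have fE k l : f k l x = f k l `|x| by case: (ler0P x) => //; rewrite /f G_even.
  have x0L : 0 <= `|x| <= L by rewrite normr_ge0.
  rewrite G_polar !fE.
  have sq (a b : R) : 0 <= a -> a <= b -> 0 <= a ^+ 2 <= b ^+ 2.
    by move=> a0 ab; rewrite sqr_ge0 lerXn2r// nnegrE (le_trans a0).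
  have := sq _ _ (f_ge0 i j _) (h1 _ x0L); have := sq _ _ (f_ge0 i i _) (h2 _ x0L).
  have := sq _ _ (f_ge0 j j _) (h3 _ x0L).
  move=> /andP[? ?] /andP[? ?] /andP[? ?].
  by rewrite ler_norml; apply/andP; split; lra.
pose M i j := sval (cid (bij i j)).
have MP i j := svalP (cid (bij i j)).
exists (\sum_i \sum_j `|M i j|) => x xL i j.
rewrite (le_trans (MP i j x xL))// (le_trans (ler_norm _))//.
rewrite (bigD1 i)//= (bigD1 j)//= -addrA lerDl addr_ge0//.
  by rewrite sumr_ge0.
by rewrite sumr_ge0// => k _; rewrite sumr_ge0.
Qed.

Lemma selfsimilar_limit : exists Q : 'M[R]_p,
  forall i j, G x i j / x ^+ 2 @[x --> +oo] --> Q i j.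
Proof.
have lij i j : exists l : R, f i j x / x @[x --> +oo] --> l.
  by apply: subadditive_cvg => // x y; exact: G_subadd.
pose l i j := sval (cid (lij i j)).
have lP i j : f i j x / x @[x --> +oo] --> l i j := svalP (cid (lij i j)).
exists (\matrix_(i, j) ((l i j ^+ 2 - l i i ^+ 2 / 4 - l j j ^+ 2 / 4) / 2)) => i j.
rewrite mxE.
have lP2 k m : (f k m x / x) ^+ 2 @[x --> +oo] --> l k m ^+ 2.
  by rewrite expr2; under eq_fun do rewrite expr2; apply: cvgM; exact: lP.
under eq_fun => x.
  rewrite G_polar (_ : _ / x ^+ 2 = ((f i j x / x) ^+ 2 - (f i i x / x) ^+ 2 / 4
    - (f j j x / x) ^+ 2 / 4) / 2); last by rewrite !exprMn exprVn; ring.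
  over.
apply: cvgM; last exact: cvg_cst.
apply: cvgB; last by apply: cvgM; [exact: lP2|exact: cvg_cst].
by apply: cvgB; [exact: lP2|apply: cvgM; [exact: lP2|exact: cvg_cst]].
Qed.

(** From [e^(-2s) >= 1 - 2s] the difference is at most [4 s^2 / (1 - 2s)], and [1 - 2s >= 1/2]. *)
Lemma expR_expansion (s : R) : `|s| <= 1 / 4 -> 0 <= expR (2 * s) - 1 - 2 * s <= 8 * s ^+ 2.
Proof.
rewrite ler_norml => /andP[s1 s2].
have h1 := expR_ge1Dx (2 * s); have := expR_ge1Dx (- (2 * s)).
rewrite expRN => h2; have e0 := expR_gt0 (2 * s).
have : (1 - 2 * s) * expR (2 * s) <= 1.
  by rewrite -ler_pdivlMr// div1r.
move=> h3; apply/andP; split; nra.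
Qed.

(* The limit Q of [G x / x ^+ 2] satisfies [a ^+ 2 *: Q = a^H Q (a^H)^T];
   differentiating at a = 1 gives [H *m Q + Q *m H^T = 2 *: Q], whence Q = 0
   because the eigenvalues of H have real part below 1. *)
Lemma selfsimilar_cvg0 i j : G x i j / x ^+ 2 @[x --> +oo] --> (0 : R).
Proof.
have [Q HQ] := selfsimilar_limit.
suff Q0 : Q = 0 by have := HQ i j; rewrite Q0 mxE.
(* The limit of [G (a x) / x^2] is computed in two ways: by rescaling the variable, and by
   self-similarity. *)
have Qa a : 0 < a -> a ^+ 2 *: Q = mxpowR a H *m Q *m (mxpowR a H)^T.
  move=> a0; apply/matrixP => k l; rewrite mxE.
  have l1 : a ^+ 2 * (G (a * x) k l / (a * x) ^+ 2) @[x --> +oo] --> a ^+ 2 * Q k l.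
    apply: cvgM; first exact: cvg_cst.
    apply: (@cvg_comp _ _ _ (fun x => a * x) (fun y => G y k l / y ^+ 2) _ _ _ _ (HQ k l)).
    exact: gt0_cvgMry.
  have l2 : \sum_n (\sum_m mxpowR a H k m * (G x m n / x ^+ 2)) * (mxpowR a H)^T n l @[x --> +oo]
      --> \sum_n (\sum_m mxpowR a H k m * Q m n) * (mxpowR a H)^T n l.
    apply: (cvg_big add_continuous) => n _; apply: cvgM; last exact: cvg_cst.
    by apply: (cvg_big add_continuous) => m _; apply: cvgM; [exact: cvg_cst|exact: HQ].
  have -> : (mxpowR a H *m Q *m (mxpowR a H)^T) k l =
    \sum_n (\sum_m mxpowR a H k m * Q m n) * (mxpowR a H)^T n l.
    by rewrite mxE; apply: eq_bigr => n _; rewrite mxE.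
  have E : (fun x => a ^+ 2 * (G (a * x) k l / (a * x) ^+ 2)) =
    (fun x => \sum_n (\sum_m mxpowR a H k m * (G x m n / x ^+ 2)) * (mxpowR a H)^T n l).
    apply/funext => x.
    rewrite exprMn invfM mulrCA mulVKf ?expf_neq0 ?gt_eqF// G_ss// mxE mulr_suml.
    apply: eq_bigr => n _; rewrite [(_ *m G x) k n]mxE mulrAC; congr (_ * _).
    rewrite mulr_suml.
    by apply: eq_bigr => m _; rewrite mulrA.
  by rewrite -(cvg_lim _ l1)// E (cvg_lim _ l2).
apply: (@sylvester_eq0 _ _ H Q 2).
  by move=> h /H_spec /andP[_]; rewrite divff// pnatr_eq0.
have [K K0 HK] := conj_mxpowR_expansion H.
have [m m0 hm] := entries_le_ex Q.
apply/eqP; rewrite -subr_eq0; apply/eqP/matrixP => k l; rewrite [RHS]mxE.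
set D := _ - _; pose C := K * m + 8 * m.
have C0 : 0 <= C by rewrite addr_ge0// mulr_ge0.
have key s : 0 < s <= 1 / 4 -> `|D k l| <= s * C.
  move=> /andP[s0 s4]; have ns : `|s| <= 1 / 4 by rewrite gtr0_norm.
  have lnE : ln (expR s) = s by rewrite expRK.
  have := HK (expR s) m Q; rewrite lnE => /(_ (le_trans ns _) m0 hm).
  have -> : (1 / 4 : R) <= 1 by lra.
  move=> /(_ isT) /(_ k l); rewrite -Qa ?expR_gt0//.
  have -> : expR s ^+ 2 = expR (2 * s) by rewrite -expRM_natl.
  have /andP[e1 e2] := expR_expansion ns.
  (* For [a = e^s], [a^2 Q = e^(2s) Q] has two first-order expansions in [s]; their difference is
     [s D] up to [O(s^2)]. *)
  have DE : s * D k l = (expR (2 * s) - 1 - 2 * s) * Q k l -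
    (expR (2 * s) *: Q - Q - s *: (H *m Q + Q *m H^T)) k l.
    by rewrite /D; move: (H *m Q + _) => W; rewrite !mxE; ring.
  move=> h; have : `|s * D k l| <= 8 * s ^+ 2 * m + s ^+ 2 * K * m.
    rewrite DE (le_trans (ler_normB _ _))// lerD// normrM ler_pM//.
    by rewrite ger0_norm.
  rewrite normrM gtr0_norm// => h'; rewrite -(ler_pM2l s0) (le_trans h')// /C.
  by rewrite le_eqVlt; apply/orP; left; apply/eqP; ring.
apply/eqP; rewrite -normr_eq0 eq_le normr_ge0 andbT leNgt; apply/negP => d0.
(* Small enough that [s C] is below [|D k l|], against [key]; [C + 1] avoids a zero denominator. *)
pose s := Num.min (1 / 4) (`|D k l| / (2 * (C + 1))).
have C1 : 0 < 2 * (C + 1) by rewrite mulr_gt0// ltr_wpDl.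
have s0 : 0 < s by rewrite lt_min divr_gt0//= divr_gt0.
have s4 : s <= 1 / 4 by rewrite ge_min lexx.
have s1 : s * (2 * (C + 1)) <= `|D k l| by rewrite -ler_pdivlMr// ge_min lexx orbT.
have := key s; rewrite s0 s4 => /(_ isT); nra.
Qed.

(** [u / (1 + u) <= ln (1 + u) <= u], so the gap is at most [u^2 / (1 + u)], with [1 + u >= 1/2]. *)
Lemma ln_expansion (u : R) : `|u| <= 1 / 2 -> `|ln (1 + u) - u| <= 2 * u ^+ 2.
Proof.
rewrite ler_norml => /andP[u1 u2].
have p1 : 0 < 1 + u by lra.
have h1 : ln (1 + u) <= u.
  by have := expR_ge1Dx (ln (1 + u)); rewrite lnK ?posrE//; lra.
have h2 : (1 - ln (1 + u)) * (1 + u) <= 1.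
  have := expR_ge1Dx (- ln (1 + u)); rewrite expRN lnK ?posrE// => h.
  by rewrite -ler_pdivlMr// div1r.
rewrite ler_norml; apply/andP; split; nra.
Qed.

(* Write x + y = (1 + u) x with u = y / x: the second-order remainder of
   [(1 + u)^H G x ((1 + u)^H)^T] is O(u ^+ 2 |G x|), and |G x| = o(x ^+ 2). *)
Lemma selfsimilar_asymptotically_affine (L e : R) : 0 <= L -> 0 < e ->
  exists X, forall x, X <= x -> exists b : 'M[R]_p, forall y, `|y| <= L ->
    entries_le (G (x + y) - G x - y *: b) e.
Proof.
move=> L0 e0; have [K K0 HK] := conj_mxpowR_expansion H.
have [h h0 hH] := entries_le_ex H.
pose P : R := p%:R; have P0 : 0 <= P by [].
(* The first term pays for replacing [ln (1 + u)] by [u] in front of [H G + G H^T], with error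
   [2 u^2]; the second for the remainder [K (ln (1 + u))^2 <= 4 K u^2]. *)
pose C := 2 * (P * h + P * h) + 4 * K.
have C0 : 0 <= C by rewrite addr_ge0// mulr_ge0// addr_ge0// mulr_ge0.
pose e' := e / (C * L ^+ 2 + 1).
have CL : 0 < C * L ^+ 2 + 1 by rewrite ltr_wpDl// mulr_ge0// sqr_ge0.
have e'0 : 0 < e' by rewrite divr_gt0.
have nearG : \forall x \near +oo, forall i j, `|G x i j / x ^+ 2| <= e'.
  apply: filter_forall => i; apply: filter_forall => j.
  have /cvgrPdist_le /(_ _ e'0) := selfsimilar_cvg0 i j.
  by apply: filterS => x; rewrite sub0r normrN.
(* [2 L <= x] ensures [|u| <= 1/2] for every [y] in the window. *)
have : \forall x \near +oo, 2 * L + 1 <= x /\ forall i j, `|G x i j / x ^+ 2| <= e'.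
  near=> x; split; last by near: x.
  by near: x; apply: nbhs_pinfty_ge; rewrite num_real.
move=> [X [_ HX]]; exists (X + 1) => x Xx.
have Xltx : X < x by rewrite (lt_le_trans _ Xx)// ltrDl.
have [xL Gx] := HX x Xltx.
have x0 : 0 < x by rewrite (lt_le_trans _ xL)// ltr_wpDl// mulr_ge0.
(* The formal derivative of [G] at [x], read off from self-similarity. *)
exists (x^-1 *: (H *m G x + G x *m H^T)) => y yL.
pose u := y / x.
have u2 : `|u| <= 1 / 2.
  rewrite normrM normfV (gtr0_norm x0) ler_pdivrMr// (le_trans yL)//; lra.
have ux : x + y = (1 + u) * x by rewrite /u mulrDl mul1r divfK// gt_eqF.
have u0 : 0 < 1 + u by move: u2; rewrite ler_norml => /andP[]; lra.
have m0 : 0 <= e' * x ^+ 2 by rewrite mulr_ge0// ?sqr_ge0// ltW.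
have hG : entries_le (G x) (e' * x ^+ 2).
  move=> i j; have := Gx i j; rewrite normrM normfV (ger0_norm (sqr_ge0 x)).
  by rewrite ler_pdivrMr// exprn_gt0.
set s := ln (1 + u).
have su := ln_expansion u2.
have uu : u ^+ 2 = `|u| ^+ 2 by rewrite real_normK// num_real.
have s2 : `|s| <= 2 * `|u|.
  have -> : s = (s - u) + u by rewrite subrK.
  by rewrite (le_trans (ler_normD _ _))//; rewrite uu in su; have := normr_ge0 u; nra.
have s1 : `|s| <= 1 by lra.
have := HK (1 + u) (e' * x ^+ 2) (G x) s1 m0 hG.
cbv zeta; rewrite -/s -G_ss// -ux.
set W := H *m G x + G x *m H^T => hrem.
have hW : entries_le W ((P * h + P * h) * (e' * x ^+ 2)).
  rewrite mulrDl; apply: entries_leD; first exact: entries_le_mul.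
  apply: entries_leW (entries_le_mul m0 hG (entries_le_tr hH)).
  by rewrite le_eqVlt; apply/orP; left; apply/eqP; rewrite /P; ring.
have -> : G (x + y) - G x - y *: (x^-1 *: W) =
  (G (x + y) - G x - s *: W) + (s - u) *: W.
  by rewrite scalerA -/u scalerBl addrA subrK.
apply: entries_leW (entries_leD hrem (entries_leZ (s - u) hW)).
have s22 : s ^+ 2 <= 4 * u ^+ 2.
  rewrite uu -[s ^+ 2]real_normK ?num_real//.
  have -> : 4 * `|u| ^+ 2 = (2 * `|u|) ^+ 2 by ring.
  by rewrite lerXn2r// nnegrE mulr_ge0.
have ux2 : u ^+ 2 * x ^+ 2 <= L ^+ 2.
  rewrite -exprMn divfK ?gt_eqF// -[y ^+ 2]real_normK ?num_real//.
  by rewrite lerXn2r// nnegrE.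
apply: (@le_trans _ _ (C * (u ^+ 2 * x ^+ 2) * e')).
  have -> : C * (u ^+ 2 * x ^+ 2) * e' = 4 * u ^+ 2 * K * (e' * x ^+ 2) +
     2 * u ^+ 2 * ((P * h + P * h) * (e' * x ^+ 2)) by rewrite /C; ring.
  rewrite lerD//.
    by rewrite ler_wpM2r// ler_wpM2r.
  by rewrite ler_wpM2r// mulr_ge0// addr_ge0// mulr_ge0.
apply: (@le_trans _ _ (C * L ^+ 2 * e')).
  by rewrite (ler_wpM2r (ltW e'0))// ler_wpM2l.
rewrite /e' mulrA ler_pdivrMr//; have := ltW e0; nra.
Unshelve. all: by end_near. Qed.

End SelfSimilarCovariance.

(** * Increments of operator fractional Brownian motion *)

Section EqualLaws.
Context {R : realType}.
Context d1 (T1 : measurableType d1) (P1 : probability T1 R).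
Context d2 (T2 : measurableType d2) (P2 : probability T2 R).
Variables (X1 : T1 -> R) (X2 : T2 -> R).
Hypotheses (mX1 : measurable_fun setT X1) (mX2 : measurable_fun setT X2).
Hypothesis law : forall A : set R, measurable A -> P1 (X1 @^-1` A) = P2 (X2 @^-1` A).

Lemma ge0_integral_eq_law (f : R -> \bar R) : measurable_fun setT f ->
  (forall x, 0 <= f x)%E -> (\int[P1]_w f (X1 w) = \int[P2]_w f (X2 w))%E.
Proof.
move=> mf f0.
rewrite -[LHS](@ge0_integral_pushforward _ _ T1 (measurableTypeR R) _ X1 mX1 P1 setT f)//.
rewrite -[RHS](@ge0_integral_pushforward _ _ T2 (measurableTypeR R) _ X2 mX2 P2 setT f)//.
apply: eq_measure_integral => A mA _; exact: law.
Qed.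

Lemma Rintegral_eq_law (f : R -> R) : measurable_fun setT f ->
  \int[P1]_w f (X1 w) = \int[P2]_w f (X2 w).
Proof.
move=> mf; have mfE : measurable_fun setT (EFin \o f) by exact/measurable_EFinP.
rewrite /Rintegral integralE [in RHS]integralE; congr (fine (_ - _)).
- transitivity (\int[P1]_w (EFin \o f)^\+ (X1 w))%E.
    by apply: eq_integral => w _; rewrite !funeposE.
  rewrite (ge0_integral_eq_law (measurable_funepos mfE))//.
  by apply: eq_integral => w _; rewrite !funeposE.
- transitivity (\int[P1]_w (EFin \o f)^\- (X1 w))%E.
    by apply: eq_integral => w _; rewrite !funenegE.
  rewrite (ge0_integral_eq_law (measurable_funeneg mfE))//.
  by apply: eq_integral => w _; rewrite !funenegE.
Qed.

End EqualLaws.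

Section FiniteDimensionalLaws.
Context {R : realType}.
Context d1 (T1 : measurableType d1) (P1 : probability T1 R).
Context d2 (T2 : measurableType d2) (P2 : probability T2 R).
Context (p : nat) (Y1 : T1 -> R -> 'cV[R]_p) (Y2 : T2 -> R -> 'cV[R]_p).
Hypothesis fdd : same_fdd P1 P2 Y1 Y2.

(** The sets with Borel preimage form a sigma-algebra containing the open intervals. This lets
    [same_fdd], a statement on Borel sets of matrices, act on the law of a continuous functional. *)
Lemma borel_preimage_continuous (V : topologicalType) (f : V -> R) (A : set R) :
  continuous f -> measurable A -> borel (f @^-1` A).
Proof.
move=> cf mA; rewrite /borel => M [sM oM].
pose S := [set B : set R | M (f @^-1` B)].
have sS : sigma_algebra setT S.
  have [M0 MC MU] := sM; split.
  - by rewrite /S/= preimage_set0.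
  - by move=> B; rewrite /S/= => /MC; rewrite !setTD preimage_setC.
  - by move=> B hB; rewrite /S/= preimage_bigcup; exact: MU.
have sG : RGenOpens.G (R := R) `<=` S.
  move=> _ [x [y ->]]; apply: oM => /=.
  by move/continuousP : cf; apply; exact: interval_open.
have : (RGenOpens.G (R := R)).-sigma.-measurable A by rewrite -RGenOpens.measurableE.
by move=> mAG; exact: (mAG S (conj sS sG)).
Qed.

Lemma same_fdd_preimage n (t : 'I_n -> R) (phi : 'M[R]_(p, n) -> R) (A : set R) :
  continuous phi -> measurable A ->
  P1 ((fun w => phi (\matrix_(i, k) Y1 w (t k) i ord0)) @^-1` A) =
  P2 ((fun w => phi (\matrix_(i, k) Y2 w (t k) i ord0)) @^-1` A).
Proof.
by move=> cphi mA; exact: (@fdd n t (phi @^-1` A) (borel_preimage_continuous cphi mA)).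
Qed.

End FiniteDimensionalLaws.

(** * Gaussian processes and the covariance of their increments *)

Section Processes.
Context {R : realType} {p : nat}.
Context d (T : measurableType d) (P : probability T R).
Variable (Y : T -> R -> 'cV[R]_p).

Notation coord i t := (fun w => Y w t i ord0).

Lemma gaussian_process_L4 t i : gaussian_process P Y -> L4 P (coord i t).
Proof.
move=> /(_ 1%N (fun=> t) (fun=> \col_j (j == i)%:R)) /gaussian_rv_L4.
congr (L4 P _); apply/funext => w; rewrite big_ord1 (bigD1 i)//= !mxE eqxx mul1r.
by rewrite big1 ?addr0// => j /negbTE ji; rewrite mxE ji mul0r.
Qed.

(** The combinations required by polarization are covered by [gaussian_process], which allows
    repeated times. *)
Lemma wick_process t1 t2 t3 t4 i1 i2 i3 i4 :
  gaussian_process P Y -> zero_mean P Y ->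
  wick P (coord i1 t1) (coord i2 t2) (coord i3 t3) (coord i4 t4).
Proof.
move=> gY mY; have LY t i := gaussian_process_L4 t i gY.
apply: wick_polarization => //= e2 e3 e4.
apply: gaussian_rv_moment4.
  pose tt := [tuple t1; t2; t3; t4]; pose ii := [tuple i1; i2; i3; i4].
  pose ee := [tuple 1; e2; e3; e4].
  have := gY 4%N (tnth tt) (fun k => \col_j (tnth ee k * (j == tnth ii k)%:R)).
  congr (gaussian_rv P _); apply/funext => w.
  have red (k : 'I_4) : \sum_(i < p) (\col_j (tnth ee k * (j == tnth ii k)%:R)) i ord0
      * Y w (tnth tt k) i ord0 = tnth ee k * Y w (tnth tt k) (tnth ii k) ord0.
    rewrite (bigD1 (tnth ii k))//= !mxE eqxx mulr1 big1 ?addr0// => j /negbTE jk.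
    by rewrite mxE jk mulr0 mul0r.
  under eq_bigr do rewrite red.
  by rewrite !big_ord_recl big_ord0 /= !(tnth_nth 0) !(tnth_nth i1)/= mul1r addr0 !addrA.
have EY t i : \int[P]_w Y w t i ord0 = 0.
  by have := mY t i; rewrite unlock /Rintegral => ->.
have iY t i := L4_integrable (LY t i).
have iZ e t i := L4_integrable (L4Z e (LY t i)).
have L12 := L4D (LY t1 i1) (L4Z e2 (LY t2 i2)).
have L123 := L4D L12 (L4Z e3 (LY t3 i3)).
rewrite (RintegralD measurableT (L4_integrable L123) (iZ e4 t4 i4)).
rewrite (RintegralD measurableT (L4_integrable L12) (iZ e3 t3 i3)).
rewrite (RintegralD measurableT (iY t1 i1) (iZ e2 t2 i2)).
by rewrite !RintegralZl// !EY !mulr0 !addr0.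
Qed.

Lemma minkowski2 (a b : T -> R) : L4 P a -> L4 P b ->
  Num.sqrt (\int[P]_w (a w + b w) ^+ 2) <=
  Num.sqrt (\int[P]_w a w ^+ 2) + Num.sqrt (\int[P]_w b w ^+ 2).
Proof.
move=> La Lb.
set A := \int[P]_w a w ^+ 2; set B := \int[P]_w b w ^+ 2.
pose C := \int[P]_w (a w * b w).
have E (s t : R) : \int[P]_w (s * a w + t * b w) ^+ 2 = s ^+ 2 * A + 2 * s * t * C + t ^+ 2 * B.
  under eq_Rintegral do rewrite expr2.
  rewrite Rintegral_mulDl//; [|exact: L4Z|exact: L4Z|exact: L4D (L4Z _ La) (L4Z _ Lb)].
  rewrite !Rintegral_mulZl//; [|exact: L4D (L4Z _ La) (L4Z _ Lb)..].
  rewrite !(Rintegral_mulC _ _ (fun w => s * a w + t * b w)).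
  rewrite !Rintegral_mulDl//; [|exact: L4Z..].
  rewrite !Rintegral_mulZl// (Rintegral_mulC _ b a).
  by rewrite /A /B /C; under [\int[P]_w (_ ^+ 2)]eq_Rintegral do rewrite expr2;
    under [X in _ = _ + _ * X]eq_Rintegral do rewrite expr2; ring.
have A0 : 0 <= A by apply: Rintegral_ge0 => w _; exact: sqr_ge0.
have B0 : 0 <= B by apply: Rintegral_ge0 => w _; exact: sqr_ge0.
have Q (s t : R) : 0 <= s ^+ 2 * A + 2 * s * t * C + t ^+ 2 * B.
  by rewrite -E; apply: Rintegral_ge0 => w _; exact: sqr_ge0.
(* Cauchy-Schwarz: the quadratic form at [(-C, A)] equals [A (A B - C^2)]. If [A = 0], its value
   [- (B + 2) C^2] at [(-(B + 1), C)] forces [C = 0]. *)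
have CAB : C ^+ 2 <= A * B.
  have [A1|A1] := ltP 0 A.
    rewrite -subr_ge0 -(pmulr_rge0 _ A1); have := Q (- C) A.
    by congr (0 <= _); ring.
  have A2 : A = 0 by apply/eqP; rewrite eq_le A1.
  by have := Q (- (B + 1)) C; rewrite A2 mul0r => h; have := sqr_ge0 C; nra.
have hC : C <= Num.sqrt A * Num.sqrt B.
  by rewrite -sqrtrM// (le_trans (ler_norm _))// -sqrtr_sqr ler_wsqrtr.
have -> : \int[P]_w (a w + b w) ^+ 2 = A + 2 * C + B.
  by have := E 1 1; rewrite !expr1n !mul1r !mulr1 => <-; apply: eq_Rintegral => w _; rewrite !mul1r.
rewrite -[leRHS]ger0_norm ?addr_ge0 ?sqrtr_ge0// -sqrtr_sqr ler_wsqrtr//.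
by rewrite sqrrD !sqr_sqrtr// addrAC [leRHS]addrAC lerD2l mulr_natl lerMn2r hC orbT.
Qed.

(** Subtracting [Y 0] avoids a separate proof that it vanishes almost surely. *)
Definition increment_cov (x : R) : 'M[R]_p :=
  \matrix_(i, j) \int[P]_w
    ((Y w x i ord0 - Y w 0 i ord0) * (Y w x j ord0 - Y w 0 j ord0)).

Lemma measurable_coord t i : measurable_process Y -> measurable_fun setT (coord i t).
Proof.
by move=> mY; exact: (@joint_measurable_slice _ _ _ (fun w t => Y w t i ord0) t (mY i)).
Qed.

Lemma Rintegral_same_fdd d' (T' : measurableType d') (P' : probability T' R)
    (Y1 : T -> R -> 'cV[R]_p) (Y2 : T' -> R -> 'cV[R]_p) n (t : 'I_n -> R)
    (phi : 'M[R]_(p, n) -> R) :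
  same_fdd P P' Y1 Y2 -> continuous phi ->
  measurable_fun setT (fun w => phi (\matrix_(i, k) Y1 w (t k) i ord0)) ->
  measurable_fun setT (fun w => phi (\matrix_(i, k) Y2 w (t k) i ord0)) ->
  \int[P]_w phi (\matrix_(i, k) Y1 w (t k) i ord0) =
  \int[P']_w phi (\matrix_(i, k) Y2 w (t k) i ord0).
Proof.
move=> fdd cphi m1 m2.
by have := Rintegral_eq_law m1 m2 (fun A mA => same_fdd_preimage fdd t cphi mA)
  (f := id) (@measurable_id _ _ _).
Qed.

Lemma increment_cov_stationary i j s t : measurable_process Y ->
  stationary_increments P Y ->
  \int[P]_w ((Y w t i ord0 - Y w s i ord0) * (Y w t j ord0 - Y w s j ord0)) =
  increment_cov (t - s) i j.
Proof.
move=> mY sY; have mc := fun t i => measurable_coord t i mY.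
pose phi (M : 'M[R]_(p, 1)) := M i ord0 * M j ord0.
have cphi : continuous phi.
  have cc k := @coord_continuous R p 1 k ord0.
  by move=> M; exact: (cvgM (cc i M) (cc j M)).
have := Rintegral_same_fdd (t := fun=> t - s) (sY s) cphi.
rewrite /phi !mxE => H.
transitivity (\int[P]_w ((Y w (t - s + s) - Y w s) i ord0 * (Y w (t - s + s) - Y w s) j ord0)).
  by apply: eq_Rintegral => w _; rewrite !mxE subrK.
have E1 : (fun w => (\matrix_(i, k) (Y w (t - s + s) - Y w s) i ord0 : 'M[R]_(p, 1)) i ord0
   * (\matrix_(i, k) (Y w (t - s + s) - Y w s) i ord0 : 'M[R]_(p, 1)) j ord0) =
  (fun w => (Y w (t - s + s) - Y w s) i ord0 * (Y w (t - s + s) - Y w s) j ord0).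
  by apply/funext => w; rewrite !mxE.
have E2 : (fun w => (\matrix_(i, k) (Y w (t - s) - Y w 0) i ord0 : 'M[R]_(p, 1)) i ord0
   * (\matrix_(i, k) (Y w (t - s) - Y w 0) i ord0 : 'M[R]_(p, 1)) j ord0) =
  (fun w => (Y w (t - s) i ord0 - Y w 0 i ord0) * (Y w (t - s) j ord0 - Y w 0 j ord0)).
  by apply/funext => w; rewrite !mxE.
move: H; rewrite E1 E2; apply.
  by apply: measurable_funM; under eq_fun do rewrite !mxE; apply: measurable_funB.
by apply: measurable_funM; apply: measurable_funB.
Qed.

Lemma Rintegral_bigsum (I : Type) (r : seq I) (F : I -> T -> R) :
  (forall i, P.-integrable setT (EFin \o F i)) ->
  \int[P]_w (\sum_(i <- r) F i w) = \sum_(i <- r) \int[P]_w F i w.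
Proof.
move=> iF; elim: r => [|i r IH].
  by under eq_Rintegral do rewrite big_nil; rewrite Rintegral_probability_cst big_nil.
under eq_Rintegral do rewrite big_cons.
rewrite RintegralD// ?IH ?big_cons//.
have := @integrable_sum _ _ _ P setT measurableT _ r xpredT (fun i => EFin \o F i) (fun i _ => iF i).
by apply: eq_integrable => // w _; rewrite /= sumEFin.
Qed.

Lemma increment_cov_self_similar (H : 'M[R]_p) a x : 0 < a ->
  measurable_process Y -> gaussian_process P Y -> operator_self_similar P H Y ->
  increment_cov (a * x) = mxpowR a H *m increment_cov x *m (mxpowR a H)^T.
Proof.
move=> a0 mY gY sY; have mc := fun t i => measurable_coord t i mY.
have LY t i := gaussian_process_L4 t i gY.
have LZ t i : L4 P (fun w => Y w t i ord0 - Y w 0 i ord0).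
  have := L4D (LY t i) (L4Z (-1) (LY 0 i)).
  by congr (L4 P _); apply/funext => w; rewrite mulN1r.
set A := mxpowR a H; apply/matrixP => i j.
pose o1 : 'I_2 := lift ord0 ord0.
pose phi (M : 'M[R]_(p, 2)) := (M i ord0 - M i o1) * (M j ord0 - M j o1).
have cphi : continuous phi.
  have cc k l := @coord_continuous R p 2 k l.
  by move=> M; exact: (cvgM (cvgB (cc i ord0 M) (cc i o1 M)) (cvgB (cc j ord0 M) (cc j o1 M))).
pose t (k : 'I_2) := if k == ord0 then a * x else 0.
have E1 : (fun w => phi (\matrix_(i, k) Y w (t k) i ord0)) =
  (fun w => (Y w (a * x) i ord0 - Y w 0 i ord0) * (Y w (a * x) j ord0 - Y w 0 j ord0)).
  by apply/funext => w; rewrite /phi !mxE.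
pose Z k w := Y w x k ord0 - Y w 0 k ord0.
have E2 : (fun w => phi (\matrix_(i, k) (A *m Y w (t k / a)) i ord0)) =
  (fun w => \sum_k \sum_l A i k * A j l * (Z k w * Z l w)).
  apply/funext => w; rewrite /phi !mxE /t /= mul0r mulrAC divff ?gt_eqF// mul1r.
  rewrite -!sumrB mulr_suml; apply: eq_bigr => k _.
  rewrite mulr_sumr; apply: eq_bigr => l _; rewrite /Z; ring.
have iZ k l : P.-integrable setT (EFin \o (fun w => A i k * A j l * (Z k w * Z l w))).
  have := integrableZl measurableT (A i k * A j l) (L4_prod2 (LZ x k) (LZ x l)).
  exact: eq_integrable.
have iS k : P.-integrable setT (EFin \o (fun w => \sum_l A i k * A j l * (Z k w * Z l w))).
  have := @integrable_sum _ _ _ P setT measurableT _ (index_enum 'I_p) xpredT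
    (fun l => EFin \o (fun w => A i k * A j l * (Z k w * Z l w))) (fun l _ => iZ k l).
  by apply: eq_integrable => // w _; rewrite /= sumEFin.
have := Rintegral_same_fdd (t := t) (sY a a0) cphi; rewrite E1 E2 !mxE => ->.
- rewrite Rintegral_bigsum//.
  under eq_bigr => k _.
    rewrite Rintegral_bigsum//.
    under eq_bigr => l _.
      rewrite RintegralZl//; last exact: (L4_prod2 (LZ x k) (LZ x l)).
      over.
    over.
  rewrite exchange_big /=; apply: eq_bigr => l _.
  rewrite !mxE mulr_suml; apply: eq_bigr => k _; rewrite !mxE /Z; ring.
- by apply: measurable_funM; apply: measurable_funB.
- have := iS; have /measurable_EFinP : measurable_fun setT (EFin \o (fun w => \sum_k \sum_l A i k * A j l * (Z k w * Z l w))).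
    have := @integrable_sum _ _ _ P setT measurableT _ (index_enum 'I_p) xpredT
      (fun k => EFin \o (fun w => \sum_l A i k * A j l * (Z k w * Z l w))) (fun k _ => iS k).
    move/measurable_int; apply: eq_measurable_fun => w _; by rewrite /= sumEFin.
  by [].
Qed.

Lemma increment_cov_even x : measurable_process Y -> stationary_increments P Y ->
  increment_cov (- x) = increment_cov x.
Proof.
move=> mY sY; apply/matrixP => i j.
have := increment_cov_stationary i j x 0 mY sY; rewrite sub0r => <-.
by rewrite mxE; apply: eq_Rintegral => w _; ring.
Qed.

Section Gaussian.
Hypotheses (mY : measurable_process Y) (gY : gaussian_process P Y)
  (sY : stationary_increments P Y).

Let LZ s t i : L4 P (fun w => Y w t i ord0 - Y w s i ord0).
Proof.
have := L4D (gaussian_process_L4 t i gY) (L4Z (-1) (gaussian_process_L4 s i gY)).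
by congr (L4 P _); apply/funext => w; rewrite mulN1r.
Qed.

Lemma increment_cov_sumE i j s t :
  let G := increment_cov (t - s) in
  G i i + G j j + 2 * G i j =
  \int[P]_w ((Y w t i ord0 - Y w s i ord0) + (Y w t j ord0 - Y w s j ord0)) ^+ 2.
Proof.
rewrite /= -!(increment_cov_stationary _ _ s t mY sY).
pose Z k w := Y w t k ord0 - Y w s k ord0.
have hi : L4 P (Z i) := LZ s t i; have hj : L4 P (Z j) := LZ s t j.
have hij := L4D hi hj.
transitivity (\int[P]_w ((Z i w + Z j w) * (Z i w + Z j w))); last first.
  by apply: eq_Rintegral => w _; rewrite expr2.
rewrite (Rintegral_mulDl hi hj hij) (Rintegral_mulC P (Z i) (fun w => Z i w + Z j w)).
rewrite (Rintegral_mulC P (Z j) (fun w => Z i w + Z j w)).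
rewrite (Rintegral_mulDl hi hj hi) (Rintegral_mulDl hi hj hj).
by rewrite (Rintegral_mulC P (Z j) (Z i)) /Z; ring.
Qed.

Lemma increment_cov_ge0 i j x :
  let G := increment_cov x in 0 <= G i i + G j j + 2 * G i j.
Proof.
rewrite /= -[x]subr0 increment_cov_sumE.
by apply: Rintegral_ge0 => w _; exact: sqr_ge0.
Qed.

(** Minkowski's inequality for the increments of [Y_i + Y_j] from 0 to [x] and from [x] to [x + y],
    the second having lag [y] by stationarity. *)
Lemma increment_cov_subadditive i j x y :
  let f x := let G := increment_cov x in Num.sqrt (G i i + G j j + 2 * G i j) in
  f (x + y) <= f x + f y.
Proof.
rewrite /=.
have := increment_cov_sumE i j 0 (x + y); rewrite subr0 => /= ->.
have := increment_cov_sumE i j 0 x; rewrite subr0 => /= ->.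
have := increment_cov_sumE i j x (x + y); rewrite addrAC subrr add0r => /= ->.
have := minkowski2 (L4D (LZ 0 x i) (LZ 0 x j)) (L4D (LZ x (x + y) i) (LZ x (x + y) j)).
apply: le_trans; rewrite le_eqVlt; apply/orP; left; apply/eqP; congr Num.sqrt.
by apply: eq_Rintegral => w _; ring.
Qed.

End Gaussian.

End Processes.

(** * Covariance of linear functionals of a process *)

Lemma measurable_expectation d (T : measurableType d) (R : realType)
    (P : probability T R) (h : T -> R -> R) :
  joint_measurable h -> measurable_fun setT (fun t => \int[P]_w h w t).
Proof.
move=> mh.
have mE : measurable_fun [set: T * measurableTypeR R] (fun z => (h z.1 z.2)%:E).
  exact/measurable_EFinP.
apply: (@measurableT_comp _ _ _ _ _ _ fine) => //.
under [X in measurable_fun _ X]eq_fun do rewrite integralE.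
apply: emeasurable_funB.
- have := @measurable_fun_fubini_tonelli_G _ _ T (measurableTypeR R) R P _
    (measurable_funepos mE) (fun z => funepos_ge0 _ z).
  by apply: eq_measurable_fun => w _; apply: eq_integral => t _; rewrite !funeposE.
- have := @measurable_fun_fubini_tonelli_G _ _ T (measurableTypeR R) R P _
    (measurable_funeneg mE) (fun z => funeneg_ge0 _ z).
  by apply: eq_measurable_fun => w _; apply: eq_integral => t _; rewrite !funenegE.
Qed.

Section IntegrableWeight.
Context {R : realType}.
Notation mu := (@lebesgue_measure R).
Variable f : R -> R.
Hypotheses (mf : measurable_fun setT f) (intf : mu.-integrable setT (EFin \o f)).

Lemma integrable_mul_bounded (g : R -> R) (M : R) : measurable_fun setT g ->
  (forall t, f t != 0 -> `|g t| <= M) -> mu.-integrable setT (fun t => (f t * g t)%:E).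
Proof.
move=> mg gM.
apply: (@le_integrable _ _ _ mu setT measurableT _
  (fun t => M%:E * (EFin \o (Num.norm \o f)) t)%E); last first.
- exact/integrableZl/integrable_norm.
- move=> t _; rewrite -EFinM !abse_EFin !lee_fin.
  have [->|ft0] := eqVneq (f t) 0; first by rewrite mul0r normr0 normr_ge0.
  by rewrite !normrM normr_id mulrC ler_wpM2r// (le_trans (gM _ ft0))// ler_norm.
exact/measurable_EFinP/measurable_funM.
Qed.

Lemma normr_Rintegral_mul_le (g : R -> R) (M : R) : 0 <= M -> measurable_fun setT g ->
  (forall t, f t != 0 -> `|g t| <= M) ->
  `|\int[mu]_t (f t * g t)| <= M * \int[mu]_t `|f t|.
Proof.
move=> M0 mg gM; have i := integrable_mul_bounded mg gM.
rewrite (le_trans (le_normr_Rintegral measurableT i))// -RintegralZl//; last first.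
  exact: integrable_norm intf.
apply: le_Rintegral => //; first exact: integrable_norm i.
  exact: integrableZl (integrable_norm intf).
move=> t _; have [->|ft0] := eqVneq (f t) 0; first by rewrite mul0r normr0 mulr0.
by rewrite normrM mulrC ler_wpM2r// gM.
Qed.

End IntegrableWeight.

Section Coefficients.
Context d (T : measurableType d) (R : realType) (P : probability T R) (p : nat).
Notation mu := (@lebesgue_measure R).
Variable (Y : T -> R -> 'cV[R]_p).
Hypothesis mY : measurable_process Y.
Hypothesis LY : forall t i, L4 P (fun w => Y w t i ord0).
Hypothesis bY : forall L, exists M, forall t i, `|t| <= L -> \int[P]_w (Y w t i ord0 ^+ 4) <= M.

(** Compact support is stated pointwise because the moments of [Y] are controlled only on bounded
    windows. *)
Definition weight (f : R -> R) (L : R) :=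
  [/\ measurable_fun setT f, mu.-integrable setT (EFin \o f) &
      forall t, f t != 0 -> `|t| <= L].

Definition coef (f : R -> R) (i : 'I_p) : T -> R := time_integral f (fun w t => Y w t i ord0).

Definition process_cov (i j : 'I_p) (s t : R) := \int[P]_w (Y w s i ord0 * Y w t j ord0).

Variables (f : R -> R) (L : R).
Hypothesis wf : weight f L.

Let mf : measurable_fun setT f. Proof. by case: wf. Qed.
Let intf : mu.-integrable setT (EFin \o f). Proof. by case: wf. Qed.
Let bdd i : exists M, forall t, f t != 0 -> \int[P]_w (Y w t i ord0 ^+ 4) <= M.
Proof.
have [M HM] := bY L; exists M => t ft0; apply: HM; by case: wf => _ _; apply.
Qed.

Lemma L4_coef i : L4 P (coef f i).
Proof.
have [M HM] := bdd i.
exact: (L4_time_integral mf intf (mY i) (fun t _ => LY t i) HM).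
Qed.

Lemma wick_coef i X1 X2 X3 : L4 P X1 -> L4 P X2 -> L4 P X3 ->
  (forall t, wick P X1 X2 X3 (fun w => Y w t i ord0)) -> wick P X1 X2 X3 (coef f i).
Proof.
move=> h1 h2 h3 W; have [M HM] := bdd i.
by apply: (wick_time_integral mf intf (mY i) (fun t _ => LY t i) HM).
Qed.

Lemma Rintegral_mul_coef i X : L4 P X ->
  \int[P]_w (X w * coef f i w) = \int[mu]_t (f t * \int[P]_w (X w * Y w t i ord0)).
Proof.
move=> hX; have [M HM] := bdd i; have c1 := L4_cst P 1.
have := Rintegral_mul_time_integral mf intf (mY i) (fun t _ => LY t i) HM c1 c1 hX.
under eq_Rintegral do rewrite !mul1r.
by move=> ->; apply: eq_Rintegral => t _; under eq_Rintegral do rewrite !mul1r.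
Qed.

Lemma integrable_mul_coef i X : L4 P X ->
  mu.-integrable setT (fun t => (f t * \int[P]_w (X w * Y w t i ord0))%:E).
Proof.
move=> hX; have [M HM] := bdd i; have c1 := L4_cst P 1.
have := integrable_mul_time mf intf (mY i) (fun t _ => LY t i) HM c1 c1 hX.
by apply: eq_integrable => // t _; under eq_Rintegral do rewrite !mul1r.
Qed.

End Coefficients.

Section CoefficientCovariance.
Context d (T : measurableType d) (R : realType) (P : probability T R) (p : nat).
Notation mu := (@lebesgue_measure R).
Variable (Y : T -> R -> 'cV[R]_p).
Hypothesis mY : measurable_process Y.
Hypothesis LY : forall t i, L4 P (fun w => Y w t i ord0).
Hypothesis bY : forall L, exists M, forall t i, `|t| <= L -> \int[P]_w (Y w t i ord0 ^+ 4) <= M.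

Lemma coef_cov f g L1 L2 i j : weight f L1 -> weight g L2 ->
  \int[P]_w (coef Y f i w * coef Y g j w) =
  \int[mu]_t (g t * \int[mu]_s (f s * process_cov P Y i j s t)).
Proof.
move=> wf wg; have LC := L4_coef mY LY bY wf i.
rewrite (Rintegral_mul_coef mY LY bY wg j LC); apply: eq_Rintegral => t _.
congr (_ * _); rewrite Rintegral_mulC (Rintegral_mul_coef mY LY bY wf i (LY t j)).
by apply: eq_Rintegral => s _; rewrite Rintegral_mulC.
Qed.

(** Four rotations replace each coefficient by a value of the process and restore the original
    order. *)
Lemma wick_coefs f1 f2 f3 f4 L1 L2 L3 L4' i1 i2 i3 i4 :
  weight f1 L1 -> weight f2 L2 -> weight f3 L3 -> weight f4 L4' ->
  gaussian_process P Y -> zero_mean P Y ->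
  wick P (coef Y f1 i1) (coef Y f2 i2) (coef Y f3 i3) (coef Y f4 i4).
Proof.
move=> w1 w2 w3 w4 gY zY.
have C1 := L4_coef mY LY bY w1 i1; have C2 := L4_coef mY LY bY w2 i2.
have C3 := L4_coef mY LY bY w3 i3; have C4 := L4_coef mY LY bY w4 i4.
apply: wick_rot; apply: (wick_coef mY LY bY w1) => // t1.
apply: wick_rot; apply: (wick_coef mY LY bY w2) => // t2.
apply: wick_rot; apply: (wick_coef mY LY bY w3) => // t3.
apply: wick_rot; apply: (wick_coef mY LY bY w4) => // t4.
exact: wick_process.
Qed.

Hypothesis sY : stationary_increments P Y.
Let G := increment_cov P Y.
Hypothesis bG : forall L, exists M, forall x, `|x| <= L -> entries_le (G x) M.

(** Expansion of the second moment of the increment from [s] to [t]; its two mixed terms are the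
    left-hand side. *)
Lemma process_cov_sym i j s t :
  process_cov P Y i j s t + process_cov P Y j i s t =
  process_cov P Y i j s s + process_cov P Y i j t t - G (t - s) i j.
Proof.
have := increment_cov_stationary i j s t mY sY; rewrite -/G => <-.
have LN k u : L4 P (fun w => - 1 * Y w u k ord0) by apply: L4Z.
have LD k := L4D (LY t k) (LN k s).
rewrite (_ : \int[P]_w _ =
  \int[P]_w ((Y w t i ord0 + - 1 * Y w s i ord0) * (Y w t j ord0 + - 1 * Y w s j ord0))); last first.
  by apply: eq_Rintegral => w _; rewrite !mulN1r.
rewrite (Rintegral_mulDl (LY t i) (LN i s) (LD j)) (Rintegral_mulZl _ (LY s i) (LD j)).
rewrite (Rintegral_mulC _ (fun w => Y w t i ord0)) (Rintegral_mulC _ (fun w => Y w s i ord0)).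
rewrite !(Rintegral_mulDl (LY t j) (LN j s) (LY _ i)) !(Rintegral_mulZl _ (LY s j) (LY _ i)).
rewrite !(Rintegral_mulC _ _ (fun w => Y w _ i ord0)) /process_cov.
by rewrite (Rintegral_mulC _ (fun w => Y w s j ord0) (fun w => Y w t i ord0)); ring.
Qed.

Let mcoord2 i j : joint_measurable (fun w t => Y w t i ord0 * Y w t j ord0).
Proof. exact: joint_measurableM (mY i) (mY j). Qed.

Lemma measurable_increment_cov i j : measurable_fun setT (fun x => G x i j).
Proof.
have mI k : joint_measurable (fun w x => Y w x k ord0 - Y w 0 k ord0).
  apply: measurable_funB; first exact: mY.
  exact: (joint_measurable_fst (measurable_coord 0 k mY)).
have := measurable_expectation P (joint_measurableM (mI i) (mI j)).
by apply: eq_measurable_fun => x _; rewrite /G mxE.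
Qed.

Lemma process_cov_bounded i j M1 L1 s :
  (forall t i, `|t| <= L1 -> \int[P]_w (Y w t i ord0 ^+ 4) <= M1) -> `|s| <= L1 ->
  `|process_cov P Y i j s s| <= M1 + M1 + 1 + 1.
Proof.
move=> HM sL; have c1 := L4_cst P 1; have hi := LY s i; have hj := LY s j.
have i2 := L4_prod2 hi hj.
rewrite (le_trans (le_normr_Rintegral measurableT i2))//.
apply: (@le_trans _ _ (\int[P]_w (Y w s i ord0 ^+ 4 + Y w s j ord0 ^+ 4 + 1 + 1))).
  apply: le_Rintegral => //; first exact: integrable_norm i2.
    exact: (integrableD measurableT (integrableD measurableT
      (integrableD measurableT hi.2 hj.2) (L4_integrable c1)) (L4_integrable c1)).
  move=> w _; have := normr_prod4_le (Y w s i ord0) (Y w s j ord0) 1 1.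
  by rewrite !mulr1 !expr1n.
rewrite RintegralD//; last 2 first.
- exact: (integrableD measurableT (integrableD measurableT hi.2 hj.2) (L4_integrable c1)).
- exact: (L4_integrable c1).
rewrite RintegralD//; last 2 first.
- exact: (integrableD measurableT hi.2 hj.2).
- exact: (L4_integrable c1).
rewrite RintegralD//; [|exact: hi.2|exact: hj.2].
by rewrite !Rintegral_probability_cst !lerD2r lerD// HM.
Qed.

(* The law of the increments determines only the part of the cross-covariance
   that is symmetric in (i, j). *)
Lemma coef_cov_sym f g L1 L2 i j : weight f L1 -> weight g L2 ->
  \int[mu]_t f t = 0 -> \int[mu]_t g t = 0 ->
  \int[P]_w (coef Y f i w * coef Y g j w) + \int[P]_w (coef Y f j w * coef Y g i w) =
  - \int[mu]_t (g t * \int[mu]_s (f s * G (t - s) i j)).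
Proof.
move=> wf wg f0 g0; rewrite !(coef_cov _ _ wf wg).
have [mf intf sf] := wf; have [mg intg sg] := wg.
have i2 k l t : mu.-integrable setT (fun s => (f s * process_cov P Y k l s t)%:E).
  have := integrable_mul_coef mY LY bY wf k (LY t l).
  by apply: eq_integrable => // s _; rewrite Rintegral_mulC.
have mdiag : measurable_fun setT (fun s => process_cov P Y i j s s).
  exact: measurable_expectation (mcoord2 i j).
have mGt t : measurable_fun setT (fun s : R => G (t - s) i j).
  apply: (measurableT_comp (measurable_increment_cov i j)).
  exact: measurable_funB.
have [M1 HM1] := bY L1.
have idiag := integrable_mul_bounded mf intf mdiag (fun s fs => process_cov_bounded i j HM1 (sf s fs)).
have iG t : mu.-integrable setT (fun s => (f s * G (t - s) i j)%:E).
  have [M2 HM2] := bG (`|t| + L1).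
  apply: (integrable_mul_bounded mf intf (mGt t) (M := M2)) => s fs; apply: HM2.
  by rewrite (le_trans (ler_normB _ _))// lerD2l sf.
have iout k l : mu.-integrable setT
    (fun t => (g t * \int[mu]_s (f s * process_cov P Y k l s t))%:E).
  have := integrable_mul_coef mY LY bY wg l (L4_coef mY LY bY wf k).
  apply: eq_integrable => // t _; congr (_ * _)%:E.
  rewrite Rintegral_mulC (Rintegral_mul_coef mY LY bY wf k (LY t l)).
  by apply: eq_Rintegral => s _; rewrite Rintegral_mulC.
pose A := \int[mu]_s (f s * process_cov P Y i j s s).
(* Of the three terms of [process_cov_sym], the one in [t] alone disappears because [f] has integral
   0. The one in [s] alone becomes the constant [A], which the integral of [g] cancels later. *)
have inner t : \int[mu]_s (f s * process_cov P Y i j s t) +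
    \int[mu]_s (f s * process_cov P Y j i s t) =
    A - \int[mu]_s (f s * G (t - s) i j).
  rewrite -RintegralD//; [|exact: i2..].
  transitivity (\int[mu]_s (f s * process_cov P Y i j s s +
      process_cov P Y i j t t * f s - f s * G (t - s) i j)).
    by apply: eq_Rintegral => s _; rewrite -mulrDr process_cov_sym; ring.
  have i3 := integrableZl measurableT (process_cov P Y i j t t) intf.
  have i4 := integrableD measurableT idiag i3.
  rewrite RintegralB//; last exact: iG.
  rewrite RintegralD// RintegralZl// f0 mulr0 addr0.
  by [].
rewrite -RintegralD//; [|exact: iout..].
have iS := integrableD measurableT (iout i j) (iout j i).
have iA := integrableZl measurableT A intg.
have E t : g t * \int[mu]_s (f s * process_cov P Y i j s t) +
    g t * \int[mu]_s (f s * process_cov P Y j i s t) =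
    A * g t - g t * \int[mu]_s (f s * G (t - s) i j).
  by rewrite -mulrDr inner; ring.
have igI : mu.-integrable setT (fun t => (g t * \int[mu]_s (f s * G (t - s) i j))%:E).
  have := integrableB measurableT iA iS.
  apply: eq_integrable => // t _.
  transitivity ((A * g t - (g t * \int[mu]_s (f s * process_cov P Y i j s t) +
    g t * \int[mu]_s (f s * process_cov P Y j i s t)))%:E); first by [].
  by rewrite E; congr EFin; ring.
under eq_Rintegral do rewrite E.
by rewrite RintegralB// RintegralZl// g0 mulr0 sub0r.
Qed.

End CoefficientCovariance.

(** * Double integrals at a large lag *)

Section LagCovariance.
Context {R : realType} {p : nat}.
Notation mu := (@lebesgue_measure R).
Variables (f : R -> R) (L : R) (G : R -> 'M[R]_p).
Hypothesis wf : weight f L.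
Hypothesis L0 : 0 <= L.
Hypothesis f0 : \int[mu]_t f t = 0.
Hypothesis mG : forall i j, measurable_fun setT (fun x => G x i j).
Hypothesis bG : forall L, exists M, forall x, `|x| <= L -> entries_le (G x) M.

Definition lag_integral i j (x : R) := \int[mu]_t (f t * \int[mu]_s (f s * G (t - s + x) i j)).

Let mf : measurable_fun setT f. Proof. by case: wf. Qed.
Let intf : mu.-integrable setT (EFin \o f). Proof. by case: wf. Qed.
Let sf t : f t != 0 -> `|t| <= L. Proof. by case: wf => _ _; apply. Qed.

Let mGt i j t x : measurable_fun setT (fun s : R => G (t - s + x) i j).
Proof.
apply: (measurableT_comp (mG i j)).
by apply: measurable_funD => //; exact: measurable_funB.
Qed.

Lemma weight_shift a : weight (fun t => f (t - a)) (L + `|a|).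
Proof.
have ms : measurable_fun setT (fun t : R => f (t - a)).
  by apply: (measurableT_comp mf); exact: measurable_funB.
split => //.
- have /integrableP[mfE foo] := intf; apply/integrableP; split; first exact/measurable_EFinP.
  have mg : measurable_fun setT (fun t => `|(f t)%:E|%E) by exact: measurableT_comp.
  have := ge0_integral_affine (- a) (@ltr01 R) mg (fun t => abse_ge0 _).
  rewrite invr1 mul1e => E; apply: le_lt_trans foo.
  by rewrite -[leRHS]E; under [leRHS]eq_integral do rewrite mul1r.
- move=> t /sf h; have -> : t = (t - a) + a by rewrite subrK.
  by rewrite (le_trans (ler_normD _ _))// lerD2r.
Qed.

Lemma Rintegral_weight_shift a : \int[mu]_t f (t - a) = 0.
Proof. by rewrite Rintegral_shift. Qed.

Let mJ i j x : measurable_fun setT (fun t : R => \int[mu]_s (f s * G (t - s + x) i j)).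
Proof.
have mh : @joint_measurable _ (measurableTypeR R) R (fun t s => G (t - s + x) i j).
  apply: (measurableT_comp (mG i j)); apply: measurable_funD => //.
  apply: measurable_funB; [exact: measurable_fst|exact: measurable_snd].
exact: (measurable_time_integral mf mh).
Qed.

Lemma lag_integral_shift i j a b :
  \int[mu]_t (f (t - b) * \int[mu]_s (f (s - a) * G (t - s) i j)) = lag_integral i j (b - a).
Proof.
have inner t : \int[mu]_s (f (s - a) * G (t - s) i j) = \int[mu]_s (f s * G (t - s + - a) i j).
  rewrite -(@Rintegral_shift _ (- a) (fun s => f s * G (t - s + - a) i j)).
    by apply: eq_Rintegral => s _; congr (_ * G _ i j); ring.
  by apply: measurable_funM.
under eq_Rintegral do rewrite inner.
rewrite -(@Rintegral_shift _ b).
  apply: eq_Rintegral => t _; rewrite addrK; congr (_ * _); apply: eq_Rintegral => s _.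
  by congr (_ * G _ i j); ring.
apply: measurable_funM; last exact: mJ.
by apply: (measurableT_comp mf); exact: measurable_funB.
Qed.

(* Since f integrates to 0, only the part of [G (t - s + x)] that is neither a
   function of t alone nor of s alone contributes; an affine function has no
   such part. *)
Lemma lag_integral_cvg0 i j :
  (forall L e, 0 <= L -> 0 < e -> exists X, forall x, X <= x ->
     exists b : 'M[R]_p, forall y, `|y| <= L -> entries_le (G (x + y) - G x - y *: b) e) ->
  forall e, 0 < e -> exists X, forall x, X <= x -> `|lag_integral i j x| <= e.
Proof.
move=> asym e e0.
pose A := \int[mu]_t `|f t|.
have A0 : 0 <= A by apply: Rintegral_ge0.
pose e' := e / (A ^+ 2 + 1).
have A1 : 0 < A ^+ 2 + 1 by rewrite ltr_wpDl// sqr_ge0.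
have e'0 : 0 < e' by rewrite divr_gt0.
have [X HX] := asym (L + L) e' (addr_ge0 L0 L0) e'0.
exists X => x /HX[b hb].
have isf : mu.-integrable setT (fun s => (f s * s)%:E).
  by apply: (integrable_mul_bounded mf intf (M := L)) => // s /sf.
(* The inner integral of the affine approximation [G x + (t - s) b]. It does not depend on [t], so
   the outer integral of [f] removes it. *)
pose c := - (b i j * \int[mu]_s (f s * s)).
have iG t : mu.-integrable setT (fun s => (f s * G (t - s + x) i j)%:E).
  have [M2 HM2] := bG (`|t| + L + `|x|).
  apply: (integrable_mul_bounded mf intf (mGt i j t x) (M := M2)) => s fs; apply: HM2.
  rewrite (le_trans (ler_normD _ _))// lerD2r (le_trans (ler_normB _ _))// lerD2l.
  exact: sf.
have inner t : \int[mu]_s (f s * G (t - s + x) i j) - c =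
   \int[mu]_s (f s * (G (t - s + x) i j - G x i j - (t - s) * b i j)).
  have i1 := integrableZl measurableT (- G x i j - t * b i j) intf.
  have i2 := integrableZl measurableT (b i j) isf.
  have i3 := integrableD measurableT i1 i2.
  have -> : - c = \int[mu]_s ((- G x i j - t * b i j) * f s + b i j * (f s * s)).
    by rewrite RintegralD// !RintegralZl// f0 mulr0 add0r /c opprK.
  rewrite -RintegralD//; [|exact: iG].
  by apply: eq_Rintegral => s _; ring.
have -> : lag_integral i j x = \int[mu]_t (f t * (\int[mu]_s (f s * G (t - s + x) i j) - c)).
  have bJ : exists M, forall t, f t != 0 -> `|\int[mu]_s (f s * G (t - s + x) i j)| <= M.
    have [M2 HM2] := bG (L + L + `|x|).
    exists (`|M2| * A) => t ft; apply: (normr_Rintegral_mul_le mf intf _ (mGt i j t x)) => // s fs.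
    rewrite (le_trans _ (ler_norm _))//; apply: HM2.
    rewrite (le_trans (ler_normD _ _))// lerD2r (le_trans (ler_normB _ _))// lerD ?sf//.
  have [M HM] := bJ; have iJ := integrable_mul_bounded mf intf (mJ i j x) HM.
  have ic := integrableZl measurableT c intf.
  transitivity (\int[mu]_t (f t * \int[mu]_s (f s * G (t - s + x) i j) - c * f t)).
    by rewrite RintegralB// RintegralZl// f0 mulr0 subr0.
  by apply: eq_Rintegral => t _; ring.
apply: (@le_trans _ _ (e' * A * A)); last first.
  by rewrite -mulrA -expr2 /e' mulrAC ler_pdivrMr// ler_pM2l// lerDl.
apply: (normr_Rintegral_mul_le mf intf).
- by rewrite mulr_ge0// ltW.
- by apply: measurable_funB => //; exact: mJ.
move=> t ft; rewrite inner; apply: (normr_Rintegral_mul_le mf intf); first exact: ltW.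
  apply: measurable_funB; first by apply: measurable_funB => //; exact: mGt.
  by apply: measurable_funM => //; exact: measurable_funB.
move=> s fs; have ts : `|t - s| <= L + L by rewrite (le_trans (ler_normB _ _))// lerD ?sf.
by have := hb (t - s) ts i j; rewrite !mxE [x + _]addrC.
Qed.

End LagCovariance.

(** * A weak law of large numbers *)

Section ToeplitzSum.
Context {R : realType}.

(** Enlarging the square from [K] to [K + 1] adds a row and a column, each with sum at most that of
    [a] over the indices up to [K]. *)
Lemma toeplitz_sum_le (a : nat -> R) (K : nat) : (forall n, 0 <= a n) ->
  \sum_(0 <= k < K) \sum_(0 <= l < K) a `|k - l|%N <=
  2 * K%:R * \sum_(0 <= n < K) a n.
Proof.
move=> a0; elim: K => [|K IH].
  by rewrite !big_nil mulr0.
have inc : \sum_(0 <= n < K) a n <= \sum_(0 <= n < K.+1) a n.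
  by rewrite big_nat_recr//= lerDl.
have -> : \sum_(0 <= k < K.+1) \sum_(0 <= l < K.+1) a `|k - l|%N =
    \sum_(0 <= k < K) \sum_(0 <= l < K) a `|k - l|%N +
    (\sum_(0 <= k < K) a `|k - K|%N + \sum_(0 <= l < K.+1) a `|K - l|%N).
  rewrite big_nat_recr//= addrA; congr (_ + _).
  by rewrite -big_split/=; apply: eq_bigr => k _; rewrite big_nat_recr.
have E : \sum_(0 <= l < K.+1) a `|K - l|%N = \sum_(0 <= n < K.+1) a n.
  rewrite big_nat_rev/= add0n; apply: eq_big_nat => l /andP[_ lK].
  by rewrite subSS; congr a; rewrite distnEl ?leq_subr// subKn.
have E' : \sum_(0 <= k < K) a `|k - K|%N <= \sum_(0 <= n < K.+1) a n.
  rewrite -E [leRHS]big_nat_recr//= (eq_bigr (fun k : nat => a `|K - k|%N)).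
    by rewrite lerDl.
  by move=> k _; rewrite distnC.
rewrite E (le_trans (lerD IH (lerD E' (lexx _))))//.
have : 2 * K%:R * \sum_(0 <= n < K) a n <= 2 * K%:R * \sum_(0 <= n < K.+1) a n.
  by rewrite ler_wpM2l// mulr_ge0.
rewrite -natr1; lra.
Qed.

End ToeplitzSum.

Section WeakLaw.
Context d (T : measurableType d) (R : realType) (P : probability T R).

Lemma chebyshev_bound (Z : T -> R) (dlt : R) : 0 < dlt -> measurable_fun setT Z ->
  P.-integrable setT (fun w => (Z w ^+ 2)%:E) ->
  (P [set w | (dlt <= `|Z w|)%R] <= (dlt ^- 2 * \int[P]_w (Z w ^+ 2))%:E)%E.
Proof.
move=> d0 mZ iZ.
have mA : measurable [set w | dlt <= `|Z w|].
  have mn : measurable_fun setT (fun w => `|Z w|) by exact: measurableT_comp.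
  have := measurable_fun_ler (measurable_cst dlt) mn; move=> /(_ measurableT [set true]).
  by rewrite setTI; apply.
have d2 : 0 < dlt ^- 2 by rewrite invr_gt0 exprn_gt0.
rewrite EFinM fineK; last exact: integrable_fin_num.
rewrite -ge0_integralZl//; last 3 first.
- by apply/measurable_EFinP; exact: measurable_funX.
- by move=> w _; rewrite lee_fin sqr_ge0.
- by rewrite lee_fin ltW.
rewrite -(setIT [set w | dlt <= `|Z w|]) -integral_indic//.
apply: ge0_le_integral => //.
- by apply/measurable_EFinP; exact: measurable_indic.
- by apply: emeasurable_funM => //; apply/measurable_EFinP; exact: measurable_funX.
move=> w _; rewrite -EFinM lee_fin indicE; case: (boolP (w \in _)) => [|_].
  rewrite inE/= => dZ; rewrite mulrC ler_pdivlMr ?exprn_gt0// mul1r.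
  by rewrite -[_ ^+ 2 in leRHS]real_normK ?num_real// lerXn2r// nnegrE// ltW.
by rewrite mulr_ge0 ?sqr_ge0// ltW.
Qed.

(** The variance of the mean is a normalized sum of covariances, at most twice the Cesaro mean of
    [a] by the Toeplitz bound. An upper bound on the covariances is therefore enough. *)
Lemma weak_law (X : nat -> T -> R) (e : R) (a : nat -> R) :
  (forall k, measurable_fun setT (X k)) ->
  (forall k, P.-integrable setT (EFin \o X k)) ->
  (forall k l, P.-integrable setT (fun w => (X k w * X l w)%:E)) ->
  (forall k, \int[P]_w X k w = e) ->
  (forall k l, \int[P]_w (X k w * X l w) - e ^+ 2 <= a `|k - l|%N) ->
  (forall n, 0 <= a n) -> a @ \oo --> (0 : R) ->
  forall dlt eta : R, 0 < dlt -> 0 < eta -> exists K0, forall K, (K0 <= K)%N ->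
    (P [set w | (dlt <= `|K%:R^-1 * (\sum_(0 <= k < K) X k w) - e|)%R] <= eta%:E)%E.
Proof.
move=> mX iX iXX eX aX a0 alim dlt eta d0 eta0.
(* [dlt^2] comes from Chebyshev's inequality, the factor 2 from the Toeplitz bound. *)
have := cesaro alim => /cvgrPdist_le /(_ (eta * dlt ^+ 2 / 2)).
rewrite divr_gt0 ?mulr_gt0 ?exprn_gt0// => /(_ isT)[K0 _ HK0].
exists K0.+1 => -[//|K]; rewrite ltnS => K0K.
set Z := fun w => K.+1%:R^-1 * (\sum_(0 <= k < K.+1) X k w) - e.
have K1 : (K.+1%:R : R) != 0 by rewrite pnatr_eq0.
have mZ : measurable_fun setT Z.
  apply: measurable_funB => //; apply: measurable_funM => //.
  by apply: measurable_sum.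
pose c k l w := (X k w - e) * (X l w - e).
have ic k l : P.-integrable setT (EFin \o c k l).
  have i1 := integrableB measurableT (iXX k l) (integrableZl measurableT e (iX k)).
  have i2 := integrableB measurableT i1 (integrableZl measurableT e (iX l)).
  have i3 := integrableD measurableT i2 (L4_integrable (L4_cst P (e ^+ 2))).
  apply: eq_integrable i3 => // w _.
  transitivity ((X k w * X l w - e * X k w - e * X l w + e ^+ 2)%:E); first by [].
  by congr EFin; rewrite /c; ring.
have Ec k l : \int[P]_w c k l w = \int[P]_w (X k w * X l w) - e ^+ 2.
  have i1 := integrableB measurableT (iXX k l) (integrableZl measurableT e (iX k)).
  have i2 := integrableB measurableT i1 (integrableZl measurableT e (iX l)).
  transitivity (\int[P]_w (X k w * X l w - e * X k w - e * X l w + e ^+ 2)).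
    by apply: eq_Rintegral => w _; rewrite /c; ring.
  rewrite RintegralD//; last exact: (L4_integrable (L4_cst P (e ^+ 2))).
  rewrite RintegralB//; last exact: (integrableZl measurableT e (iX l)).
  rewrite RintegralB//; [|exact: iXX|exact: (integrableZl measurableT e (iX k))].
  rewrite (RintegralZl e measurableT (iX k)) (RintegralZl e measurableT (iX l)).
  by rewrite !eX Rintegral_probability_cst; ring.
have Z2 w : Z w ^+ 2 = K.+1%:R^-1 ^+ 2 * \sum_(0 <= k < K.+1) \sum_(0 <= l < K.+1) c k l w.
  have -> : Z w = K.+1%:R^-1 * \sum_(0 <= k < K.+1) (X k w - e).
    rewrite /Z sumrB mulrBr; congr (_ - _).
    by rewrite sumr_const_nat subn0 -[e *+ _]mulr_natl mulKf.
  rewrite exprMn expr2 [in LHS]expr2; congr (_ * _).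
  by rewrite mulr_suml; apply: eq_bigr => k' _; rewrite mulr_sumr.
have iS k : P.-integrable setT (EFin \o (fun w => \sum_(0 <= l < K.+1) c k l w)).
  have := @integrable_sum _ _ _ P setT measurableT _ (index_iota 0 K.+1) xpredT
    (fun l => EFin \o c k l) (fun l _ => ic k l).
  by apply: eq_integrable => // w _; rewrite /= sumEFin.
have iSS : P.-integrable setT (EFin \o (fun w => \sum_(0 <= k < K.+1) \sum_(0 <= l < K.+1) c k l w)).
  have := @integrable_sum _ _ _ P setT measurableT _ (index_iota 0 K.+1) xpredT
    (fun k => EFin \o (fun w => \sum_(0 <= l < K.+1) c k l w)) (fun k _ => iS k).
  by apply: eq_integrable => // w _; rewrite /= sumEFin.
have iZ2 : P.-integrable setT (fun w => (Z w ^+ 2)%:E).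
  have := integrableZl measurableT (K.+1%:R^-1 ^+ 2) iSS.
  by apply: eq_integrable => // w _; rewrite Z2.
have EZ2 : \int[P]_w (Z w ^+ 2) <= K.+1%:R^-1 ^+ 2 *
    \sum_(0 <= k < K.+1) \sum_(0 <= l < K.+1) a `|k - l|%N.
  under eq_Rintegral do rewrite Z2.
  rewrite RintegralZl// ler_wpM2l ?sqr_ge0//.
  rewrite Rintegral_bigsum//; apply: ler_sum => k _.
  rewrite Rintegral_bigsum//; apply: ler_sum => l _.
  by rewrite Ec.
rewrite (le_trans (chebyshev_bound d0 mZ iZ2))// lee_fin.
have A := HK0 K K0K; rewrite sub0r normrN /arithmetic_mean/= /series/= in A.
have {A} := le_trans (ler_norm _) A => A.
have TS := toeplitz_sum_le K.+1 a0.
rewrite mulrC ler_pdivrMr ?exprn_gt0// (le_trans EZ2)//.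
apply: (@le_trans _ _ (K.+1%:R^-1 ^+ 2 * (2 * K.+1%:R * \sum_(0 <= n < K.+1) a n))).
  by rewrite ler_wpM2l ?sqr_ge0.
have -> : K.+1%:R^-1 ^+ 2 * (2 * K.+1%:R * \sum_(0 <= n < K.+1) a n) =
  2 * (K.+1%:R^-1 * \sum_(0 <= n < K.+1) a n) by field.
by rewrite mulrC -ler_pdivlMr.
Qed.

End WeakLaw.

(** * Decorrelation of the wavelet coefficients *)

Section LocalFourthMoments.
Context d (T : measurableType d) (R : realType) (P : probability T R) (p : nat).
Variables (Y : T -> R -> 'cV[R]_p) (H : 'M[R]_p).
Hypotheses (mY : measurable_process Y) (oY : ofbm P H Y).

Lemma ofbm_L4 t i : L4 P (fun w => Y w t i ord0).
Proof. by case: oY => gY _ _ _; exact: gaussian_process_L4. Qed.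

Lemma ofbm_increment_cov_bounded L :
  exists M, forall x, `|x| <= L -> entries_le (increment_cov P Y x) M.
Proof.
case: oY => gY zY sY ssY.
apply: (@selfsimilar_entries_bounded _ _ H).
- by move=> a x a0; exact: increment_cov_self_similar.
- by move=> x; exact: increment_cov_even.
- by move=> i j x; exact: increment_cov_ge0.
- by move=> i j x y; exact: increment_cov_subadditive.
Qed.

Lemma ofbm_increment_cov_asymptotically_affine : hurst_spectrum H ->
  forall L e, 0 <= L -> 0 < e -> exists X, forall x, X <= x -> exists b : 'M[R]_p,
    forall y, `|y| <= L ->
      entries_le (increment_cov P Y (x + y) - increment_cov P Y x - y *: b) e.
Proof.
case: oY => gY zY sY ssY hH L e L0 e0.
apply: (selfsimilar_asymptotically_affine hH) => //.
- by move=> a x a0; exact: increment_cov_self_similar.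
- by move=> x; exact: increment_cov_even.
- by move=> i j x; exact: increment_cov_ge0.
- by move=> i j x y; exact: increment_cov_subadditive.
Qed.

(** For a centred Gaussian variable the fourth moment is three times the squared variance, and the
    variance at [t] is controlled through [y^2 <= 2 (y - z)^2 + 2 z^2] with [z] the value at time
    0. *)
Lemma ofbm_moment4_bounded L :
  exists M, forall t i, `|t| <= L -> \int[P]_w (Y w t i ord0 ^+ 4) <= M.
Proof.
have [gY zY sY _] := oY; have LY := ofbm_L4.
have [M HM] := ofbm_increment_cov_bounded L.
pose m0 := \sum_i \int[P]_w (Y w 0 i ord0 * Y w 0 i ord0).
have sq_ge0 t i : 0 <= \int[P]_w (Y w t i ord0 * Y w t i ord0).
  by apply: Rintegral_ge0 => w _; rewrite -expr2 sqr_ge0.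
exists (3 * (2 * `|M| + 2 * m0) ^+ 2) => t i tL.
have W := wick_process t t t t i i i i gY zY.
rewrite /wick in W.
have -> : \int[P]_w (Y w t i ord0 ^+ 4) =
    3 * (\int[P]_w (Y w t i ord0 * Y w t i ord0)) ^+ 2.
  transitivity (\int[P]_w (Y w t i ord0 * Y w t i ord0 * Y w t i ord0 * Y w t i ord0)).
    by apply: eq_Rintegral => w _; rewrite !exprS expr0; ring.
  by rewrite W; ring.
have m0i : \int[P]_w (Y w 0 i ord0 * Y w 0 i ord0) <= m0.
  by rewrite /m0 (bigD1 i)//= lerDl sumr_ge0.
have LN := L4Z (-1) (LY 0 i); have LD := L4D (LY t i) LN.
have bound : \int[P]_w (Y w t i ord0 * Y w t i ord0) <= 2 * `|M| + 2 * m0.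
  apply: (@le_trans _ _ (2 * increment_cov P Y t i i +
      2 * \int[P]_w (Y w 0 i ord0 * Y w 0 i ord0))).
    have E : increment_cov P Y t i i =
        \int[P]_w ((Y w t i ord0 + -1 * Y w 0 i ord0) * (Y w t i ord0 + -1 * Y w 0 i ord0)).
      by rewrite mxE; apply: eq_Rintegral => w _; rewrite !mulN1r.
    rewrite E.
    have i1 := L4_prod2 LD LD; have i2 := L4_prod2 (LY 0 i) (LY 0 i).
    rewrite -(RintegralZl 2 measurableT i1) -(RintegralZl 2 measurableT i2).
    have i3 := integrableZl measurableT 2 i1; have i4 := integrableZl measurableT 2 i2.
    rewrite -RintegralD//; apply: le_Rintegral => //.
    - exact: L4_prod2 (LY t i) (LY t i).
    - exact: (integrableD measurableT i3 i4).
    move=> w _; have := sqr_ge0 (Y w t i ord0 - 2 * Y w 0 i ord0); rewrite expr2; lra.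
  apply: lerD; last by rewrite ler_pM2l.
  by rewrite ler_pM2l// (le_trans (ler_norm _))// (le_trans (HM _ tL i i))// ler_norm.
have := sq_ge0 t i => s0.
by rewrite ler_pM2l// lerXn2r// nnegrE// (le_trans s0).
Qed.

End LocalFourthMoments.

(** [c * c] is the product of the means in Wick's formula, so the left-hand side is a covariance of
    products. Absolute values keep the bound nonnegative, as [weak_law] demands. *)
Lemma symmetrized_product_le {R : realType} (c rii rjj rij rji gij gii gjj : R) :
  rij + rji = - gij -> rjj + rjj = - gjj -> rii + rii = - gii ->
  c * c + rii * rjj + rij * rji - c ^+ 2 <= `|gii| * `|gjj| / 4 + gij ^+ 2 / 4.
Proof.
move=> hij hjj hii.
have -> : gij = - (rij + rji) by lra.
have -> : c * c + rii * rjj + rij * rji - c ^+ 2 = gii * gjj / 4 + rij * rji.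
  have -> : rii = - gii / 2 by lra.
  have -> : rjj = - gjj / 2 by lra.
  by field.
apply: lerD; first by rewrite ler_pM2r ?invr_gt0// -normrM ler_norm.
by have := sqr_ge0 (rij - rji); rewrite expr2 => h; rewrite expr2; lra.
Qed.

Lemma product_bound_cvg0 {R : realType} (u v w : nat -> R) :
  u @ \oo --> (0 : R) -> v @ \oo --> (0 : R) -> w @ \oo --> (0 : R) ->
  `|u n| * `|v n| / 4 + w n ^+ 2 / 4 @[n --> \oo] --> (0 : R).
Proof.
move=> u0 v0 w0.
have h1 : `|u n| * `|v n| / 4 @[n --> \oo] --> (`|0 : R| * `|0 : R| / 4 : R).
  exact: (cvgM (cvgM (cvg_norm u0) (cvg_norm v0)) (cvg_cst _)).
have h2 : w n ^+ 2 / 4 @[n --> \oo] --> (0 ^+ 2 / 4 : R).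
  exact: (cvgM (cvgM w0 w0) (cvg_cst _)).
have E : (0 : R) = `|0 : R| * `|0 : R| / 4 + 0 ^+ 2 / 4 by rewrite normr0 expr2 !mul0r addr0.
by rewrite [X in _ --> X]E; exact: (cvgD h1 h2).
Qed.

Section ShiftedCoefficients.
Context d (T : measurableType d) (R : realType) (P : probability T R) (p : nat).
Notation mu := (@lebesgue_measure R).
Variables (Y : T -> R -> 'cV[R]_p) (H : 'M[R]_p).
Hypotheses (mY : measurable_process Y) (oY : ofbm P H Y) (hH : hurst_spectrum H).
Variables (f : R -> R) (L tau : R).
Hypotheses (wf : weight f L) (L0 : 0 <= L) (f0 : \int[mu]_t f t = 0) (tau0 : 0 < tau).

Let LY := ofbm_L4 oY.
Let bY := ofbm_moment4_bounded mY oY.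
Let bG := ofbm_increment_cov_bounded mY oY.
Let gY : gaussian_process P Y. Proof. by case: oY. Qed.
Let zY : zero_mean P Y. Proof. by case: oY. Qed.
Let sY : stationary_increments P Y. Proof. by case: oY. Qed.

Let fk (k : nat) (t : R) := f (t - tau * k%:R).
Let D (k : nat) i := coef Y (fk k) i.
Let wk k : weight (fk k) (L + `|tau * k%:R|). Proof. exact: (weight_shift wf). Qed.
Let LD k i : L4 P (D k i). Proof. exact: (L4_coef mY LY bY (wk k)). Qed.

Definition lag_cov i j (n : nat) := lag_integral f (increment_cov P Y) i j (tau * n%:R).

Let rho k l i j := \int[P]_w (D k i w * D l j w).

Let rhoC k l i j : rho k l i j = rho l k j i.
Proof. exact: Rintegral_mulC. Qed.

(** Exchanging [k] and [l] amounts to exchanging [i] and [j], which the symmetrized sum does not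
    see; hence [k <= l] may be assumed. *)
Let rho_sym k l i j : rho k l i j + rho k l j i = - lag_cov i j `|k - l|%N.
Proof.
wlog kl : k l / (k <= l)%N.
  move=> W; have [/W//|/ltnW/W] := leqP k l.
  rewrite distnC => <-; apply: (etrans (addrC _ _)).
  exact: (f_equal2 +%R (rhoC k l j i) (rhoC k l i j)).
have mG i' j' := measurable_increment_cov P mY i' j'.
have fk0 m : \int[mu]_t fk m t = 0 by rewrite /fk (Rintegral_weight_shift wf f0).
rewrite /rho (coef_cov_sym mY LY bY sY bG i j (wk k) (wk l) (fk0 k) (fk0 l)).
have E := lag_integral_shift wf mG i j (tau * k%:R) (tau * l%:R).
have {}kl : (`|k - l|%N%:R : R) = l%:R - k%:R by rewrite (distnEr kl) natrB.
by rewrite /lag_cov kl mulrBr -E.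
Qed.

(** At lag 0 the cross-covariance is already symmetric in (i, j), so its symmetric part determines
    it. This makes the mean of the products independent of the shift. *)
Let rho_diag k i j : rho k k i j = rho 0 0 i j.
Proof.
have h m : rho m m i j = - lag_cov i j 0 / 2.
  have := rho_sym m m i j; rewrite (rhoC m m j i) distnn => <-; by field.
by rewrite !h.
Qed.

Let lag_cov_cvg0 i j : lag_cov i j n @[n --> \oo] --> (0 : R).
Proof.
have mG i' j' := measurable_increment_cov P mY i' j'.
apply/cvgrPdist_le => e e0.
have [X HX] := lag_integral_cvg0 wf L0 f0 mG bG i j
  (ofbm_increment_cov_asymptotically_affine mY oY hH) e0.
near=> n; rewrite sub0r normrN; apply: HX.
rewrite mulrC -ler_pdivrMr//.
by near: n; exact: nbhs_infty_ger.
Unshelve. all: by end_near. Qed.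

Lemma shifted_coef_weak_law i j (dlt eta : R) : 0 < dlt -> 0 < eta ->
  exists K0, forall K, (K0 <= K)%N ->
    (P [set w | (dlt <= `|K%:R^-1 *
        (\sum_(1 <= k < K.+1) coef Y (fun t => f (t - tau * k%:R)) i w *
                              coef Y (fun t => f (t - tau * k%:R)) j w) -
        \int[P]_w (coef Y f i w * coef Y f j w)|)%R] <= eta%:E)%E.
Proof.
move=> dlt0 eta0.
(* The sample spectrum starts at shift 1, the weak law at index 0. *)
pose X k w := D k.+1 i w * D k.+1 j w.
pose a n := `|lag_cov i i n| * `|lag_cov j j n| / 4 + (lag_cov i j n) ^+ 2 / 4.
have E0 : \int[P]_w (coef Y f i w * coef Y f j w) = rho 0 0 i j.
  rewrite /rho /D /fk; apply: eq_Rintegral => w _.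
  by under eq_fun do rewrite mulr0 subr0.
have iX k : P.-integrable setT (EFin \o X k) by exact: L4_prod2 (LD _ _) (LD _ _).
have mX k : measurable_fun setT (X k).
  by have := measurable_int _ (iX k) => /measurable_EFinP.
have iXX k l : P.-integrable setT (fun w => (X k w * X l w)%:E).
  have := L4_prod4 (LD k.+1 i) (LD k.+1 j) (LD l.+1 i) (LD l.+1 j).
  by apply: eq_integrable => // w _; rewrite /X !mulrA.
have eX k : \int[P]_w X k w = rho 0 0 i j by rewrite -(rho_diag k.+1).
have aX k l : \int[P]_w (X k w * X l w) - rho 0 0 i j ^+ 2 <= a `|k - l|%N.
  have W := wick_coefs mY LY bY i j i j (wk k.+1) (wk k.+1) (wk l.+1) (wk l.+1) gY zY.
  rewrite /wick in W.
  have -> : \int[P]_w (X k w * X l w) = rho k.+1 k.+1 i j * rho l.+1 l.+1 i j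
    + rho k.+1 l.+1 i i * rho k.+1 l.+1 j j + rho k.+1 l.+1 i j * rho k.+1 l.+1 j i.
    transitivity (\int[P]_w (D k.+1 i w * D k.+1 j w * D l.+1 i w * D l.+1 j w)).
      by apply: eq_Rintegral => w _; rewrite /X !mulrA.
    by rewrite W.
  rewrite !rho_diag /a.
  have := rho_sym k.+1 l.+1 i i; have := rho_sym k.+1 l.+1 j j; have := rho_sym k.+1 l.+1 i j.
  have -> : `|k.+1 - l.+1|%N = `|k - l|%N by rewrite -[k.+1]addn1 -[l.+1]addn1 distnDr.
  move=> hij hjj hii; exact: symmetrized_product_le hij hjj hii.
have a0 n : 0 <= a n.
  have h4 : 0 <= 4 :> R by [].
  exact: (addr_ge0 (divr_ge0 (mulr_ge0 (normr_ge0 _) (normr_ge0 _)) h4) (divr_ge0 (sqr_ge0 _) h4)).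
have alim : a @ \oo --> (0 : R).
  exact: product_bound_cvg0 (lag_cov_cvg0 i i) (lag_cov_cvg0 j j) (lag_cov_cvg0 i j).
have [K0 HK0] := weak_law mX iX iXX eX aX a0 alim dlt0 eta0.
rewrite E0; exists K0 => K K0K; apply: le_trans (HK0 K K0K).
rewrite le_eqVlt; apply/orP; left; apply/eqP; congr (P _); apply/seteqP.
by split => w /=; rewrite big_add1/=.
Unshelve. all: by end_near. Qed.

End ShiftedCoefficients.

(** * Consistency of the sample wavelet spectrum *)

Section WaveletWeights.
Context {R : realType}.
Notation mu := (@lebesgue_measure R).
Variable psi : R -> R.
Hypothesis psi_L1 : psi \in Lfun mu 1.
Implicit Types (j k : int) (c t : R).

Lemma weight_affine f L a b c : weight f L -> 0 < a ->
  weight (fun t => c * f (a * t + b)) ((L + `|b|) / a).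
Proof.
move=> [mf intf sf] a0.
have mfa : measurable_fun setT (fun t : R => f (a * t + b)).
  by apply: (measurableT_comp mf); exact: measurable_affine.
have ifa : mu.-integrable setT (EFin \o (fun t => f (a * t + b))).
  have /integrableP[mfE foo] := intf; apply/integrableP; split; first exact/measurable_EFinP.
  have mg : measurable_fun setT (fun t => `|(f t)%:E|%E) by exact: measurableT_comp.
  have E := ge0_integral_affine b a0 mg (fun t => abse_ge0 _).
  move: foo; rewrite /= E => foo; apply: lte_mul_pinfty => //.
  by rewrite lee_fin invr_ge0 ltW.
split.
- exact: measurable_funM.
- exact: (integrableZl measurableT c ifa).
- move=> t; rewrite mulf_eq0 negb_or => /andP[_ /sf h].
  rewrite ler_pdivlMr// mulrC -[a in leLHS](gtr0_norm a0) -normrM.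
  have -> : a * t = (a * t + b) - b by rewrite addrK.
  by rewrite (le_trans (ler_normB _ _))// lerD2r.
Qed.

Lemma psi_weight : compact_interval_support psi -> exists L, weight psi L.
Proof.
move=> [a [b ab]]; exists (Num.max `|a| `|b|).
have mpsi : measurable_fun setT psi by have := sub_Lfun_mfun psi_L1; rewrite inE.
split => //.
  exact/Lfun1_integrable.
move=> t pt; have : `[a, b]%classic t by rewrite -ab; exact: subset_closure.
rewrite /= in_itv/= => /andP[at' tb]; rewrite le_max.
have [t0|t0] := leP 0 t.
  by rewrite ger0_norm// (le_trans tb (ler_norm _)) orbT.
by rewrite ltr0_norm// (le_trans (_ : - t <= - a)) ?lerN2// -normrN ler_norm.
Qed.

Lemma exprz2_gt0 j : 0 < 2 ^ j :> R. Proof. exact: exprz_gt0. Qed.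

(** Within one scale all coefficients come from a single weight translated by multiples of [2 ^ j],
    which is the form the lag covariances need. *)
Lemma waveletE j k t : wavelet psi j k t = wavelet psi j 0 (t - 2 ^ j * k%:~R).
Proof.
rewrite /wavelet subr0 mulrBr mulrA -expfzDr ?pnatr_eq0//.
by rewrite addNr expr0z mul1r.
Qed.

Lemma wavelet_weight j : compact_interval_support psi ->
  exists2 L, 0 <= L & weight (wavelet psi j 0) L.
Proof.
move=> /psi_weight[L wpsi].
have := weight_affine 0 (2 `^ (- (j%:~R / 2))) wpsi (exprz2_gt0 (- j)).
have -> : (fun t : R => 2 `^ (- (j%:~R / 2)) * psi (2 ^ (- j) * t + 0)) = wavelet psi j 0.
  by apply/funext => t; rewrite /wavelet subr0 addr0.
rewrite normr0 addr0 => -[mf intf sf]; exists `|L / 2 ^ (- j)| => //; split => //.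
by move=> t /sf h; rewrite (le_trans h)// ler_norm.
Qed.

Lemma Rintegral_wavelet j N : (0 < N)%N -> vanishing_moments psi N ->
  \int[mu]_t wavelet psi j 0 t = 0.
Proof.
move=> N0 /(_ 0%N N0); under eq_Rintegral do rewrite expr0 mul1r.
move=> psi0.
have mpsi : measurable_fun setT psi by have := sub_Lfun_mfun psi_L1; rewrite inE.
have ipsi : mu.-integrable setT (EFin \o psi) by exact/Lfun1_integrable.
have h := Rintegral_affine 0 (exprz2_gt0 (- j)) mpsi.
transitivity (\int[mu]_t (2 `^ (- (j%:~R / 2)) * psi (2 ^ (- j) * t + 0))) => //.
  by apply: eq_Rintegral => t _; rewrite /wavelet subr0 addr0.
have m2 : measurable_fun setT (fun t : R => psi (2 ^ (- j) * t + 0)).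
  by apply: (measurableT_comp mpsi); exact: measurable_affine.
have := Rintegral_affine 0 (exprz2_gt0 (- j)) (measurable_funM (measurable_cst (2 `^ (- (j%:~R / 2)))) mpsi).
move=> /= ->.
by rewrite RintegralZl// psi0 !mulr0.
Qed.

End WaveletWeights.

Section SpectrumEntries.
Context d (T : measurableType d) (R : realType) (P : probability T R) (p : nat).
Variables (psi : R -> R) (Y : T -> R -> 'cV[R]_p).
Implicit Types (i : 'I_p) (j : int).

Lemma wavelet_coefE j k i w : wavelet_coef psi Y j k w i ord0 = coef Y (wavelet psi j k) i w.
Proof. by rewrite mxE. Qed.

Lemma wavelet_spectrumE j i1 i2 : wavelet_spectrum P psi Y j i1 i2 =
  \int[P]_w (coef Y (wavelet psi j 0) i1 w * coef Y (wavelet psi j 0) i2 w).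
Proof.
rewrite mxE unlock /Rintegral; congr fine; apply: eq_integral => w _.
by rewrite !mxE big_ord1 !mxE.
Qed.

Lemma wavelet_spectrum_sym j i1 i2 :
  wavelet_spectrum P psi Y j i1 i2 = wavelet_spectrum P psi Y j i2 i1.
Proof. by rewrite !wavelet_spectrumE Rintegral_mulC. Qed.

Lemma sample_spectrumE N j w i1 i2 : sample_spectrum psi Y N j w i1 i2 =
  (nb_coefs (R := R) N j)%:R^-1 * \sum_(1 <= k < (nb_coefs (R := R) N j).+1)
    coef Y (fun t => wavelet psi j 0 (t - 2 ^ j * k%:R)) i1 w *
    coef Y (fun t => wavelet psi j 0 (t - 2 ^ j * k%:R)) i2 w.
Proof.
rewrite mxE summxE; congr (_ * _); apply: eq_bigr => k _.
rewrite mxE big_ord1 [_^T _ _]mxE !wavelet_coefE.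
have -> : wavelet psi j k = (fun t => wavelet psi j 0 (t - 2 ^ j * k%:R)).
  by apply/funext => t; rewrite waveletE.
by [].
Qed.

End SpectrumEntries.

(** By Fubini the spectrum is a double integral of second moments at two times, and each of these
    depends only on a two-time law. *)
Lemma wavelet_spectrum_same_fdd {R : realType} (p : nat)
    d1 (T1 : measurableType d1) (P1 : probability T1 R)
    d2 (T2 : measurableType d2) (P2 : probability T2 R)
    (Y1 : T1 -> R -> 'cV[R]_p) (Y2 : T2 -> R -> 'cV[R]_p) (H1 H2 : 'M[R]_p)
    (psi : R -> R) j :
  measurable_process Y1 -> measurable_process Y2 -> ofbm P1 H1 Y1 -> ofbm P2 H2 Y2 ->
  psi \in Lfun (@lebesgue_measure R) 1 -> compact_interval_support psi ->
  same_fdd P1 P2 Y1 Y2 ->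
  wavelet_spectrum P1 psi Y1 j = wavelet_spectrum P2 psi Y2 j.
Proof.
move=> m1 m2 o1 o2 p1 sp fdd; apply/matrixP => i1 i2; rewrite !wavelet_spectrumE.
have [L _ w] := wavelet_weight p1 j sp.
rewrite (coef_cov m1 (ofbm_L4 o1) (ofbm_moment4_bounded m1 o1) i1 i2 w w).
rewrite (coef_cov m2 (ofbm_L4 o2) (ofbm_moment4_bounded m2 o2) i1 i2 w w).
apply: eq_Rintegral => t _; congr (_ * _); apply: eq_Rintegral => s _; congr (_ * _).
pose o := lift ord0 ord0 : 'I_2.
pose phi (M : 'M[R]_(p, 2)) := M i1 ord0 * M i2 o.
have cphi : continuous phi.
  have cc k l := @coord_continuous R p 2 k l.
  by move=> M; exact: (cvgM (cc i1 ord0 M) (cc i2 o M)).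
have := Rintegral_same_fdd (t := fun k : 'I_2 => if k == ord0 then s else t) fdd cphi.
have E d (T : measurableType d) (Y : T -> R -> 'cV[R]_p) :
    (fun w => phi (\matrix_(i, k) Y w (if k == ord0 then s else t) i ord0)) =
    (fun w => Y w s i1 ord0 * Y w t i2 ord0).
  by apply/funext => w'; rewrite /phi !mxE.
rewrite !E; apply; apply: measurable_funM; exact: measurable_coord.
Qed.

Section Consistency.
Context d (T : measurableType d) (R : realType) (P : probability T R) (p : nat).
Variables (Y : T -> R -> 'cV[R]_p) (H : 'M[R]_p) (psi : R -> R) (Npsi : nat).
Hypotheses (mY : measurable_process Y) (oY : ofbm P H Y) (hH : hurst_spectrum H).
Hypotheses (psi_L1 : psi \in Lfun (@lebesgue_measure R) 1) (Npsi_gt0 : (0 < Npsi)%N)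
  (psi_moments : vanishing_moments psi Npsi) (psi_support : compact_interval_support psi).

Lemma measurable_sample_spectrum N j i1 i2 :
  measurable_fun setT (fun w => sample_spectrum psi Y N j w i1 i2).
Proof.
have [L _ w] := wavelet_weight psi_L1 j psi_support.
have mc i k : measurable_fun setT (coef Y (fun t => wavelet psi j 0 (t - 2 ^ j * k%:R)) i).
  exact: (L4_coef mY (ofbm_L4 oY) (ofbm_moment4_bounded mY oY) (weight_shift w _) i).1.
apply: (eq_measurable_fun _ (fun w _ => esym (sample_spectrumE psi Y N j w i1 i2))).
by apply: measurable_funM => //; apply: measurable_sum => k; exact: measurable_funM.
Qed.

Lemma nb_coefs_ge K j : exists N0, forall N, (N0 <= N)%N -> (K <= nb_coefs (R := R) N j)%N.
Proof.
have p2 : 0 < 2 ^ j :> R := exprz2_gt0 j.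
exists (Num.truncn (K%:R * 2 ^ j : R)).+1 => N N0.
rewrite /nb_coefs truncn_ge_nat; last by rewrite divr_ge0// ltW.
rewrite ler_pdivlMr//.
by rewrite ltW// (lt_le_trans (truncnS_gt _))// ler_nat.
Qed.

Lemma sample_spectrum_consistent j i1 i2 (dlt eta : R) : 0 < dlt -> 0 < eta ->
  exists N0, forall N, (N0 <= N)%N ->
    (P [set w | (dlt <= `|sample_spectrum psi Y N j w i1 i2 -
                          wavelet_spectrum P psi Y j i1 i2|)%R] <= eta%:E)%E.
Proof.
move=> dlt0 eta0; have [L L0 w] := wavelet_weight psi_L1 j psi_support.
have i0 := Rintegral_wavelet psi_L1 j Npsi_gt0 psi_moments.
have [K0 HK0] := shifted_coef_weak_law mY oY hH w L0 i0 (exprz2_gt0 j) i1 i2 dlt0 eta0.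
have [N0 HN0] := nb_coefs_ge K0 j.
exists N0 => N /HN0/HK0; rewrite wavelet_spectrumE.
apply: le_trans; rewrite le_eqVlt; apply/orP; left; apply/eqP; congr (P _).
by apply/seteqP; split => w' /=; rewrite sample_spectrumE.
Qed.

End Consistency.

(** * Stability of the minimizer *)

Section LogDistance.
Context {R : realType}.
Implicit Types (x c eps : R).

(** Serves to choose one tolerance for all matrix entries and all scales. *)
Lemma uniform_threshold (I : eqType) (s : seq I) (Q : I -> R -> Prop) :
  (forall i d d', Q i d -> d' <= d -> Q i d') ->
  (forall i, i \in s -> exists2 d, 0 < d & Q i d) ->
  exists2 d, 0 < d & forall i, i \in s -> Q i d.
Proof.
move=> mono; elim: s => [|i s IH] h; first by exists 1.
have [|d1 d10 h1] := IH; first by move=> k ks; apply: h; rewrite inE ks orbT.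
have [d2 d20 h2] := h i (mem_head _ _).
exists (Num.min d1 d2); first by rewrite lt_min d10.
move=> k; rewrite inE => /predU1P[->|ks].
  by apply: mono h2 _; rewrite ge_min lexx orbT.
by apply: mono (h1 k ks) _; rewrite ge_min lexx.
Qed.

Lemma ln2_gt0 : 0 < ln 2 :> R.
Proof. by rewrite ln_gt0// ltr1n. Qed.

(** Continuity of the logarithm at [|c|]; staying within [|c|] of [c] keeps [x] nonzero, away from
    the default value of [ln]. *)
Lemma log2_norm_near c eps : c != 0 -> 0 < eps -> exists2 d, 0 < d &
  forall x, `|x - c| < d -> x != 0 /\ `|log2 `|x| - log2 `|c| | <= eps.
Proof.
move=> c0 eps0; have nc0 : 0 < `|c| by rewrite normr_gt0.
have l2 := ln2_gt0.
have := continuous_ln nc0 => /cvgrPdist_le/(_ (eps * ln 2)).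
rewrite mulr_gt0// => /(_ isT) /nbhs_ballP[d /= d0 hd].
exists (Num.min d `|c|); first by rewrite lt_min d0.
move=> x; rewrite lt_min => /andP[xd xc]; split.
  by apply/negP => /eqP x0; move: xc; rewrite x0 sub0r normrN ltxx.
rewrite /log2 -mulrBl normrM (gtr0_norm (_ : 0 < (ln 2)^-1)) ?invr_gt0//.
rewrite ler_pdivrMr// distrC; apply: hd; rewrite /ball/=.
by rewrite (le_lt_trans (ler_dist_dist _ _))// distrC.
Qed.

(** The converse control, by continuity of the exponential at [ln |c|]. *)
Lemma norm_log2_near c eps : c != 0 -> 0 < eps -> exists2 k, 0 < k &
  forall x, x != 0 -> `|log2 `|x| - log2 `|c| | <= k -> `| `|x| - `|c| | < eps.
Proof.
move=> c0 eps0; have nc0 : 0 < `|c| by rewrite normr_gt0.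
have l2 := ln2_gt0.
have := @continuous_expR R (ln `|c|) => /cvgrPdist_lt/(_ eps eps0) /nbhs_ballP[d /= d0 hd].
exists (d / 2 / ln 2); first by rewrite !divr_gt0.
move=> x x0; rewrite /log2 -mulrBl normrM (gtr0_norm (_ : 0 < (ln 2)^-1)) ?invr_gt0//.
rewrite ler_pM2r ?invr_gt0// => h.
have := hd (ln `|x|); rewrite !lnK ?posrE ?normr_gt0// distrC; apply.
by rewrite /ball/= distrC (le_lt_trans h)// ltr_pdivrMr// ltr_pMr// ltr1n.
Qed.

Variables (p : nat) (j1 j2 : int).
Hypothesis j12 : j1 <= j2.

Lemma mem_scales j : (j \in scales j1 j2) = (j1 <= j <= j2).
Proof.
apply/mapP/idP => [[n]|/andP[h1 h2]].
  rewrite mem_iota add0n ltnS => /andP[_ nj] ->.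
  rewrite lerDl/= -lerBrDl.
  by rewrite -(ger0_norm (_ : 0 <= j2 - j1)) ?subr_ge0// -abszE lez_nat.
exists `|j - j1|%N; last by rewrite gez0_abs ?subr_ge0// [RHS]addrC subrK.
rewrite mem_iota add0n ltnS/= -lez_nat !abszE !ger0_norm ?subr_ge0//.
by rewrite lerD2r.
Qed.

(** A finite bound excludes the value [+oo], so all entries in the sum are nonzero, and each square
    is at most the whole sum. *)
Lemma log_distance_leP (S E : int -> 'M[R]_p) (r : R) :
  (log_distance j1 j2 S E <= r%:E)%E -> forall (j : int) (i1 i2 : 'I_p), j1 <= j <= j2 ->
  (i1 <= i2)%N -> E j i1 i2 != 0 /\ (log2 `|S j i1 i2| - log2 `|E j i1 i2|) ^+ 2 <= r.
Proof.
rewrite /log_distance; case: ifPn => [/asboolP nz|_]; last by rewrite leye_eq.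
rewrite lee_fin => le_r j i1 i2 jj ii; split; first by case: (nz j i1 i2 jj ii).
apply: le_trans le_r; rewrite (bigD1 i1)//= (bigD1 i2)//=.
have us : uniq (scales j1 j2).
  by rewrite map_inj_uniq ?iota_uniq// => m n /addrI; exact: (can_inj absz_nat).
rewrite (bigD1_seq j) ?mem_scales//=.
rewrite -!addrA lerDl !addr_ge0//.
- by apply: sumr_ge0 => k _; exact: sqr_ge0.
- by apply: sumr_ge0 => i _; apply: sumr_ge0 => k _; exact: sqr_ge0.
- apply: sumr_ge0 => i _; apply: sumr_ge0 => i' _; apply: sumr_ge0 => k _; exact: sqr_ge0.
Qed.

Lemma log_distance_le (S E : int -> 'M[R]_p) (r : R) : 0 <= r ->
  (forall (j : int) (i1 i2 : 'I_p), j1 <= j <= j2 ->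
    [/\ S j i1 i2 != 0, E j i1 i2 != 0 &
        (log2 `|S j i1 i2| - log2 `|E j i1 i2|) ^+ 2 <= r]) ->
  (log_distance j1 j2 S E <= (r * (size (scales j1 j2) * p * p)%:R)%:E)%E.
Proof.
move=> r0 h; rewrite /log_distance ifT; last first.
  by apply/asboolP => j i1 i2 jj _; case: (h j i1 i2 jj).
rewrite lee_fin.
apply: (@le_trans _ _ (\sum_(i1 < p) \sum_(i2 < p) \sum_(j <- scales j1 j2) r)).
  apply: ler_sum => i1 _; rewrite big_mkcond; apply: ler_sum => i2 _.
  case: ifP => _; last by apply: sumr_ge0.
  by rewrite big_seq [leRHS]big_seq; apply: ler_sum => j; rewrite mem_scales => jj; case: (h j i1 i2 jj).
have -> : \sum_(j <- scales j1 j2) r = r *+ size (scales j1 j2).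
  by rewrite big_const_seq count_predT iter_addr_0.
rewrite !sumr_const.
rewrite !card_ord -!mulrnA mulr_natr mulnA.
by [].
Qed.

End LogDistance.

Section ArgminStability.
Context {R : realType} (V : normedModType R) (p : nat) (j1 j2 js : int).
Variables (Xi : set V) (th0 : V) (E : int -> V -> 'M[R]_p).
Hypotheses (j12 : j1 <= j2) (jsP : j1 <= js <= j2).
Hypothesis Xi_compact : compact Xi.
Hypothesis E_cont : {within Xi, continuous (E js)}.
Hypothesis E_sym : forall th i1 i2, E js th i1 i2 = E js th i2 i1.
Hypothesis E_ident : forall th, Xi th -> th <> th0 ->
  exists i1 i2 : 'I_p, `|E js th i1 i2| <> `|E js th0 i1 i2|.
Hypothesis E_neq0 : forall (i1 i2 : 'I_p) (j : int), j1 <= j <= j2 -> E j th0 i1 i2 <> 0.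

(** The total deviation [h] of the moduli is continuous and, by identifiability, positive on the
    compact set of parameters at distance at least [e]; there its minimum is positive, and some
    entry must carry a fixed share of it. *)
Lemma argmin_separation (e : R) : 0 < e -> exists2 m, 0 < m &
  forall th, Xi th -> e <= `|th - th0| ->
    exists i1 i2 : 'I_p, m <= `| `|E js th i1 i2| - `|E js th0 i1 i2| |.
Proof.
move=> e0; pose K := Xi `&` [set th | e <= `|th - th0|].
pose h th := \sum_(i1 < p) \sum_(i2 < p) `| `|E js th i1 i2| - `|E js th0 i1 i2| |.
have [K0|/set0P K0] := eqVneq K set0.
  exists 1 => // th Xth eth; exfalso.
  by have : K th by []; rewrite K0.
have Kc : compact K.
  apply: compact_closedI => //.
  apply: (@closed_comp _ _ (fun th => `|th - th0|) [set x | e <= x]).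
    by move=> th _; apply: cvg_norm; apply: cvgB; [exact: cvg_id|exact: cvg_cst].
  exact: closed_ge.
have cE i1 i2 : {within Xi, continuous (fun th => E js th i1 i2)}.
  move=> th; apply: (@continuous_comp _ _ _ (E js : subspace Xi -> 'M[R]_p) (fun M : 'M[R]_p => M i1 i2)).
    exact: E_cont.
  exact: coord_continuous.
have hc : {within K, continuous h}.
  apply: (@continuous_subspaceW _ _ _ Xi); first by move=> ? [].
  move=> th; apply: cvg_big => [|i1 _]; first exact: add_continuous.
  apply: cvg_big => [|i2 _]; first exact: add_continuous.
  apply: cvg_norm; apply: cvgB; last exact: cvg_cst.
  apply: cvg_norm.
  exact: cE.
have [c Kcc hmin] := compact_EVT_min K0 Kc hc.
have [Xc ec] : Xi c /\ e <= `|c - th0| by move: Kcc; rewrite inE.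
have h_ge0 i1 i2 th : 0 <= `| `|E js th i1 i2| - `|E js th0 i1 i2| | by [].
have hc0 : 0 < h c.
  have cth : c <> th0 by move=> cth; move: ec; rewrite cth subrr normr0 leNgt e0.
  have [i1 [i2 ne]] := E_ident Xc cth.
  rewrite /h (bigD1 i1)//= (bigD1 i2)//= -addrA ltr_wpDr//.
    by apply: addr_ge0; apply: sumr_ge0 => // i _; apply: sumr_ge0.
  by rewrite normr_gt0 subr_eq0; apply/eqP.
(* With [p^2 + 1] in place of [p^2], the sum of [p^2] entries below this share is strictly less than
   [h c]. *)
exists (h c / (p * p).+1%:R); first by rewrite divr_gt0.
move=> th Xth eth; apply/not_existsP => hne.
have : h c <= h th by apply: hmin; rewrite inE.
apply/negP; rewrite -ltNge.
have bnd i1 i2 : `| `|E js th i1 i2| - `|E js th0 i1 i2| | <= h c / (p * p).+1%:R.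
  rewrite leNgt; apply/negP => lt; apply: (hne i1); exists i2; exact: ltW.
apply: (@le_lt_trans _ _ (\sum_(i1 < p) \sum_(i2 < p) (h c / (p * p).+1%:R))).
  by apply: ler_sum => i1 _; apply: ler_sum => i2 _.
rewrite !sumr_const !card_ord -mulrnA -[X in X < _]mulr_natr -mulrA gtr_pMr//.
by rewrite mulrC ltr_pdivrMr// mul1r ltr_nat.
Qed.

(** If [S] is close to [E(th0)], the objective at [th0] is small, hence so is the one at [th]; then
    every [log |E(th)|] is close to [log |S|], thus to [log |E(th0)|], which contradicts the
    separation when [th] is far. *)
Lemma argmin_stable (e : R) : 0 < e -> exists2 dlt, 0 < dlt &
  forall (S : int -> 'M[R]_p) th, Xi th ->
    (forall (j : int) (i1 i2 : 'I_p), j1 <= j <= j2 -> `|S j i1 i2 - E j th0 i1 i2| < dlt) ->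
    (log_distance j1 j2 S (E ^~ th) <= log_distance j1 j2 S (E ^~ th0))%E ->
    `|th - th0| <= e.
Proof.
move=> e0; have [m m0 sep] := argmin_separation e0.
have neq0 i1 i2 j : j1 <= j <= j2 -> E j th0 i1 i2 != 0 by move=> jj; apply/eqP; exact: E_neq0.
have [k k0 hk] : exists2 k : R, 0 < k & forall ii, ii \in enum {: 'I_p * 'I_p} ->
    forall x : R, x != 0 -> `|log2 `|x| - log2 `|E js th0 ii.1 ii.2| | <= k ->
    `| `|x| - `|E js th0 ii.1 ii.2| | < m.
  apply: (@uniform_threshold _ _ _ (fun ii d => forall x : R, x != 0 ->
    `|log2 `|x| - log2 `|E js th0 ii.1 ii.2| | <= d -> `| `|x| - `|E js th0 ii.1 ii.2| | < m))
    => [ii d d' h d'd x x0 xd|ii _].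
    by apply: h => //; exact: le_trans d'd.
  exact: norm_log2_near (neq0 _ _ _ jsP) m0.
pose n := (size (scales j1 j2) * p * p).+1.
(* The objective at [th0] is at most [om^2 (n - 1) <= (om n)^2 = (k / 2)^2]; the other half of [k]
   is left for the distance from [log |S|] to [log |E(th0)|]. *)
pose om := k / 2 / n%:R.
have n1 : 1 <= n%:R :> R by rewrite ler1n.
have n0 : 0 < n%:R :> R by rewrite ltr0n.
have om0 : 0 < om by rewrite !divr_gt0.
have omk : om <= k / 2 by rewrite ler_pdivrMr// ler_peMr// divr_ge0// ltW.
have [dlt dlt0 hdlt] : exists2 d : R, 0 < d & forall j, j \in scales j1 j2 ->
    forall ii, ii \in enum {: 'I_p * 'I_p} -> forall x : R, `|x - E j th0 ii.1 ii.2| < d ->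
    x != 0 /\ `|log2 `|x| - log2 `|E j th0 ii.1 ii.2| | <= om.
  pose Q j ii d := forall x : R, `|x - E j th0 ii.1 ii.2| < d ->
    x != 0 /\ `|log2 `|x| - log2 `|E j th0 ii.1 ii.2| | <= om.
  apply: (@uniform_threshold _ _ _ (fun j d => forall ii, ii \in enum {: 'I_p * 'I_p} -> Q j ii d))
    => [j d d' h d'd ii iie x xd|j].
    by apply: h iie _ _; exact: lt_le_trans d'd.
  rewrite mem_scales// => jj; apply: (@uniform_threshold _ _ _ (Q j)) => [ii d d' h d'd x xd|ii _].
    by apply: h => //; exact: lt_le_trans d'd.
  exact: log2_norm_near (neq0 _ _ _ jj) om0.
exists dlt => // S th Xth Sdlt Dle; rewrite leNgt; apply/negP => /ltW/(sep _ Xth).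
move=> [a [b mab]].
(* The objective only sees entries on or above the diagonal, whereas separation may produce one
   below it. *)
wlog ab : a b mab / (a <= b)%N.
  move=> W; have [/W|/ltnW ba] := leqP a b; first exact.
  by apply: W ba; rewrite (E_sym th) (E_sym th0).
have close j i1 i2 : j1 <= j <= j2 -> S j i1 i2 != 0 /\
    `|log2 `|S j i1 i2| - log2 `|E j th0 i1 i2| | <= om.
  move=> jj; apply: (hdlt j _ (i1, i2)); rewrite ?mem_scales ?mem_enum//.
  exact: Sdlt.
have D0 : (log_distance j1 j2 S (E ^~ th0) <= (om ^+ 2 * (size (scales j1 j2) * p * p)%:R)%:E)%E.
  apply: log_distance_le => //; first exact: sqr_ge0.
  move=> j i1 i2 jj; have [S0 Som] := close j i1 i2 jj; split => //; first exact: neq0.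
  by rewrite -[leLHS]real_normK ?num_real// lerXn2r// nnegrE// ltW.
have [Eth0 hsq] := log_distance_leP j12 (le_trans Dle D0) jsP ab.
have [S0 Som] := close js a b jsP.
have hS : `|log2 `|S js a b| - log2 `|E js th a b| | <= k / 2.
  have k20 : 0 <= k / 2 by rewrite divr_ge0// ltW.
  rewrite -(ler_pXn2r (ltn0Sn 1)) ?nnegrE//.
  rewrite real_normK ?num_real//; apply: (le_trans hsq).
  have -> : (k / 2) ^+ 2 = om ^+ 2 * n%:R ^+ 2.
    by rewrite /om; field; rewrite gt_eqF.
  rewrite ler_pM2l ?exprn_gt0//.
  by rewrite -natrX ler_nat (leq_trans (leqnSn _))// /n -[leqLHS]expn1 leq_pexp2l.
have := hk (a, b) (mem_enum _ _) _ Eth0.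
have -> : `|log2 `|E js th a b| - log2 `|E js th0 a b| | <= k.
  have -> : log2 `|E js th a b| - log2 `|E js th0 a b| =
    - (log2 `|S js a b| - log2 `|E js th a b|) + (log2 `|S js a b| - log2 `|E js th0 a b|) by ring.
  rewrite (le_trans (ler_normD _ _))// normrN [k in leRHS]splitr lerD//.
  exact: le_trans Som omk.
by move=> /(_ isT); rewrite ltNge mab.
Qed.

End ArgminStability.

(** * Convergence of the estimator *)

Lemma uniform_rank (I : eqType) (s : seq I) (Q : I -> nat -> Prop) :
  (forall i, i \in s -> exists N0, forall N, (N0 <= N)%N -> Q i N) ->
  exists N0, forall N, (N0 <= N)%N -> forall i, i \in s -> Q i N.
Proof.
elim: s => [|i s IH] h; first by exists 0%N.
have [|N1 h1] := IH; first by move=> k ks; apply: h; rewrite inE ks orbT.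
have [N2 h2] := h i (mem_head _ _).
exists (maxn N1 N2) => N; rewrite geq_max => /andP[N1N N2N] k.
by rewrite inE => /predU1P[->|ks]; [exact: h2|exact: h1].
Qed.

Lemma probability_bigsetU_le d (T : measurableType d) (R : realType)
    (P : probability T R) (I : eqType) (s : seq I) (A : I -> set T) (eta : R) :
  (forall i, measurable (A i)) -> (forall i, i \in s -> (P (A i) <= eta%:E)%E) ->
  (P (\big[setU/set0]_(i <- s) A i) <= (eta *+ size s)%:E)%E.
Proof.
move=> mA; elim: s => [|i s IH] h; first by rewrite big_nil measure0 mulr0n.
rewrite big_cons/= mulrS EFinD.
have mU : measurable (\big[setU/set0]_(k <- s) A k) by exact: bigsetU_measurable.
apply: (le_trans (measureU2 _ _ _)) => //; apply: leeD; first by rewrite h ?mem_head.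
by apply: IH => k ks; rewrite h// inE ks orbT.
Qed.

Lemma random_vector_open d (T : measurableType d) (R : realType) (V : topologicalType)
    (f : T -> V) (A : set V) : random_vector f -> open A -> measurable (f @^-1` A).
Proof. by move=> rf oA; apply: rf => M [_]; exact. Qed.

Lemma open_dist_gt (R : realType) (V : normedModType R) (x : V) (e : R) :
  open [set y | e < `|y - x|].
Proof.
apply: (@open_comp _ _ (fun y => `|y - x|) [set r | e < r]); last exact: open_gt.
by move=> y _; apply: cvg_norm; apply: cvgB; [exact: cvg_id|exact: cvg_cst].
Qed.

Unset Implicit Arguments.
Theorem theorem5p2 (R : realType) (p d : nat) (p_ge2 : (2 <= p)%N)
  (j1 j2 : int) (j1_lt_j2 : j1 < j2)
  (* parameter set and parametric family of OfBm laws *)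
  (Xi : set 'rV[R]_d) (Xi_compact : compact Xi)
  (dM : 'rV[R]_d -> measure_display)
  (TM : forall th : 'rV[R]_d, measurableType (dM th))
  (PM : forall th : 'rV[R]_d, probability (TM th) R)
  (X : forall th : 'rV[R]_d, TM th -> R -> 'cV[R]_p)
  (X_ofbm : forall th, Xi th ->
     measurable_process (X th) /\ exists H : 'M[R]_p, ofbm (PM th) H (X th))
  (* observed process *)
  (dT : measure_display) (T : measurableType dT) (Pr : probability T R)
  (Y : T -> R -> 'cV[R]_p) (Y_meas : measurable_process Y)
  (th0 : 'rV[R]_d) (th0_in : Xi th0) (Y_law : same_fdd Pr (PM th0) Y (X th0))
  (* (OFBM1)-(OFBM3) *)
  (OFBM1 : exists2 H : 'M[R]_p, ofbm Pr H Y & hurst_spectrum H)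
  (OFBM2 : forall t : R, t != 0 -> \rank (second_moment Pr (Y ^~ t)) = p)
  (OFBM3 : time_reversible Pr Y)
  (* wavelet and (W1)-(W3) *)
  (psi0 : R -> R)
  (psi0_L1 : psi0 \in Lfun (@lebesgue_measure R) 1)
  (psi0_L2 : psi0 \in Lfun (@lebesgue_measure R) 2%:E)
  (psi0_basis : wavelet_orthonormal_basis psi0)
  (Npsi : nat) (Npsi_ge2 : (2 <= Npsi)%N)
  (W1 : vanishing_moments psi0 Npsi)
  (W2 : compact_interval_support psi0)
  (W3 : polynomial_decay psi0) :
  let E (j : int) (th : 'rV[R]_d) : 'M[R]_p :=
    wavelet_spectrum (PM th) psi0 (X th) j in
  let S (N : nat) (w : T) (j : int) : 'M[R]_p :=
    sample_spectrum psi0 Y N j w in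
  let C (N : nat) (w : T) (th : 'rV[R]_d) : \bar R :=
    log_distance j1 j2 (S N w) (E ^~ th) in
  let sizes : set nat := admissible_size (R := R) j1 j2 in
  forall
  (i_interior : Xi^° th0)
  (ii_identif : exists2 js : int, j1 <= js <= j2 &
     forall th th', Xi th -> Xi th' -> th <> th' ->
       exists i1 i2 : 'I_p, `|E js th i1 i2| <> `|E js th' i1 i2|)
  (iii_nonzero : forall (i1 i2 : 'I_p) (j : int), j1 <= j <= j2 ->
     E j th0 i1 i2 <> 0)
  (iv_smooth : forall j : int, j1 <= j <= j2 ->
     {within Xi, continuous (E j)} /\ Cn_on 3 Xi^° (E j))
  (thM : nat -> T -> 'rV[R]_d)
  (thM_rv : forall N, sizes N -> random_vector (thM N))
  (thM_in : forall N, sizes N -> forall w, Xi (thM N w))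
  (thM_min : forall N, sizes N ->
     {ae Pr, forall w, forall th, Xi th -> (C N w (thM N w) <= C N w th)%E}),
  cvg_in_probability Pr (within sizes \oo) thM th0.
Proof.
move=> E S C sizes i_interior ii_identif iii_nonzero iv_smooth thM thM_rv thM_in thM_min e e0.
have [H oY hH] := OFBM1; have [mX [HX oX]] := X_ofbm th0 th0_in.
have [js jsP ident] := ii_identif.
have j12 : j1 <= j2 := ltW j1_lt_j2.
have Npsi0 : (0 < Npsi)%N := ltnW Npsi_ge2.
(* The model at [th0] and the observed process live on different probability spaces and share only
   their finite-dimensional laws. *)
have E0 j : E j th0 = wavelet_spectrum Pr psi0 Y j.
  by rewrite /E -(wavelet_spectrum_same_fdd j Y_meas mX oY oX psi0_L1 W2 Y_law).
have E_sym th i1 i2 : E js th i1 i2 = E js th i2 i1 by exact: wavelet_spectrum_sym.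
have [dlt dlt0 stab] := argmin_stable j12 jsP Xi_compact (iv_smooth js jsP).1 E_sym
  (fun th Xth => ident th th0 Xth th0_in) iii_nonzero e0.
pose s := [seq (j, ii) | j <- scales j1 j2, ii <- enum {: 'I_p * 'I_p}].
pose B N (q : int * ('I_p * 'I_p)) :=
  [set w | (dlt <= `|S N w q.1 q.2.1 q.2.2 - E q.1 th0 q.2.1 q.2.2|)%R].
have mB N q : measurable (B N q).
  have mn : measurable_fun setT (fun w => `|S N w q.1 q.2.1 q.2.2 - E q.1 th0 q.2.1 q.2.2|).
    apply: measurableT_comp => //; apply: measurable_funB => //.
    exact: measurable_sample_spectrum Y_meas oY psi0_L1 W2 _ _ _ _.
  have := measurable_fun_ler (measurable_cst dlt) mn => /(_ measurableT [set true]).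
  by rewrite setTI; apply.
have event_le N : sizes N -> measurable [set w | e < `|thM N w - th0|] /\
    (Pr [set w | (e < `|thM N w - th0|)%R] <= Pr (\big[setU/set0]_(q <- s) B N q))%E.
  move=> sN.
  have mev : measurable [set w | e < `|thM N w - th0|].
    exact: random_vector_open (thM_rv N sN) (open_dist_gt th0 e).
  split => //.
  have mU : measurable (\big[setU/set0]_(q <- s) B N q) by exact: bigsetU_measurable.
  have [A [mA PA subA]] := thM_min N sN.
  (* [A] is a null set outside which the estimator minimizes the objective; there a deviation larger
     than [e] forces one entry of the sample spectrum to be off by at least [dlt]. *)
  apply: (@le_trans _ _ (Pr (A `|` \big[setU/set0]_(q <- s) B N q))).
    apply: le_measure; rewrite ?inE//; first exact: measurableU.
    move=> w /= ew; rewrite -bigcup_seq.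
    have [wA|/contrapT Aw] := pselect (~ A w); last by left.
    right; apply: contrapT => wB; move: ew; apply/negP; rewrite -leNgt.
    have minw : [set w | forall th, Xi th -> (C N w (thM N w) <= C N w th)%E] w.
      by apply: contrapT => nw; apply: wA; exact: subA.
    apply: (stab (S N w) (thM N w) (thM_in N sN w) _ (minw th0 th0_in)) => j i1 i2 jj.
    rewrite ltNge; apply/negP => Bw; apply: wB; exists (j, (i1, i2)) => //=.
    by apply/allpairsP; exists (j, (i1, i2)); rewrite mem_scales ?mem_enum.
  apply: (le_trans (measureU2 _ _ _)) => //.
  by rewrite [X in (X + _)%E](_ : _ = 0%E) ?add0e.
apply/fine_cvgP; split.
  rewrite near_withinE; apply: nearW => N sN.
  exact: fin_num_measure (event_le N sN).1.
apply/cvgrPdist_le => eta eta0; rewrite near_withinE.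
(* An equal share for each bad event of the union bound; the successor keeps the denominator
   positive. *)
pose eta' := eta / (size s).+1%:R.
have eta'0 : 0 < eta' by rewrite divr_gt0.
have [N0 HN0] : exists N0, forall N, (N0 <= N)%N -> forall q, q \in s -> (Pr (B N q) <= eta'%:E)%E.
  apply: uniform_rank => -[j [i1 i2]] _; rewrite /B/= E0.
  exact: (sample_spectrum_consistent Y_meas oY hH psi0_L1 Npsi0 W1 W2).
exists N0 => // N /= N0N sN; have [mev le_ev] := event_le N sN.
rewrite sub0r normrN ger0_norm ?fine_ge0//.
rewrite -lee_fin fineK ?fin_num_measure//.
apply: (le_trans le_ev); apply: (le_trans (probability_bigsetU_le (mB N) (HN0 N N0N))).
rewrite lee_fin -mulr_natr mulrAC ler_pdivrMr// ler_pM2l// ler_nat.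
exact: leqnSn.
Qed.
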